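(* The \textsc{Paw-free Edge Deletion} problem, parameterized by $k$, admits a kernel of size $\mathcal{O}(k^3)$: there is a polynomial-time algorithm that, given an instance $(G,k)$, outputs an equivalent instance $(G',k')$ of the same problem with $k'\le k$ and $G'$ having $\mathcal{O}(k^3)$ vertices.
   Context: The paw is the graph on four vertices $x_1,x_2,x_3,x_4$ with edges $x_1x_2,x_2x_3,x_1x_3,x_3x_4$. A graph is paw-free if it has no induced subgraph isomorphic to the paw. \textsc{Paw-free Edge Deletion}: given a graph $G$ and an integer $k$, decide whether there is a set $A\subseteq E(G)$ with $|A|\le k$ such that $G-A$ is paw-free. A kernel is a polynomial-time algorithm mapping an instance to an equivalent instance whose size is bounded by a function of $k$ only. *)

(* Defs.v *)
From mathcomp Require Import all_boot.
Set Implicit Arguments. Unset Strict Implicit. Unset Printing Implicit Defensive.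

Record graph := Graph {
  vn : nat;
  adj : 'I_vn -> 'I_vn -> bool;
  adj_sym : forall x y, adj x y = adj y x;
  adj_irr : forall x, adj x x = false }.
Arguments adj : clear implicits.

Definition induced_paw (n : nat) (e : 'I_n -> 'I_n -> bool) (x1 x2 x3 x4 : 'I_n) : bool :=
  [&& uniq [:: x1; x2; x3; x4],
      e x1 x2, e x2 x3, e x1 x3, e x3 x4, ~~ e x1 x4 & ~~ e x2 x4].

Definition paw_free (n : nat) (e : 'I_n -> 'I_n -> bool) : Prop :=
  forall x1 x2 x3 x4 : 'I_n, ~~ induced_paw e x1 x2 x3 x4.

Definition delete_edges (G : graph) (A : {set {set 'I_(vn G)}}) :
  'I_(vn G) -> 'I_(vn G) -> bool :=
  fun x y => adj G x y && ([set x; y] \notin A).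

Definition paw_free_edge_deletion (G : graph) (k : nat) : Prop :=
  exists A : {set {set 'I_(vn G)}},
    (forall a, a \in A -> exists x y, adj G x y /\ a = [set x; y]) /\
    #|A| <= k /\ paw_free (delete_edges A).

Definition bin (m : nat) : seq bool :=
  if m is 0 then [::] else [seq odd (m %/ 2 ^ i) | i <- iota 0 (trunc_log 2 m).+1].

(* self-delimiting field: each bit b becomes [true; b], terminated by [false; false] *)
Definition field (s : seq bool) : seq bool :=
  flatten [seq [:: true; b] | b <- s] ++ [:: false; false].

Definition adj_bits (G : graph) : seq bool :=
  [seq adj G i j | i <- enum 'I_(vn G), j <- enum 'I_(vn G)].

Definition encode (G : graph) (k : nat) : seq bool :=
  field (bin (vn G)) ++ field (bin k) ++ field (adj_bits G).

Inductive dir := DL | DR | DS.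

Record TM := {
  tm_state : finType;
  tm_start : tm_state;
  tm_halt : tm_state -> bool;
  tm_trans : tm_state -> option bool -> tm_state * option bool * dir }.
Arguments tm_start : clear implicits.
Arguments tm_halt : clear implicits.
Arguments tm_trans : clear implicits.

(* configuration: state, left part of tape (reversed, nearest cell first),
   scanned symbol, right part of tape; None is the blank symbol *)
Definition config (M : TM) : Type :=
  (tm_state M * seq (option bool) * option bool * seq (option bool))%type.

Definition tm_init (M : TM) (w : seq bool) : config M :=
  match w with
  | [::] => (tm_start M, [::], None, [::])
  | b :: w' => (tm_start M, [::], Some b, map Some w')
  end.

Definition tm_step (M : TM) (c : config M) : config M :=
  let: (q, l, h, r) := c in
  if tm_halt M q then c else
  let: (q', a, d) := tm_trans M q h in
  match d with
  | DS => (q', l, a, r)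
  | DL => match l with
          | [::] => (q', [::], None, a :: r)
          | x :: l' => (q', l', x, a :: r)
          end
  | DR => match r with
          | [::] => (q', a :: l, None, [::])
          | x :: r' => (q', a :: l, x, r')
          end
  end.

Definition tm_run (M : TM) (w : seq bool) (t : nat) : config M :=
  iter t (@tm_step M) (tm_init M w).

Fixpoint read_word (s : seq (option bool)) : seq bool :=
  match s with
  | Some b :: s' => b :: read_word s'
  | _ => [::]
  end.

Definition tm_halted (M : TM) (c : config M) : bool :=
  let: (q, _, _, _) := c in tm_halt M q.

Definition tm_output (M : TM) (c : config M) : seq bool :=
  let: (_, _, h, r) := c in read_word (h :: r).

Definition halts_within (M : TM) (w : seq bool) (t : nat) (y : seq bool) : Prop :=
  tm_halted (tm_run M w t) /\ tm_output (tm_run M w t) = y.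

(* Main.v *)
Require Import Defs.
From mathcomp Require Import all_boot.
From mathcomp Require Import zify.
Set Implicit Arguments. Unset Strict Implicit. Unset Printing Implicit Defensive.

(* Two kinds of reductions are applied exhaustively. An edge is
   deleted, and k decreases, if keeping it requires more than k other deletions.
   A vertex v is isolated if its component is complete multipartite, or if for all
   relevant a, b, c more than k vertices look like v towards a, b, c (or if this
   holds for the false twin class of v, with look-alikes outside the class). If
   more than 76 k^3 + 76 vertices then still have an edge, the answer is no: for a
   solution A with at most 2k endpoints S, a vertex v outside S with an edge falls
   into one of three cases.
   - v lies in a triangle of G - A. Its component in G - A is complete multipartite
     and meets S; each part outside S consists of false twins, and parts avoiding S
     look alike, so O(k^2) vertices survive.
   - v lies in triangles of G only. Their edges opposite to v are in A; apart from
     O(k^2) exceptions bounded by the edge rule, the neighbourhoods of such vertices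
     lie in S and are equal or disjoint, so there are O(k) false twin classes.
   - v lies in no triangle. Then v is adjacent to a triangle vertex that is in S or
     one of O(k^2) exceptions, each of which keeps at most k + 1 such neighbours.
   The rules are formulas with counting quantifiers, evaluated by nested loops in a
   small language of programs on stacks, which is compiled to a Turing machine. *)

(** A paw through a vertex only sees its adjacency to three other vertices, which is why look-alikes
    are tested against triples: such a rule has a bounded number of quantifiers, so it can be
    checked in polynomial time. A solution of the reduced graph gives one of the original graph, no
    larger, by dropping its edges at the isolated vertex, at its twin class or in its component.
    Vertices are isolated rather than deleted, so that the matrix keeps its shape and vertices keep
    their names; isolated vertices lie in no paw and disappear on output only. The rules depend on
    the current [k] and may enable each other, so rounds of all rules are repeated [n * n] times: an
    effective round loses an ordered adjacent pair, hence the last state is stable. The parameter is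
    given in binary and may exceed every polynomial in the input length; it is first capped at
    [n * n], where every instance is solvable. The size bound holds for solvable instances only, so
    an oversized one is answered by the paw with parameter 0. *)

(** * Runs of Turing machines and machine combinators *)

Definition tape := (seq (option bool) * option bool * seq (option bool))%type.

Definition conf (M : TM) (q : tm_state M) (x : tape) : config M :=
  (q, x.1.1, x.1.2, x.2).
Arguments conf : simpl never.
Arguments tm_step : simpl never.

Definition mv (x : tape) (a : option bool) (d : dir) : tape :=
  match d with
  | DS => (x.1.1, a, x.2)
  | DL => if x.1.1 is b :: l then (l, b, a :: x.2) else ([::], None, a :: x.2)
  | DR => if x.2 is b :: r then (a :: x.1.1, b, r) else (a :: x.1.1, None, [::])
  end.

Lemma conf_inj (M : TM) (q q' : tm_state M) x y :
  conf q x = conf q' y -> q = q' /\ x = y.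
Proof. by case: x y => [[? ?] ?] [[? ?] ?] [-> -> -> ->]. Qed.

Lemma tm_step_conf (M : TM) (q : tm_state M) (x : tape) :
  tm_step (conf q x) =
  if tm_halt M q then conf q x
  else let: (q', a, d) := tm_trans M q x.1.2 in conf q' (mv x a d).
Proof.
case: x => [[l h] r]; rewrite /conf /tm_step /=.
by case: (tm_halt M q) => //; case: (tm_trans M q h) => [[q' a] []] //; [case: l | case: r].
Qed.

(** Only an upper bound on the number of steps is recorded, so costs compose by inequalities and may
    be rounded up. *)
Definition steps (M : TM) (c c' : config M) (t : nat) : Prop :=
  exists2 u, u <= t & iter u (@tm_step M) c = c'.

Lemma steps_trans M (c1 c2 c3 : config M) t1 t2 t :
  steps c1 c2 t1 -> steps c2 c3 t2 -> t1 + t2 <= t -> steps c1 c3 t.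
Proof.
move=> [u1 l1 <-] [u2 l2 <-] ht; exists (u2 + u1); first lia.
by rewrite iterD.
Qed.

Lemma steps0 M (c : config M) t : steps c c t.
Proof. by exists 0. Qed.

Lemma steps1 M (q q' : tm_state M) (x y : tape) a d :
  ~~ tm_halt M q -> tm_trans M q x.1.2 = (q', a, d) -> y = mv x a d ->
  steps (conf q x) (conf q' y) 1.
Proof.
by move=> /negPf hq tq ->; exists 1 => //=; rewrite tm_step_conf hq tq.
Qed.

Lemma steps_jump M (q q' : tm_state M) (x : tape) :
  ~~ tm_halt M q -> tm_trans M q x.1.2 = (q', x.1.2, DS) ->
  steps (conf q x) (conf q' x) 1.
Proof. by move=> hq tq; apply: (steps1 hq tq); case: x {tq} => [[]]. Qed.

Definition mruns (M : TM) (x y : tape) (t : nat) : Prop :=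
  exists2 q, tm_halt M q & steps (conf (tm_start M) x) (conf q y) t.

Lemma mruns_le M x y t t' : mruns M x y t -> t <= t' -> mruns M x y t'.
Proof. by move=> [q hq [u lu e]] le; exists q => //; exists u => //; apply: leq_trans le. Qed.

(** A combinator agrees with its component [M] only until [M] halts, and then takes over. Idle steps
    in a halting state are therefore dropped, which the bound [t] permits. *)
Lemma steps_embed (M N : TM) (f : tm_state M -> tm_state N) :
  (forall q, ~~ tm_halt M q -> ~~ tm_halt N (f q)) ->
  (forall q h, ~~ tm_halt M q ->
     tm_trans N (f q) h = (f (tm_trans M q h).1.1, (tm_trans M q h).1.2, (tm_trans M q h).2)) ->
  forall q q' x y t, tm_halt M q' ->
  steps (conf q x) (conf q' y) t -> steps (conf (f q) x) (conf (f q') y) t.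
Proof.
move=> hh ht q q' x y t hq' [u lu]; elim: u q x t lu => [|u IH] q x t lu /=.
  by move/conf_inj=> [-> ->]; apply: steps0.
rewrite -iterS iterSr tm_step_conf; case: ifPn => hq.
  by move=> e; apply: (IH q x t) => //; lia.
case E: (tm_trans M q x.1.2) => [[q1 a] d] e.
apply: (@steps_trans _ _ (conf (f q1) (mv x a d)) _ 1 t.-1); last lia; last first.
  by apply: IH => //; lia.
by apply: steps1; [exact: hh | rewrite ht // E |].
Qed.

Definition MSkip : TM := @Build_TM unit tt xpredT (fun q h => (q, h, DS)).

Definition MOne (f : option bool -> option bool) (d : dir) : TM :=
  @Build_TM bool false id (fun _ h => (true, f h, d)).

Definition MSeq (M1 M2 : TM) : TM :=
  @Build_TM (tm_state M1 + tm_state M2)%type (inl (tm_start M1))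
    (fun q => if q is inr q2 then tm_halt M2 q2 else false)
    (fun q h => match q with
     | inl q1 => if tm_halt M1 q1 then (inr (tm_start M2), h, DS)
                 else let: (q', a, d) := tm_trans M1 q1 h in (inl q', a, d)
     | inr q2 => let: (q', a, d) := tm_trans M2 q2 h in (inr q', a, d)
     end).

Definition MCond (p : pred (option bool)) (M1 M2 : TM) : TM :=
  @Build_TM (option (tm_state M1 + tm_state M2)) None
    (fun q => match q with
     | None => false | Some (inl q1) => tm_halt M1 q1 | Some (inr q2) => tm_halt M2 q2 end)
    (fun q h => match q with
     | None => (Some (if p h then inl (tm_start M1) else inr (tm_start M2)), h, DS)
     | Some (inl q1) => let: (q', a, d) := tm_trans M1 q1 h in (Some (inl q'), a, d)
     | Some (inr q2) => let: (q', a, d) := tm_trans M2 q2 h in (Some (inr q'), a, d)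
     end).

(* Repeat [A]; then continue with [B] and start again if the scanned symbol
   satisfies [p], and finish with [E] otherwise. *)
Definition MLoop (p : pred (option bool)) (A B E : TM) : TM :=
  @Build_TM (tm_state A + tm_state B + tm_state E)%type (inl (inl (tm_start A)))
    (fun q => if q is inr q3 then tm_halt E q3 else false)
    (fun q h => match q with
     | inl (inl q1) =>
         if tm_halt A q1
         then (if p h then inl (inr (tm_start B)) else inr (tm_start E), h, DS)
         else let: (q', a, d) := tm_trans A q1 h in (inl (inl q'), a, d)
     | inl (inr q2) =>
         if tm_halt B q2 then (inl (inl (tm_start A)), h, DS)
         else let: (q', a, d) := tm_trans B q2 h in (inl (inr q'), a, d)
     | inr q3 => let: (q', a, d) := tm_trans E q3 h in (inr q', a, d)
     end).

Lemma mruns_skip x t : mruns MSkip x x t.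
Proof. by exists tt => //; apply: steps0. Qed.

Lemma mruns_one f d x : mruns (MOne f d) x (mv x (f x.1.2) d) 1.
Proof. by exists true => //; apply: steps1. Qed.

Lemma mruns_seq M1 M2 x y z t1 t2 t :
  mruns M1 x y t1 -> mruns M2 y z t2 -> t1 + t2 < t -> mruns (MSeq M1 M2) x z t.
Proof.
move=> [q1 h1 s1] [q2 h2 s2] ht; exists (inr q2) => //.
have s1' := @steps_embed M1 (MSeq M1 M2) inl _ _ _ _ _ _ _ h1 s1.
have s2' := @steps_embed M2 (MSeq M1 M2) inr _ _ _ _ _ _ _ h2 s2.
apply: (steps_trans (t1 := t1) (t2 := t2.+1)) (s1' _ _) _ _; try lia.
- by [].
- by move=> q h /negPf /= ->; case: tm_trans => [[]].
apply: (steps_trans (t1 := 1) (t2 := t2)) _ (s2' _ _) _ => //; last first.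
  by move=> q h _ /=; case: tm_trans => [[]].
by apply: steps_jump; rewrite /= ?h1.
Qed.

Lemma mruns_seqE M1 M2 x y z t1 t2 :
  mruns M1 x y t1 -> mruns M2 y z t2 -> mruns (MSeq M1 M2) x z (t1 + t2).+1.
Proof. by move=> h1 h2; apply: mruns_seq h1 h2 _. Qed.

Lemma mruns_cond (p : pred (option bool)) M1 M2 x y t :
  mruns (if p x.1.2 then M1 else M2) x y t -> mruns (MCond p M1 M2) x y t.+1.
Proof.
case: ifP => hp [q hq s].
- have s' := @steps_embed M1 (MCond p M1 M2) (Some \o inl) _ _ _ _ _ _ _ hq s.
  exists (Some (inl q)) => //.
  apply: (steps_trans (t1 := 1) (t2 := t)) _ (s' _ _) _ => //; last first.
    by move=> ? h _ /=; case: tm_trans => [[]].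
  by apply: steps_jump; rewrite /= ?hp.
- have s' := @steps_embed M2 (MCond p M1 M2) (Some \o inr) _ _ _ _ _ _ _ hq s.
  exists (Some (inr q)) => //.
  apply: (steps_trans (t1 := 1) (t2 := t)) _ (s' _ _) _ => //; last first.
    by move=> ? h _ /=; case: tm_trans => [[]].
  by apply: steps_jump; rewrite /= ?hp.
Qed.

Lemma mruns_loop_stop (p : pred (option bool)) A B E x y z tA tE t :
  mruns A x y tA -> ~~ p y.1.2 -> mruns E y z tE -> tA + tE < t ->
  mruns (MLoop p A B E) x z t.
Proof.
move=> [qA hA sA] /negPf hp [qE hE sE] ht; exists (inr qE) => //.
have sA' := @steps_embed A (MLoop p A B E) (inl \o inl) _ _ _ _ _ _ _ hA sA.
have sE' := @steps_embed E (MLoop p A B E) inr _ _ _ _ _ _ _ hE sE.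
apply: (steps_trans (t1 := tA) (t2 := tE.+1)) (sA' _ _) _ _; try lia.
- by [].
- by move=> q h /negPf /= ->; case: tm_trans => [[]].
apply: (steps_trans (t1 := 1) (t2 := tE)) _ (sE' _ _) _ => //; last first.
  by move=> ? h _ /=; case: tm_trans => [[]].
by apply: steps_jump; rewrite /= ?hA ?hp.
Qed.

Lemma mruns_loop_next (p : pred (option bool)) A B E x y z w tA tB t t' :
  mruns A x y tA -> p y.1.2 -> mruns B y z tB -> mruns (MLoop p A B E) z w t ->
  tA + tB + t + 2 <= t' -> mruns (MLoop p A B E) x w t'.
Proof.
move=> [qA hA sA] hp [qB hB sB] [q hq s] ht; exists q => //.
have sA' := @steps_embed A (MLoop p A B E) (inl \o inl) _ _ _ _ _ _ _ hA sA.
have sB' := @steps_embed B (MLoop p A B E) (inl \o inr) _ _ _ _ _ _ _ hB sB.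
apply: (steps_trans (t1 := tA) (t2 := (tB + t + 2))) (sA' _ _) _ _; try lia.
- by [].
- by move=> ? h /negPf /= ->; case: tm_trans => [[]].
apply: (steps_trans (t1 := 1) (t2 := (tB + t + 1))); [|shelve|lia].
  by apply: (@steps_jump (MLoop p A B E) _ (inl (inr (tm_start B))) y); rewrite /= ?hA ?hp.
Unshelve.
apply: (steps_trans (t1 := tB) (t2 := t.+1)) (sB' _ _) _ _; try lia.
- by [].
- by move=> ? h /negPf /= ->; case: tm_trans => [[]].
apply: (steps_trans (t1 := 1) (t2 := t)) _ s _ => //.
by apply: steps_jump; rewrite /= ?hB.
Qed.

Fixpoint MIter (M : TM) (i : nat) : TM :=
  if i is j.+1 then MSeq M (MIter M j) else MSkip.

Definition MRight := MOne id DR.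
Definition MLeft := MOne id DL.

(* Move from a blank to the next blank in direction [d]. *)
Definition MWalk (d : dir) : TM :=
  @Build_TM (option bool) None (fun q => q == Some true)
    (fun q h => match q, h with
     | None, _ => (Some false, h, d)
     | Some _, None => (Some true, h, DS)
     | Some _, Some _ => (Some false, h, d)
     end).

(* Copy each cell to its neighbour in direction [d], up to and including the
   first blank; the state carries the symbol read last. *)
Definition MShift (d : dir) : TM :=
  @Build_TM (option (option bool)) (Some None) (fun q => q == None)
    (fun q h => match q, h with
     | None, _ => (None, h, DS)
     | Some c, None => (None, c, d)
     | Some c, Some _ => (Some h, c, d)
     end).

(** The head stands where two lists meet, on the near end of one of them. An empty list contributes
    a blank cell, since the tape is blank beyond its end. *)
Definition at_left (l r : seq (option bool)) : tape :=
  if l is a :: l' then (l', a, r) else ([::], None, r).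
Definition at_right (l r : seq (option bool)) : tape :=
  if r is a :: r' then (l, a, r') else (l, None, [::]).

Lemma mruns_walkR l (s : seq bool) r :
  mruns (MWalk DR) (l, None, map Some s ++ None :: r)
        (rev (map Some s) ++ None :: l, None, r) (size s + 2).
Proof.
have loop : forall l0, steps
    (@conf (MWalk DR) (Some false) (at_right l0 (map Some s ++ None :: r)))
    (@conf (MWalk DR) (Some true) (rev (map Some s) ++ l0, None, r)) (size s).+1.
  elim: s => [|b s IH] l0 /=; first exact: steps1.
  apply: (steps_trans (t1 := 1) (t2 := (size s).+1) (c2 := @conf (MWalk DR) (Some false)
    (at_right (Some b :: l0) (map Some s ++ None :: r)))) => //; first exact: steps1.
  by have := IH (Some b :: l0); rewrite rev_cons cat_rcons.
exists (Some true) => //.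
by apply: (steps_trans (t1 := 1)) _ (loop (None :: l)) _; [exact: steps1 | lia].
Qed.

Lemma mruns_walkL l (s : seq bool) r :
  mruns (MWalk DL) (rev (map Some s) ++ None :: l, None, r)
        (l, None, map Some s ++ None :: r) (size s + 2).
Proof.
have loop : forall r0, steps
    (@conf (MWalk DL) (Some false) (at_left (rev (map Some s) ++ None :: l) r0))
    (@conf (MWalk DL) (Some true) (l, None, map Some s ++ r0)) (size s).+1.
  elim/last_ind: s => [|s b IH] r0 /=; first exact: steps1.
  rewrite map_rcons rev_rcons size_rcons /=.
  apply: (steps_trans (t1 := 1) (t2 := (size s).+1) (c2 := @conf (MWalk DL) (Some false)
    (at_left (rev (map Some s) ++ None :: l) (Some b :: r0)))) => //; first exact: steps1.
  by have := IH (Some b :: r0); rewrite cat_rcons.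
exists (Some true) => //.
by apply: (steps_trans (t1 := 1)) _ (loop (None :: r)) _; [exact: steps1 | lia].
Qed.

Lemma mruns_shiftL l (s : seq bool) r :
  mruns (MShift DL) (at_left (rev (map Some s) ++ None :: l) r)
        (at_left l (map Some s ++ None :: r)) (size s).+1.
Proof.
exists None => //=.
(* The state carries an arbitrary symbol [c] through the induction; the start state carries a
   blank. *)
suff H c r0 : steps (@conf (MShift DL) (Some c) (at_left (rev (map Some s) ++ None :: l) r0))
  (@conf (MShift DL) None (at_left l (map Some s ++ c :: r0))) (size s).+1 by exact: H.
elim/last_ind: s c r0 => [|s b IH] c r0 /=; first exact: steps1.
rewrite map_rcons rev_rcons size_rcons /=.
apply: (steps_trans (t1 := 1) (t2 := (size s).+1) (c2 := @conf (MShift DL) (Some (Some b))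
    (at_left (rev (map Some s) ++ None :: l) (c :: r0)))) => //; first exact: steps1.
by have := IH (Some b) (c :: r0); rewrite cat_rcons.
Qed.

Lemma mruns_shiftR l (s : seq bool) r :
  mruns (MShift DR) (at_right l (map Some s ++ None :: r))
        (at_right (rev (map Some s) ++ None :: l) r) (size s).+1.
Proof.
exists None => //=.
suff H c l0 : steps (@conf (MShift DR) (Some c) (at_right l0 (map Some s ++ None :: r)))
  (@conf (MShift DR) None (at_right (rev (map Some s) ++ c :: l0) r)) (size s).+1 by exact: H.
elim: s c l0 => [|b s IH] c l0 /=; first exact: steps1.
apply: (steps_trans (t1 := 1) (t2 := (size s).+1) (c2 := @conf (MShift DR) (Some (Some b))
    (at_right (c :: l0) (map Some s ++ None :: r)))) => //; first exact: steps1.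
by have := IH (Some b) (c :: l0); rewrite rev_cons cat_rcons.
Qed.

(** * A language of stack programs *)

Inductive cmd :=
| Skip
| Push (i : nat) (b : bool)
| Pop (i : nat)
| Seq (c1 c2 : cmd)
| If (i : nat) (p : pred bool) (c1 c2 : cmd)
| While (i : nat) (p : pred bool) (c : cmd).

Definition env := seq (seq bool).

(** The empty stack fails every test: [xpredT] asks for a nonempty stack, [id] for [true] on top. *)
Definition test (p : pred bool) (s : seq bool) : bool :=
  if s is b :: _ then p b else false.

Fixpoint iterR (i : nat) (p : pred bool) (R : env -> env -> Prop) (j : nat) (s s' : env) : Prop :=
  i < size s /\
  if j is j'.+1 then test p (nth [::] s i) /\ exists2 s1, R s s1 & iterR i p R j' s1 s'
  else test p (nth [::] s i) = false /\ s' = s.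

(* Every loop of the execution makes at most [B] iterations; for a fixed program
   this bounds the running time by a polynomial in [B] and the initial size. *)
Fixpoint exec (B : nat) (c : cmd) (s s' : env) : Prop :=
  match c with
  | Skip => s' = s
  | Push i b => i < size s /\ s' = set_nth [::] s i (b :: nth [::] s i)
  | Pop i => [/\ i < size s, nth [::] s i != [::] & s' = set_nth [::] s i (behead (nth [::] s i))]
  | Seq c1 c2 => exists2 s1, exec B c1 s s1 & exec B c2 s1 s'
  | If i p c1 c2 =>
      i < size s /\ if test p (nth [::] s i) then exec B c1 s s' else exec B c2 s s'
  | While i p c => exists2 j, j <= B & iterR i p (exec B c) j s s'
  end.

(** The walks end on the blank before stack [i]; the next cell holds its top, or a blank if the
    stack is empty. *)
Definition MPeek (i : nat) : TM := MSeq (MIter (MWalk DR) i) MRight.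
Definition MBack (i : nat) : TM := MSeq MLeft (MIter (MWalk DL) i).

Definition lift_test (p : pred bool) : pred (option bool) := fun h => if h is Some b then p b else false.

(* A push shifts the part of the tape before the content of stack [i] one cell
   to the left, a pop shifts it to the right; the rest of the tape does not move.
   The head rests on the blank preceding stack 0. *)
Fixpoint compile (c : cmd) : TM :=
  match c with
  | Skip => MSkip
  | Push i b => MSeq (MIter (MWalk DR) i)
      (MSeq (MOne (fun _ => Some b) DL) (MSeq (MIter (MShift DL) i) (MOne (fun _ => None) DS)))
  | Pop i => MSeq MRight
      (MSeq (MIter (MShift DR) i) (MSeq (MOne (fun _ => None) DS) (MIter (MWalk DL) i)))
  | Seq c1 c2 => MSeq (compile c1) (compile c2)
  | If i p c1 c2 => MSeq (MPeek i)
      (MCond (lift_test p) (MSeq (MBack i) (compile c1)) (MSeq (MBack i) (compile c2)))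
  | While i p c => MLoop (lift_test p) (MPeek i) (MSeq (MBack i) (compile c)) (MBack i)
  end.

(* Stacks lie on the tape top first, each preceded by a blank. *)
Definition enc (s : env) : seq (option bool) := flatten [seq None :: map Some x | x <- s].

(** What lies to the left is arbitrary, since pushes overwrite it. Blanks on the right arise when
    the head looks past an empty last stack. *)
Definition rep (s : env) (x : tape) : Prop :=
  exists l j, x = at_right l (enc s ++ nseq j None).

Lemma enc_cons x s : enc (x :: s) = None :: map Some x ++ enc s.
Proof. by []. Qed.

Lemma enc_cat s1 s2 : enc (s1 ++ s2) = enc s1 ++ enc s2.
Proof. by rewrite /enc map_cat flatten_cat. Qed.

Lemma enc_rcons s x : enc (rcons s x) = enc s ++ None :: map Some x.
Proof. by rewrite -cats1 enc_cat /enc /= cats0. Qed.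

Lemma enc_blank s r : enc s ++ None :: r = None :: behead (enc s ++ None :: r).
Proof. by case: s. Qed.

Lemma walkR_iter s l r :
  mruns (MIter (MWalk DR) (size s)) (at_right l (enc s ++ None :: r))
        (at_right (rev (enc s) ++ l) (None :: r)) (3 * size (enc s)).
Proof.
elim: s l => [|x s IH] l; first exact: mruns_skip.
rewrite enc_cons cat_cons -catA enc_blank.
have h := IH (rev (map Some x) ++ None :: l); rewrite enc_blank in h.
rewrite rev_cons rev_cat -cats1 -!catA.
by apply: mruns_le (mruns_seqE (mruns_walkR _ _ _) h) _; rewrite /= size_cat size_map; lia.
Qed.

Lemma walkL_iter s l r :
  mruns (MIter (MWalk DL) (size s)) (at_right (rev (enc s) ++ l) (None :: r))
        (at_right l (enc s ++ None :: r)) (3 * size (enc s)).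
Proof.
elim/last_ind: s r => [|s x IH] r; first exact: mruns_skip.
rewrite enc_rcons size_rcons rev_cat rev_cons -cats1 -!catA /= /at_right.
by apply: mruns_le (mruns_seqE (mruns_walkL _ _ _) (IH (map Some x ++ None :: r))) _;
  rewrite size_cat /= size_map; lia.
Qed.

(** [behead] occurs because the leading blank of the shifted block belongs on the cell now scanned,
    where [Push] writes it afterwards. *)
Lemma shiftL_iter s l r :
  mruns (MIter (MShift DL) (size s)) (at_left (rev (enc s) ++ l) r)
        (at_left l (behead (enc s ++ None :: r))) (3 * size (enc s)).
Proof.
elim/last_ind: s r => [|s x IH] r; first exact: mruns_skip.
rewrite enc_rcons size_rcons rev_cat rev_cons -cats1 -!catA /=.
by apply: mruns_le (mruns_seqE (mruns_shiftL _ _ _) (IH (map Some x ++ None :: r))) _;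
  rewrite size_cat /= size_map; lia.
Qed.

Lemma shiftR_iter s l r :
  mruns (MIter (MShift DR) (size s)) (at_right l (behead (enc s ++ None :: r)))
        (at_right (rev (enc s) ++ l) r) (3 * size (enc s)).
Proof.
elim: s l => [|x s IH] l; first exact: mruns_skip.
rewrite enc_cons cat_cons -catA enc_blank /behead -/behead.
rewrite rev_cons rev_cat -cats1 -!catA.
by apply: mruns_le (mruns_seqE (mruns_shiftR _ _ _) (IH (rev (map Some x) ++ None :: l))) _;
  rewrite /= size_cat size_map; lia.
Qed.

Lemma env_split (s : env) i : i < size s ->
  exists s1 x s2, [/\ s = s1 ++ x :: s2, size s1 = i, nth [::] s i = x &
    forall y, set_nth [::] s i y = s1 ++ y :: s2].
Proof.
move=> lt; exists (take i s), (nth [::] s i), (drop i.+1 s).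
have sz : size (take i s) = i by rewrite size_takel // ltnW.
split=> //; first by rewrite -drop_nth // cat_take_drop.
by move=> y; rewrite set_nthE lt.
Qed.

Lemma peek_back s i x : i < size s -> rep s x ->
  exists y z, [/\ mruns (MPeek i) x y (3 * size (enc s) + 2),
    y.1.2 = ohead (nth [::] s i), rep s z & mruns (MBack i) y z (3 * size (enc s) + 2)].
Proof.
move=> /env_split [s1 [w [s2 [-> <- -> _]]]] [l [j ->]].
set r := map Some w ++ enc s2 ++ nseq j None.
have -> : enc (s1 ++ w :: s2) ++ nseq j None = enc s1 ++ None :: r.
  by rewrite enc_cat enc_cons -!catA cat_cons -catA.
pose l' := rev (enc s1) ++ l.
have sz : size (enc s1) <= size (enc (s1 ++ w :: s2)) by rewrite enc_cat size_cat leq_addr.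
exists (at_right (None :: l') r), (at_right l (enc s1 ++ None :: (if r is [::] then [:: None] else r))); split.
- by apply: mruns_le (mruns_seqE (walkR_iter _ _ _) (mruns_one _ _ _)) _; lia.
- rewrite /r; case: w {r sz} => [|b w] //=.
  by case: s2 => [|x2 s2] //=; case: j.
- exists l, (if r is [::] then 1 else j).
  rewrite enc_cat enc_cons -!catA cat_cons -catA; congr at_right; congr (_ ++ _ :: _).
  by rewrite /r; case: w {r sz} => //=; case: s2 => //; case: j.
- have h := mruns_one id DL (at_right (None :: l') r).
  have e : mv (at_right (None :: l') r) (at_right (None :: l') r).1.2 DL =
      at_right l' (None :: (if r is [::] then [:: None] else r)) by case: (r).
  rewrite [mv _ _ _]e in h.
  by apply: mruns_le (mruns_seqE h (walkL_iter _ _ _)) _; lia.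
Qed.

Lemma push_ok s i b x : i < size s -> rep s x ->
  exists2 y, rep (set_nth [::] s i (b :: nth [::] s i)) y &
    mruns (compile (Push i b)) x y (6 * size (enc s) + 5).
Proof.
move=> /env_split [s1 [w [s2 [-> <- -> ->]]]] [l [j ->]].
set r := map Some w ++ enc s2 ++ nseq j None.
have -> : enc (s1 ++ w :: s2) ++ nseq j None = enc s1 ++ None :: r.
  by rewrite enc_cat enc_cons -!catA cat_cons -catA.
have sz : size (enc s1) <= size (enc (s1 ++ w :: s2)) by rewrite enc_cat size_cat leq_addr.
exists (at_right (behead l) (enc s1 ++ None :: Some b :: r)).
  by exists (behead l), j; rewrite enc_cat enc_cons -!catA cat_cons -catA.
have h1 := walkR_iter s1 l r.
have h2 : mruns (MOne (fun _ => Some b) DL) (at_right (rev (enc s1) ++ l) (None :: r))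
   (at_left (rev (enc s1) ++ l) (Some b :: r)) 1 by apply: mruns_one.
have h3 := shiftL_iter s1 l (Some b :: r).
have h4 : mruns (MOne (fun _ => None) DS) (at_left l (behead (enc s1 ++ None :: Some b :: r)))
    (at_right (behead l) (enc s1 ++ None :: Some b :: r)) 1.
  by rewrite enc_blank /=; have := mruns_one (fun=> None) DS (at_left l (behead (enc s1 ++ [:: None, Some b & r]))); case: (l).
apply: mruns_le (mruns_seqE h1 (mruns_seqE h2 (mruns_seqE h3 h4))) _; lia.
Qed.

Lemma pop_ok s i x : i < size s -> nth [::] s i != [::] -> rep s x ->
  exists2 y, rep (set_nth [::] s i (behead (nth [::] s i))) y &
    mruns (compile (Pop i)) x y (6 * size (enc s) + 5).
Proof.
move=> /env_split [s1 [w [s2 [-> <- -> ->]]]] wn [l [j ->]].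
case: w wn => // b w _.
set r := map Some w ++ enc s2 ++ nseq j None.
have -> : enc (s1 ++ (b :: w) :: s2) ++ nseq j None = enc s1 ++ None :: Some b :: r.
  by rewrite enc_cat enc_cons -!catA cat_cons -catA.
have sz : size (enc s1) <= size (enc (s1 ++ (b :: w) :: s2)) by rewrite enc_cat size_cat leq_addr.
exists (at_right (None :: l) (enc s1 ++ None :: r)).
  by exists (None :: l), j; rewrite enc_cat enc_cons -!catA cat_cons -catA.
have h1 : mruns MRight (at_right l (enc s1 ++ None :: Some b :: r))
    (at_right (None :: l) (behead (enc s1 ++ None :: Some b :: r))) 1.
  by rewrite enc_blank /=; apply: mruns_one.
have h2 := shiftR_iter s1 (None :: l) (Some b :: r).
have h3 : mruns (MOne (fun _ => None) DS) (at_right (rev (enc s1) ++ None :: l) (Some b :: r))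
   (at_right (rev (enc s1) ++ None :: l) (None :: r)) 1 by apply: mruns_one.
have h4 := walkL_iter s1 (None :: l) r.
apply: mruns_le (mruns_seqE h1 (mruns_seqE h2 (mruns_seqE h3 h4))) _; lia.
Qed.

(** [grow] bounds how much the tape content can lengthen, and [S] in [time] bounds its length
    throughout. The recursion is over a fixed program, so nested loops only raise the degree in
    [B]. *)
Fixpoint grow (B : nat) (c : cmd) : nat :=
  match c with
  | Skip | Pop _ => 0
  | Push _ _ => 1
  | Seq c1 c2 | If _ _ c1 c2 => grow B c1 + grow B c2
  | While _ _ c => B * grow B c
  end.

Fixpoint time (B S : nat) (c : cmd) : nat :=
  match c with
  | Skip => 0
  | Push _ _ | Pop _ => 6 * S + 5
  | Seq c1 c2 => time B S c1 + time B S c2 + 1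
  | If _ _ c1 c2 => time B S c1 + time B S c2 + 6 * S + 9
  | While _ _ c => B.+1 * (time B S c + 6 * S + 9)
  end.

Lemma size_enc_set s i y : i < size s ->
  size (enc (set_nth [::] s i y)) + size (nth [::] s i) = size (enc s) + size y.
Proof.
move=> /env_split [s1 [w [s2 [-> _ -> ->]]]].
by rewrite !enc_cat !enc_cons !size_cat /= !size_cat !size_map; lia.
Qed.

Lemma lift_testE p s i y :
  y = ohead (nth [::] s i) -> lift_test p y = test p (nth [::] s i).
Proof. by move=> ->; case: (nth _ _ _). Qed.

Lemma compile_ok B S c s s' x :
  exec B c s s' -> size (enc s) + grow B c <= S -> rep s x ->
  size (enc s') <= size (enc s) + grow B c /\
  exists2 y, rep s' y & mruns (compile c) x y (time B S c).
Proof.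
elim: c s s' x => [|i b|i|c1 IH1 c2 IH2|i p c1 IH1 c2 IH2|i p c IH] s s' x.
- by move=> /= -> _ r; split; [rewrite addn0 | exists x => //; apply: mruns_skip].
- move=> [lt ->] hS r; split.
    by have /= := size_enc_set (b :: nth [::] s i) lt; lia.
  have [y ry my] := push_ok b lt r; exists y => //.
  by apply: mruns_le my _ => /=; move: hS; rewrite /=; lia.
- move=> [lt nz ->] hS r; split.
    by have /= := size_enc_set (behead (nth [::] s i)) lt; rewrite size_behead; lia.
  have [y ry my] := pop_ok lt nz r; exists y => //.
  by apply: mruns_le my _ => /=; move: hS; rewrite /=; lia.
- move=> [s1 e1 e2] /= hS r.
  have [|l1 [y ry my]] := IH1 _ _ _ e1 _ r; first lia.
  have [|l2 [z rz mz]] := IH2 _ _ _ e2 _ ry; first lia.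
  split; first lia.
  by exists z => //; apply: mruns_le (mruns_seqE my mz) _; lia.
- move=> [lt e] /= hS r.
  have [y [z [m1 hy rz m2]]] := peek_back lt r.
  have hy' := lift_testE p hy.
  case: ifP e => ht e.
  + have [|l1 [w rw mw]] := IH1 _ _ _ e _ rz; first lia.
    split; first lia.
    exists w => //.
    have mc : mruns (MCond (lift_test p) (MSeq (MBack i) (compile c1)) (MSeq (MBack i) (compile c2)))
        y w (3 * size (enc s) + 2 + time B S c1).+2.
      by apply: mruns_cond; rewrite hy' ht; apply: mruns_seqE m2 mw.
    by apply: mruns_le (mruns_seqE m1 mc) _; lia.
  + have [|l1 [w rw mw]] := IH2 _ _ _ e _ rz; first lia.
    split; first lia.
    exists w => //.
    have mc : mruns (MCond (lift_test p) (MSeq (MBack i) (compile c1)) (MSeq (MBack i) (compile c2)))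
        y w (3 * size (enc s) + 2 + time B S c2).+2.
      by apply: mruns_cond; rewrite hy' ht; apply: mruns_seqE m2 mw.
    by apply: mruns_le (mruns_seqE m1 mc) _; lia.
- move=> [j lej e] /= hS r.
  (* Counting the actual iterations [j] makes the bounds additive along the loop; [j <= B] then
     gives the stated ones. *)
  suff [l [y ry my]] : size (enc s') <= size (enc s) + j * grow B c /\
     exists2 y, rep s' y & mruns (compile (While i p c)) x y (j.+1 * (time B S c + 6 * S + 9)).
    split; first by nia.
    by exists y => //; apply: mruns_le my _; nia.
  have hSj : size (enc s) + j * grow B c <= S by nia.
  elim: j s x e hSj r {lej hS} => [|j IHj] s x [lt [ht e]] hS r.
    have [y [z [m1 hy rz m2]]] := peek_back lt r.
    rewrite {}e; split; first lia.
    exists z => //; apply: mruns_loop_stop m1 _ m2 _; last nia.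
    by rewrite (lift_testE p hy) ht.
  case: e => s1 e1 e2.
  have [y [z [m1 hy rz m2]]] := peek_back lt r.
  have [|l1 [w rw mw]] := IH _ _ _ e1 _ rz; first by nia.
  have [|l2 [v rv mv]] := IHj _ _ e2 _ rw; first by nia.
  split; first by nia.
  exists v => //; apply: mruns_loop_next m1 _ (mruns_seqE m2 mw) mv _; last nia.
  by rewrite (lift_testE p hy) ht.
Qed.

(** The [m] blanks to the left of the input read as [m - 1] empty stacks followed by the separator
    of the input, which becomes the last stack. The final move puts the head on the top of stack 0,
    where the output is read up to the next blank. *)
Definition Mprog (m : nat) (c : cmd) : TM := MSeq (MIter MLeft m) (MSeq (compile c) MRight).

Lemma tm_halted_iter M (c : config M) t : tm_halted c -> iter t (@tm_step M) c = c.
Proof.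
by case: c => [[[q l] h] r] /= hq; elim: t => //= t ->; rewrite /tm_step hq.
Qed.

Lemma left_iter m (w : seq bool) : w != [::] ->
  mruns (MIter MLeft m) (at_right [::] (map Some w))
    (at_right [::] (nseq m None ++ map Some w)) (2 * m).
Proof.
move=> wn; suff H j : mruns (MIter MLeft m) (at_right [::] (nseq j None ++ map Some w))
    (at_right [::] (nseq (m + j) None ++ map Some w)) (2 * m).
  by have := H 0; rewrite addn0.
elim: m j => [|m IH] j; first exact: mruns_skip.
have h : mruns MLeft (at_right [::] (nseq j None ++ map Some w))
    (at_right [::] (nseq j.+1 None ++ map Some w)) 1.
  have := mruns_one id DL (at_right [::] (nseq j None ++ map Some w)).
  by case: w wn {IH} => // b w _; case: j.
by rewrite addSnnS; apply: mruns_le (mruns_seqE h (IH _)) _; lia.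
Qed.

Lemma read_word_enc (w : seq bool) r :
  ohead r != Some (Some true) -> ohead r != Some (Some false) -> read_word (map Some w ++ r) = w.
Proof. by elim: w => [|b w IH] h1 h2 /=; [case: r h1 h2 => [|[[]|] r] | rewrite IH]. Qed.

Lemma Mprog_halts B m c w s' : 0 < m -> w != [::] ->
  exec B c (rcons (nseq m.-1 [::]) w) s' ->
  halts_within (Mprog m c) w (2 * m + time B (m + size w + grow B c) c + 3) (head [::] s').
Proof.
move=> m0 wn e; set s0 := rcons _ _ in e.
have es0 : enc s0 = nseq m None ++ map Some w.
  rewrite enc_rcons -cat_rcons; congr (_ ++ _).
  case: m m0 {e s0} => // m _ /=; elim: m => //= m IH; by rewrite /enc /= -/(enc _) IH.
have sz : size (enc s0) = m + size w by rewrite es0 size_cat size_nseq size_map.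
have r0 : rep s0 (at_right [::] (nseq m None ++ map Some w)).
  by exists [::], 0; rewrite es0 cats0.
have [|_ [y [l [j ey]] my]] := compile_ok (S := m + size w + grow B c) e _ r0.
  by rewrite sz.
have mR := mruns_one id DR y.
have [q hq [u lu eu]] := mruns_seqE (left_iter m wn) (mruns_seqE my mR).
have ini : conf (tm_start (Mprog m c)) (at_right [::] (map Some w)) = tm_init (Mprog m c) w.
  by case: (w).
rewrite ini in eu.
have run : tm_run (Mprog m c) w (2 * m + time B (m + size w + grow B c) c + 3) =
    conf q (mv y y.1.2 DR).
  rewrite /tm_run; set T := _ + 3; have hT : u <= T by apply: leq_trans lu _; rewrite /T; lia.
  rewrite -(subnK hT) iterD; have eu' : iter u (@tm_step (Mprog m c)) (tm_init (Mprog m c) w) = conf q (mv y y.1.2 DR) := eu.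
  by rewrite eu' tm_halted_iter.
split; rewrite run // /tm_output /conf ey.
case: s' e ey => [|w' s'] e ey; first by case: j ey => // [[|j]].
rewrite enc_cons cat_cons -catA /=.
have H : ohead (enc s' ++ nseq j None) = None \/ ohead (enc s' ++ nseq j None) = Some None.
  by case: s' {e ey} => [|x s']; [case: j; [left|right] | right].
case: w' {e ey} => [|b w'] /=.
  by case: s' H => //=; case: j.
by rewrite read_word_enc //; case: H => ->.
Qed.

(** * Polynomial bounds *)

(** One constant serves as factor and exponent, as in the theorem; the base [n.+1] is positive, so
    enlarging the exponent only weakens the bound. *)
Definition polyb (f : nat -> nat) : Prop := exists c, forall n, f n <= c * n.+1 ^ c.

Lemma polyb_le f g : polyb g -> (forall n, f n <= g n) -> polyb f.
Proof. by move=> [c hc] fg; exists c => n; apply: leq_trans (fg n) (hc n). Qed.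

Lemma polyb_const a : polyb (fun _ => a).
Proof. by exists a => n; rewrite leq_pmulr // expn_gt0. Qed.

Lemma polyb_id : polyb id.
Proof. by exists 1 => n; rewrite mul1n expn1. Qed.

Lemma polyb_add f g : polyb f -> polyb g -> polyb (fun n => f n + g n).
Proof.
move=> [c hc] [d hd]; exists (c + d) => n.
apply: leq_trans (leq_add (hc n) (hd n)) _; rewrite mulnDl.
by apply: leq_add; apply: leq_mul => //; apply: leq_pexp2l => //; lia.
Qed.

Lemma polyb_mul f g : polyb f -> polyb g -> polyb (fun n => f n * g n).
Proof.
move=> [c hc] [d hd]; exists (c + d + c * d) => n.
apply: leq_trans (leq_mul (hc n) (hd n)) _.
rewrite mulnACA -expnD; apply: leq_mul; first lia.
by apply: leq_pexp2l => //; lia.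
Qed.

Lemma polyb_grow B c : polyb B -> polyb (fun n => grow (B n) c).
Proof.
move=> pB; elim: c => //= *; try exact: polyb_const; try exact: polyb_add.
exact: polyb_mul.
Qed.

Lemma polyb_time B S c : polyb B -> polyb S -> polyb (fun n => time (B n) (S n) c).
Proof.
move=> pB pS.
have p6 a : polyb (fun n => 6 * S n + a).
  by apply: polyb_add (polyb_const _); apply: polyb_mul (polyb_const _) pS.
elim: c => [|i b|i|c1 IH1 c2 IH2|i p c1 IH1 c2 IH2|i p c IH] /=.
- exact: polyb_const.
- exact: p6.
- exact: p6.
- by apply: polyb_add (polyb_const _); apply: polyb_add.
- apply: polyb_le (polyb_add (polyb_add IH1 IH2) (p6 9)) _ => n; lia.
- apply: polyb_le (polyb_mul (polyb_add (polyb_const 1) pB) (polyb_add IH (p6 9))) _ => n; lia.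
Qed.

(** For positive [n], [n.+1 <= 2 * n], and the factor [2 ^ c] goes into the constant. *)
Lemma polyb_expand f : polyb f -> exists c, forall n, 0 < n -> f n <= c * n ^ c + c.
Proof.
move=> [c hc]; exists (c * 2 ^ c) => n n0; apply: leq_trans (leq_trans (hc n) _) (leq_addr _ _).
have le2 : n.+1 ^ c <= 2 ^ c * n ^ c by rewrite -expnMn; case: (c) => // d; rewrite leq_exp2r; lia.
apply: leq_trans (leq_mul (leqnn c) le2) _; rewrite mulnA leq_mul2l; apply/orP; right.
by apply: leq_pexp2l => //; rewrite leq_pmulr // expn_gt0.
Qed.

(* Moving, copying and clearing stacks; loops with unary counters *)
Infix ";;" := Seq (at level 60, right associativity).

Lemma upd_size (s : env) i x : i < size s -> size (set_nth [::] s i x) = size s.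
Proof. by move=> lt; rewrite size_set_nth; apply/maxn_idPr. Qed.

Lemma updE (s : env) i j x :
  nth [::] (set_nth [::] s i x) j = if j == i then x else nth [::] s j.
Proof. by rewrite nth_set_nth. Qed.

Lemma updK (s : env) i x y : set_nth [::] (set_nth [::] s i x) i y = set_nth [::] s i y.
Proof. by rewrite set_set_nth eqxx. Qed.

Lemma upd_id (s : env) i : i < size s -> set_nth [::] s i (nth [::] s i) = s.
Proof.
move=> lt; apply: (@eq_from_nth _ [::]); rewrite upd_size // => j _.
by rewrite nth_set_nth /=; case: eqP => // ->.
Qed.

Ltac env_ext := apply: (@eq_from_nth _ [::]);
  [rewrite ?size_set_nth; lia
  |let k := fresh in move=> k _; rewrite !updE; repeat (case: eqP => //= ?); try congruence; try lia].
Ltac env_size := rewrite ?size_set_nth; lia.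

Definition trues (x : nat) : seq bool := nseq x true.

(** A loop is verified by describing its whole trajectory: [F j] is the environment after [j]
    iterations. *)
Lemma exec_while B i p c (F : nat -> env) x : x <= B ->
  (forall j, j <= x -> i < size (F j)) ->
  (forall j, j < x -> test p (nth [::] (F j) i) /\ exec B c (F j) (F j.+1)) ->
  test p (nth [::] (F x) i) = false ->
  exec B (While i p c) (F 0) (F x).
Proof.
move=> le sz st tx; exists x => //.
suff H y : y <= x -> iterR i p (exec B c) y (F (x - y)) (F x) by have := H x (leqnn x); rewrite subnn.
elim: y => [|y IH] ly /=.
  by rewrite subn0; split; [apply: sz | rewrite tx].
have [] := st (x - y.+1) _; first lia.
rewrite subnSK // => t e; split; first by apply: sz; lia.
by split=> //; exists (F (x - y)) => //; apply: IH; lia.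
Qed.

(** The counter lies on top of a rest [r] that is empty or begins with [false], so the loop stops at
    its own frame and nested counters can share one stack. *)
Lemma exec_countdown B i c (F : nat -> env) r x : x <= B -> test id r = false ->
  (forall j, j <= x -> i < size (F j) /\ nth [::] (F j) i = trues (x - j) ++ r) ->
  (forall j, j < x -> exec B c (set_nth [::] (F j) i (trues (x - j.+1) ++ r)) (F j.+1)) ->
  exec B (While i id (Pop i ;; c)) (F 0) (F x).
Proof.
move=> le tr sz st; apply: exec_while => //.
- by move=> j /sz [].
- move=> j lt; have [ls e] := sz j (ltnW lt).
  have e2 : trues (x - j) = true :: trues (x - j.+1) by rewrite -(subnSK lt).
  rewrite e e2; split => //; exists (set_nth [::] (F j) i (trues (x - j.+1) ++ r)); last exact: st.
  by split; rewrite // e e2.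
- by have [_ ->] := sz x (leqnn x); rewrite subnn.
Qed.

Definition moveT i j := While i id (Pop i ;; Push j true).
Definition clearT i := While i id (Pop i ;; Skip).
Definition moveT2 i j k := While i id (Pop i ;; Push j true ;; Push k true).
Definition copyT i t j := moveT i t ;; moveT2 t i j.
Definition moveBit i j := If i id (Pop i ;; Push j true) (Pop i ;; Push j false).
Definition moveAll i j := While i xpredT (moveBit i j).
Definition clearAll i := While i xpredT (Pop i).

Lemma moveT_ok B i j s x r : i != j -> i < size s -> j < size s -> x <= B ->
  nth [::] s i = trues x ++ r -> test id r = false ->
  exec B (moveT i j) s (set_nth [::] (set_nth [::] s i r) j (trues x ++ nth [::] s j)).
Proof.
move=> ne li lj le ei tr.
pose F y := set_nth [::] (set_nth [::] s i (trues (x - y) ++ r)) j (trues y ++ nth [::] s j).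
have F0 : F 0 = s by rewrite /F subn0 -ei upd_id // upd_id.
have -> : set_nth [::] (set_nth [::] s i r) j (trues x ++ nth [::] s j) = F x by rewrite /F subnn.
rewrite -{1}F0; apply: exec_countdown (le) tr _ _ => y ly.
  by rewrite /F !updE eqxx (negPf ne) !upd_size // upd_size.
split; first by rewrite /F; env_size.
rewrite /F; env_ext.
Qed.

Lemma moveT2_ok B i j k s x r : i != j -> i != k -> j != k ->
  i < size s -> j < size s -> k < size s -> x <= B ->
  nth [::] s i = trues x ++ r -> test id r = false ->
  exec B (moveT2 i j k) s
    (set_nth [::] (set_nth [::] (set_nth [::] s i r) j (trues x ++ nth [::] s j)) k (trues x ++ nth [::] s k)).
Proof.
move=> ij ik jk li lj lk le ei tr.
pose F y := set_nth [::] (set_nth [::] (set_nth [::] s i (trues (x - y) ++ r)) j (trues y ++ nth [::] s j))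
  k (trues y ++ nth [::] s k).
have F0 : F 0 = s by rewrite /F subn0 -ei !upd_id.
have -> : set_nth [::] (set_nth [::] (set_nth [::] s i r) j (trues x ++ nth [::] s j)) k
   (trues x ++ nth [::] s k) = F x by rewrite /F subnn.
have szF y : size (F y) = size s by rewrite /F upd_size // !upd_size // upd_size.
have ji : j != i by rewrite eq_sym.
have ki : k != i by rewrite eq_sym.
have kj : k != j by rewrite eq_sym.
rewrite -{1}F0; apply: exec_countdown (le) tr _ _ => y ly.
  by rewrite szF /F !updE eqxx (negPf ij) (negPf ik).
set G := set_nth _ (F y) i _.
have szG : size G = size s by rewrite /G upd_size szF.
exists (set_nth [::] G j (trues y.+1 ++ nth [::] s j)).
  split; first by rewrite szG.
  by rewrite /G /F !updE (negPf ji) (negPf jk) eqxx.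
split; first by rewrite upd_size szG.
rewrite /G /F !updE (negPf kj) (negPf ki) eqxx.
by env_ext.
Qed.

Lemma clearT_ok B i s x r : i < size s -> x <= B ->
  nth [::] s i = trues x ++ r -> test id r = false ->
  exec B (clearT i) s (set_nth [::] s i r).
Proof.
move=> li le ei tr.
pose F y := set_nth [::] s i (trues (x - y) ++ r).
have F0 : F 0 = s by rewrite /F subn0 -ei upd_id.
have -> : set_nth [::] s i r = F x by rewrite /F subnn.
rewrite -{1}F0; apply: exec_countdown (le) tr _ _ => y ly.
  by rewrite /F !updE eqxx !upd_size.
by rewrite /F /= updK.
Qed.

Lemma copyT_ok B i t j s x : i != t -> i != j -> t != j ->
  i < size s -> t < size s -> j < size s -> x <= B ->
  nth [::] s i = trues x -> test id (nth [::] s t) = false ->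
  exec B (copyT i t j) s (set_nth [::] s j (trues x ++ nth [::] s j)).
Proof.
move=> it ij tj li lt lj le ei tt.
have ti : t != i by rewrite eq_sym.
have ji : j != i by rewrite eq_sym.
have jt : j != t by rewrite eq_sym.
exists (set_nth [::] (set_nth [::] s i [::]) t (trues x ++ nth [::] s t)).
  by apply: moveT_ok => //; rewrite cats0.
have := @moveT2_ok B t i j (set_nth [::] (set_nth [::] s i [::]) t (trues x ++ nth [::] s t)) x (nth [::] s t).
rewrite !updE eqxx (negPf it) (negPf jt) (negPf ji) eqxx cats0.
have <- : set_nth [::] s j (trues x ++ nth [::] s j) =
  set_nth [::] (set_nth [::] (set_nth [::] (set_nth [::] (set_nth [::] s i [::]) t (trues x ++ nth [::] s t)) t
     (nth [::] s t)) i (trues x)) j (trues x ++ nth [::] s j).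
  by env_ext.
by apply => //; rewrite !upd_size // upd_size.
Qed.

Lemma moveBit_ok B i j s b w : i != j -> i < size s -> j < size s ->
  nth [::] s i = b :: w ->
  exec B (moveBit i j) s (set_nth [::] (set_nth [::] s i w) j (b :: nth [::] s j)).
Proof.
move=> ij li lj e.
have ji : j != i by rewrite eq_sym.
split=> //; rewrite e; case: b e => e /=; exists (set_nth [::] s i w);
  by rewrite ?e ?upd_size // !updE (negPf ji).
Qed.

Lemma moveAll_ok B i j s w : i != j -> i < size s -> j < size s -> size w <= B ->
  nth [::] s i = w ->
  exec B (moveAll i j) s (set_nth [::] (set_nth [::] s i [::]) j (rev w ++ nth [::] s j)).
Proof.
move=> ij li lj le e.
have ji : j != i by rewrite eq_sym.
pose F y := set_nth [::] (set_nth [::] s i (drop y w)) j (rev (take y w) ++ nth [::] s j).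
have F0 : F 0 = s by rewrite /F drop0 take0 -e !upd_id.
have -> : set_nth [::] (set_nth [::] s i [::]) j (rev w ++ nth [::] s j) = F (size w).
  by rewrite /F drop_size take_size.
have szF y : size (F y) = size s by rewrite /F upd_size upd_size.
have nF y : nth [::] (F y) i = drop y w by rewrite /F !updE (negPf ij) eqxx.
rewrite -{1}F0; apply: exec_while => //.
- by move=> y _; rewrite szF.
- move=> y ly; rewrite nF (drop_nth true) //; split=> //.
  have := @moveBit_ok B i j (F y) (nth true w y) (drop y.+1 w) ij.
  rewrite nF szF (drop_nth true ly) => /(_ li lj erefl).
  congr exec; rewrite /F (take_nth true ly) rev_rcons; env_ext.
- by rewrite nF drop_size.
Qed.

Lemma clearAll_ok B i s : i < size s -> size (nth [::] s i) <= B ->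
  exec B (clearAll i) s (set_nth [::] s i [::]).
Proof.
move=> li le; set w := nth [::] s i in le *.
pose F y := set_nth [::] s i (drop y w).
have F0 : F 0 = s by rewrite /F drop0 !upd_id.
have -> : set_nth [::] s i [::] = F (size w) by rewrite /F drop_size.
have nF y : nth [::] (F y) i = drop y w by rewrite /F updE eqxx.
rewrite -{1}F0; apply: exec_while => //.
- by move=> y _; rewrite upd_size.
- move=> y ly; rewrite nF (drop_nth true) //; split=> //=.
  by rewrite nF upd_size // (drop_nth true ly) /F updK.
- by rewrite nF drop_size.
Qed.

(* Stacks: 0 output, 1 adjacency matrix by rows, 2 number of vertices, 3 parameter,
   4 values of the variables, 5 truth values, 6 loop counters, 7 quantifier counters,
   8 to 11 scratch, 12 accumulator, 13 input and later the number of kept vertices.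
   Numbers are in unary ([true]s); nested frames on 4, 6 and 7 end with a [false]. *)
Record store := Store { sM : seq bool; sK : seq bool; sR : seq bool; sC : seq bool; sA : seq bool; sI : seq bool }.

Definition lay (n : nat) (s : store) (E L : seq bool) : env :=
  [:: [::]; sM s; trues n; sK s; E; sR s; L; sC s; [::]; [::]; [::]; [::]; sA s; sI s].

Arguments exec : simpl never.

Ltac lit := rewrite ?/lay /=; first
  [ split; [done | done | rewrite /=; reflexivity]
  | split; [done | rewrite /=; reflexivity]
  | reflexivity ].

(** The counter on stack 6 runs down while the value of the new variable, on top of stack 4, runs up
    from 0 to [n - 1]. The body sees only the latter. *)
Definition forV (body : cmd) : cmd :=
  Push 6 false ;; copyT 2 9 6 ;; Push 4 false ;;
  While 6 id (Pop 6 ;; body ;; Push 4 true) ;;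
  Pop 6 ;; clearT 4 ;; Pop 4.

Lemma forV_ok B n body (f : nat -> store) E L : n <= B ->
  (forall x, x < n -> forall L', exec B body (lay n (f x) (trues x ++ false :: E) L')
     (lay n (f x.+1) (trues x ++ false :: E) L')) ->
  exec B (forV body) (lay n (f 0) E L) (lay n (f n) E L).
Proof.
move=> le hb.
eexists; first by lit.
eexists; first by apply: (@copyT_ok B 2 9 6 _ n).
eexists; first by lit.
pose F j := lay n (f j) (trues j ++ false :: E) (trues (n - j) ++ false :: L).
have h : exec B (While 6 id (Pop 6 ;; body ;; Push 4 true)) (F 0) (F n).
  apply: (@exec_countdown B 6 _ F (false :: L) n) => // j lj.
  by eexists; [exact: hb | lit].
rewrite /F subn0 subnn in h.
eexists; first exact: h.
eexists; first by lit.
eexists; first by apply: (@clearT_ok B 4 _ n (false :: E)).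
by lit.
Qed.

Definition encv (r : seq nat) : seq bool := flatten [seq trues x ++ [:: false] | x <- r].

Lemma encv_cons x r : encv (x :: r) = trues x ++ false :: encv r.
Proof. by rewrite /encv /= -catA. Qed.

(** The values above variable [i] are moved to stack 9 with their separators and put back
    afterwards; the wanted value is copied to stack 8. *)
Fixpoint getv (i : nat) : cmd :=
  if i is j.+1 then
    moveT 4 9 ;; Pop 4 ;; Push 9 false ;; getv j ;; Pop 9 ;; Push 4 false ;; moveT 9 4
  else moveT2 4 8 9 ;; moveT 9 4.

Lemma getv_ok B i r a0 a1 a2 a3 a5 a6 a7 a8 a9 a10 a11 a12 a13 :
  i < size r -> all (geq B) r -> test id a9 = false ->
  exec B (getv i) [:: a0; a1; a2; a3; encv r; a5; a6; a7; a8; a9; a10; a11; a12; a13]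
   [:: a0; a1; a2; a3; encv r; a5; a6; a7; trues (nth 0 r i) ++ a8; a9; a10; a11; a12; a13].
Proof.
elim: i r a9 => [|i IH] [|x r] // a9 li /andP [lx lr] t9; rewrite encv_cons.
  eexists; first by apply: (@moveT2_ok B 4 8 9 _ x (false :: encv r)).
  exact: (@moveT_ok B 9 4 _ x a9).
eexists; first by apply: (@moveT_ok B 4 9 _ x (false :: encv r)).
eexists; first by lit.
eexists; first by lit.
eexists; first by rewrite /=; apply: IH.
eexists; first by lit.
eexists; first by lit.
exact: (@moveT_ok B 9 4 _ x a9).
Qed.

(** * Formulas with counting quantifiers and their evaluation *)

(* Variables are de Bruijn indices; [FCnt b f] says that more than [k]
   (for [b = true]) or more than [0] vertices satisfy [f]. *)
Inductive fm :=
| FAdj (i j : nat)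
| FEq (i j : nat)
| FNot (f : fm)
| FAnd (f g : fm)
| FCnt (b : bool) (f : fm).

Fixpoint sat (n : nat) (g : nat -> nat -> bool) (k : nat) (r : seq nat) (f : fm) : bool :=
  match f with
  | FAdj i j => g (nth 0 r i) (nth 0 r j)
  | FEq i j => nth 0 r i == nth 0 r j
  | FNot f => ~~ sat n g k r f
  | FAnd f1 f2 => sat n g k r f1 && sat n g k r f2
  | FCnt b f => (if b then k else 0) < count (fun x => sat n g k (x :: r) f) (iota 0 n)
  end.

Fixpoint wf (d : nat) (f : fm) : bool :=
  match f with
  | FAdj i j | FEq i j => (i < d) && (j < d)
  | FNot f => wf d f
  | FAnd f1 f2 => wf d f1 && wf d f2
  | FCnt _ f => wf d.+1 f
  end.

Definition madj (n : nat) (M : seq bool) (x y : nat) : bool := nth false M (x * n + y).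

(** A matrix entry is read by unwinding [x * n + y] bits of stack 1 onto stack 10 and back. Equality
    is tested by cancellation, which leaves [x - y] on stack 11 and [y - x] on stack 10. A
    quantifier collects its count on stack 7 and, if [b] holds, subtracts [k] from it. *)
Fixpoint eval (f : fm) : cmd :=
  match f with
  | FAdj i j =>
      getv i ;; While 8 id (Pop 8 ;; copyT 2 9 11 ;; While 11 id (Pop 11 ;; moveBit 1 10)) ;;
      getv j ;; While 8 id (Pop 8 ;; moveBit 1 10) ;;
      If 1 id (Push 5 true) (Push 5 false) ;; moveAll 10 1
  | FEq i j =>
      getv i ;; moveT 8 11 ;; getv j ;;
      While 8 id (Pop 8 ;; If 11 id (Pop 11) (Push 10 true)) ;;
      If 11 id (Push 5 false) (If 10 id (Push 5 false) (Push 5 true)) ;;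
      clearT 11 ;; clearT 10
  | FNot f => eval f ;; If 5 id (Pop 5 ;; Push 5 false) (Pop 5 ;; Push 5 true)
  | FAnd f1 f2 => eval f1 ;; If 5 id (Pop 5 ;; eval f2) Skip
  | FCnt b f =>
      Push 7 false ;; forV (eval f ;; If 5 id (Pop 5 ;; Push 7 true) (Pop 5)) ;;
      (if b then copyT 3 9 8 ;; While 8 id (Pop 8 ;; If 7 id (Pop 7) Skip) else Skip) ;;
      If 7 id (Push 5 true) (Push 5 false) ;; clearT 7 ;; Pop 7
  end.

Definition fits (B n k : nat) (M : seq bool) := [&& size M == n * n, n * n <= B, n <= B & k <= B].

Lemma all_leB B n r : n <= B -> all (gtn n) r -> all (geq B) r.
Proof. by move=> le; apply: sub_all => x /= /ltnW h; apply: leq_trans le. Qed.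

Lemma idx_lt n x y : x < n -> y < n -> x * n + y < n * n.
Proof. by move=> lx ly; nia. Qed.

Lemma eval_adj B n M K R C A I i j r L : 
  size M = n * n -> n * n <= B -> n <= B -> all (gtn n) r -> i < size r -> j < size r ->
  exec B (eval (FAdj i j)) (lay n (Store M K R C A I) (encv r) L)
    (lay n (Store M K (madj n M (nth 0 r i) (nth 0 r j) :: R) C A I) (encv r) L).
Proof.
move=> sM nnB nB hr li lj.
have hB := all_leB nB hr.
have xn : nth 0 r i < n by have /all_nthP := hr => /(_ 0 i li).
have yn : nth 0 r j < n by have /all_nthP := hr => /(_ 0 j lj).
move: (nth 0 r i) (nth 0 r j) xn yn (getv_ok (B := B) (r := r) (i := i)) (getv_ok (B := B) (r := r) (i := j)).
move=> x y xn yn g1 g2.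
have idx := idx_lt xn yn.
pose S q a u : env := [:: [::]; drop q M; trues n; K; encv r; R; L; C; a; [::]; rev (take q M); u; A; I].
have bit q a u : q < n * n -> exec B (moveBit 1 10) (S q a u) (S q.+1 a u).
  move=> lq; have := @moveBit_ok B 1 10 (S q a u) (nth false M q) (drop q.+1 M).
  rewrite /S /= (take_nth false) ?sM // rev_rcons; apply=> //.
  by rewrite (drop_nth false) ?sM.
eexists; first exact: g1.
have e1 : exec B (While 8 id (Pop 8 ;; copyT 2 9 11 ;; While 11 id (Pop 11 ;; moveBit 1 10)))
    (S 0 (trues x) [::]) (S (x * n) [::] [::]).
  pose F j := S (j * n) (trues (x - j)) [::].
  have h : exec B (While 8 id (Pop 8 ;; copyT 2 9 11 ;; While 11 id (Pop 11 ;; moveBit 1 10))) (F 0) (F x).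
    apply: (@exec_countdown B 8 _ F [::] x) => // [|z _|z lz]; first lia.
      by rewrite cats0.
    eexists; first by rewrite /= cats0; apply: (@copyT_ok B 2 9 11 _ n).
    rewrite /= cats0.
    pose G i := S (z * n + i) (trues (x - z.+1)) (trues (n - i)).
    have h : exec B (While 11 id (Pop 11 ;; moveBit 1 10)) (G 0) (G n).
      apply: (@exec_countdown B 11 _ G [::] n) => // [w _|w lw]; first by rewrite cats0.
      by rewrite /= cats0 /G addnS; apply: bit; nia.
    by move: h; rewrite /G subn0 subnn addn0 /F mulSn addnC.
  by move: h; rewrite /F subn0 subnn.
rewrite /= cats0; rewrite [S 0 _ _]/S drop0 take0 in e1.
eexists; first exact: e1.
eexists; first exact: g2.
have e2 : exec B (While 8 id (Pop 8 ;; moveBit 1 10))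
    (S (x * n) (trues y) [::]) (S (x * n + y) [::] [::]).
  pose F j := S (x * n + j) (trues (y - j)) [::].
  have h : exec B (While 8 id (Pop 8 ;; moveBit 1 10)) (F 0) (F y).
    apply: (@exec_countdown B 8 _ F [::] y) => // [|z _|z lz]; first lia.
      by rewrite cats0.
    by rewrite /= cats0 /F addnS; apply: bit; nia.
  by move: h; rewrite /F subn0 subnn addn0.
eexists; first by rewrite cats0; exact: e2.
rewrite /S; set q := x * n + y in idx *.
have eq : drop q M = madj n M x y :: drop q.+1 M by rewrite (drop_nth false) ?sM.
exists [:: [::]; drop q M; trues n; K; encv r; madj n M x y :: R; L; C; [::]; [::]; rev (take q M); [::]; A; I].
  split=> //=; rewrite eq /=; by case: (madj _ _ _ _); split.
have := @moveAll_ok B 10 1 [:: [::]; drop q M; trues n; K; encv r; madj n M x y :: R; L; C; [::]; [::]; rev (take q M); [::]; A; I].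
rewrite /= => /(_ _ isT isT isT _ erefl).
rewrite revK cat_take_drop; apply; rewrite size_rev size_takel ?sM; [apply: leq_trans (ltnW idx) nnB | exact: ltnW].
Qed.

Lemma eval_eq B n M K R C A I i j r L : 
  n <= B -> all (gtn n) r -> i < size r -> j < size r ->
  exec B (eval (FEq i j)) (lay n (Store M K R C A I) (encv r) L)
    (lay n (Store M K ((nth 0 r i == nth 0 r j) :: R) C A I) (encv r) L).
Proof.
move=> nB hr li lj.
have hB := all_leB nB hr.
have xn : nth 0 r i < n by have /all_nthP := hr => /(_ 0 i li).
have yn : nth 0 r j < n by have /all_nthP := hr => /(_ 0 j lj).
move: (nth 0 r i) (nth 0 r j) xn yn (getv_ok (B := B) (r := r) (i := i)) (getv_ok (B := B) (r := r) (i := j)).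
move=> x y xn yn g1 g2.
eexists; first exact: g1.
eexists; first by apply: (@moveT_ok B 8 11 _ x [::]) => //; lia.
eexists; first exact: g2.
rewrite /= !cats0.
pose F z : env := [:: [::]; M; trues n; K; encv r; R; L; C; trues (y - z); [::]; trues (z - x); trues (x - z); A; I].
have h : exec B (While 8 id (Pop 8 ;; If 11 id (Pop 11) (Push 10 true))) (F 0) (F y).
  apply: (@exec_countdown B 8 _ F [::] y) => // [|z _|z lz]; first lia.
    by rewrite cats0.
  rewrite /= cats0; split=> //=; rewrite /F.
  case: (ltnP z x) => lzx.
    rewrite -(subnSK lzx) /=; split=> //.
    by rewrite (_ : z - x = 0) 1?(_ : z.+1 - x = 0) //; lia.
  rewrite (_ : x - z = 0) 1?(_ : x - z.+1 = 0) /=; try lia.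
  by split=> //; rewrite subSn.
rewrite /F subn0 subnn (_ : 0 - x = 0) // subn0 in h.
eexists; first exact: h.
exists [:: [::]; M; trues n; K; encv r; (x == y) :: R; L; C; [::]; [::]; trues (y - x); trues (x - y); A; I].
  case: (ltngtP x y) => xy; (split; first by []).
  - by rewrite (_ : x - y = 0) /=; [split=> //=; rewrite -(subnSK xy); split | lia].
  - by rewrite /= -(subnSK xy); split.
  - by rewrite xy subnn; split.
eexists; first by apply: (@clearT_ok B 11 _ (x - y) [::]); rewrite ?cats0 //; lia.
by apply: (@clearT_ok B 10 _ (y - x) [::]); rewrite ?cats0 //=; lia.
Qed.

Lemma count_iotaS (P : pred nat) x : count P (iota 0 x.+1) = count P (iota 0 x) + P x.
Proof. by rewrite -addn1 iotaD count_cat /= addn0. Qed.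

Lemma eval_ok B n k M f r R C A I L :
  fits B n k M -> all (gtn n) r -> wf (size r) f ->
  exec B (eval f) (lay n (Store M (trues k) R C A I) (encv r) L)
    (lay n (Store M (trues k) (sat n (madj n M) k r f :: R) C A I) (encv r) L).
Proof.
move=> /and4P [/eqP sM nnB nB kB].
elim: f r R C L => [i j|i j|f IH|f1 IH1 f2 IH2|b f IH] r R C L hr.
- by move=> /andP [li lj]; apply: eval_adj.
- by move=> /andP [li lj]; apply: eval_eq.
- move=> /= wff; eexists; first exact: IH.
  split=> //=; case: sat => /=; (eexists; first by lit); by lit.
- move=> /= /andP [w1 w2]; eexists; first exact: IH1.
  split=> //=; case: sat => //=.
  eexists; first by lit.
  exact: (IH2 r).
- move=> /= wff; set P := fun x => sat _ _ _ (x :: r) f.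
  eexists; first by lit.
  pose F x := Store M (trues k) R (trues (count P (iota 0 x)) ++ false :: C) A I.
  eexists.
    apply: (@forV_ok B n _ F (encv r) L nB) => x lx L'; rewrite -encv_cons.
    eexists; first by apply: IH => //=; rewrite lx hr.
    split=> //=; rewrite /F count_iotaS /P; case: sat.
      eexists; first by lit.
      by rewrite addn1; lit.
    by rewrite addn0; lit.
  set c := count P (iota 0 n).
  have cn : c <= n by have := count_size P (iota 0 n); rewrite size_iota.
  exists (lay n (Store M (trues k) R (trues (c - (if b then k else 0)) ++ false :: C) A I) (encv r) L).
    case: b; last by rewrite subn0.
    eexists; first by apply: (@copyT_ok B 3 9 8 _ k).
    rewrite /= cats0.
    pose G z : env := [:: [::]; M; trues n; trues k; encv r; R; L; trues (c - z) ++ false :: C; trues (k - z); [::]; [::]; [::]; A; I].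
    have h : exec B (While 8 id (Pop 8 ;; If 7 id (Pop 7) Skip)) (G 0) (G k).
      apply: (@exec_countdown B 8 _ G [::] k) => // [z _|z lz]; first by rewrite cats0.
      rewrite /= cats0 /G; split=> //=.
      case: (ltnP z c) => lzc; first by rewrite -(subnSK lzc) /=; split.
      by rewrite (_ : c - z = 0) 1?(_ : c - z.+1 = 0) /=; try lia.
    by rewrite /G !subn0 subnn in h.
  set d := c - _; have -> : ((if b then k else 0) < c) = (0 < d) by rewrite /d; lia.
  have dB : d <= B by rewrite /d; lia.
  exists (lay n (Store M (trues k) ((0 < d) :: R) (trues d ++ false :: C) A I) (encv r) L).
    by split=> //=; case: d {dB} => /=; split.
  eexists; first by apply: (@clearT_ok B 7 _ d (false :: C)).
  by lit.
Qed.

(** * Updating the adjacency matrix *)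

Definition mx (n : nat) (g : nat -> nat -> bool) : seq bool :=
  [seq g i j | i <- iota 0 n, j <- iota 0 n].

(* In [p] and [f], the column [j] and the row [i] are the variables 0 and 1. *)
Definition collect (p f : fm) : cmd :=
  forV (forV (eval p ;; If 5 id (Pop 5 ;; eval f ;; moveBit 5 12) (Pop 5))).

Definition collected n g k r p f m : seq bool :=
  flatten [seq [seq sat n g k (j :: i :: r) f | j <- iota 0 n & sat n g k (j :: i :: r) p] | i <- iota 0 m].

Lemma collect_ok B n k M p f r R C A I L :
  fits B n k M -> all (gtn n) r -> wf (size r).+2 p -> wf (size r).+2 f ->
  exec B (collect p f) (lay n (Store M (trues k) R C A I) (encv r) L)
    (lay n (Store M (trues k) R C (rev (collected n (madj n M) k r p f n) ++ A) I) (encv r) L).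
Proof.
move=> fB hr wp wf'; have /and4P [/eqP sM nnB nB kB] := fB.
pose F x := Store M (trues k) R C (rev (collected n (madj n M) k r p f x) ++ A) I.
apply: (@forV_ok B n _ F _ _ nB) => x lx L'; rewrite -encv_cons.
pose G y := Store M (trues k) R C (rev
  [seq sat n (madj n M) k (j :: x :: r) f | j <- iota 0 y & sat n (madj n M) k (j :: x :: r) p]
  ++ rev (collected n (madj n M) k r p f x) ++ A) I.
have -> : F x.+1 = G n.
  by rewrite /F /G /collected -addn1 iotaD map_cat flatten_cat rev_cat /= cats0 -catA add0n.
apply: (@forV_ok B n _ G _ _ nB) => y ly L2; rewrite -encv_cons.
eexists; first by apply: eval_ok => //=; rewrite ly lx hr.
split=> //=; rewrite /G -[y.+1]addn1 iotaD filter_cat map_cat rev_cat add0n /=.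
case: (sat _ _ _ _ p) => /=; last by lit.
eexists; first by lit.
eexists; first by apply: (@eval_ok B n k M f [:: y, x & r]) => //=; rewrite ly lx hr.
by apply: (@moveBit_ok B 5 12).
Qed.

Definition FTrue : fm := FEq 0 0.

(** The new entries wait on stack 12 so that all of them are computed from the old matrix; the move
    to stack 1 undoes the reversal. *)
Definition remap (f : fm) : cmd := collect FTrue f ;; clearAll 1 ;; moveAll 12 1.

Lemma mx_collected n g k r f : collected n g k r FTrue f n = mx n (fun i j => sat n g k [:: j, i & r] f).
Proof.
rewrite /collected /mx; congr flatten; apply: eq_map => i; congr map.
by apply/all_filterP/allP => j _; rewrite /= eqxx.
Qed.

Lemma size_mx n g : size (mx n g) = n * n.
Proof. by rewrite size_allpairs size_iota. Qed.

Lemma madj_mx n g x y : x < n -> y < n -> madj n (mx n g) x y = g x y.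
Proof.
move=> lx ly; rewrite /madj /mx.
have gen m a : x < m -> nth false [seq g i j | i <- iota a m, j <- iota 0 n] (x * n + y) = g (a + x) y.
  elim: m a x {lx} => [|m IH] a [|x] // lx.
    rewrite mul0n add0n /= nth_cat size_map size_iota ly (nth_map 0) ?size_iota //.
    by rewrite nth_iota // add0n addn0.
  by rewrite /= nth_cat size_map size_iota mulSn -addnA ltnNge leq_addr /= addKn IH // addnS addSn.
by rewrite gen.
Qed.

Lemma remap_ok B n k M f r R C I L :
  fits B n k M -> all (gtn n) r -> wf (size r).+2 f ->
  exec B (remap f) (lay n (Store M (trues k) R C [::] I) (encv r) L)
    (lay n (Store (mx n (fun i j => sat n (madj n M) k [:: j, i & r] f)) (trues k) R C [::] I) (encv r) L).
Proof.
move=> fB hr wff; have /and4P [/eqP sM nnB nB kB] := fB.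
eexists; first by apply: collect_ok.
rewrite cats0 mx_collected; eexists.
  by apply: (@clearAll_ok B 1); rewrite //= sM.
rewrite /lay /=; set w := mx _ _.
have := @moveAll_ok B 12 1 [:: [::]; [::]; trues n; trues k; encv r; R; L; C; [::]; [::]; [::]; [::]; rev w; I] (rev w).
by rewrite /= revK cats0; apply=> //; rewrite size_rev size_mx.
Qed.

(** This lets a rule run beneath the variables of outer loops without changing its meaning. *)
Lemma sat_cat n g k r1 r2 f : wf (size r1) f -> sat n g k (r1 ++ r2) f = sat n g k r1 f.
Proof.
elim: f r1 => [i j|i j|f IH|f IHf h IHh|b f IH] r1 /=.
- by move=> /andP [li lj]; rewrite !nth_cat li lj.
- by move=> /andP [li lj]; rewrite !nth_cat li lj.
- by move=> w; rewrite IH.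
- by move=> /andP [w1 w2]; rewrite IHf // IHh.
- by move=> w; congr (_ < _); apply: eq_count => x; rewrite -cat_cons IH.
Qed.

(** * Loops acting on a pair (matrix, parameter) *)

Definition lays (n : nat) (s : seq bool * nat) (E L : seq bool) : env :=
  lay n (Store s.1 (trues s.2) [::] [::] [::] [::]) E L.

Definition implements (B n : nat) (r : seq nat) (c : cmd) (F : seq bool * nat -> seq bool * nat) : Prop :=
  forall s L, fits B n s.2 s.1 ->
    fits B n (F s).2 (F s).1 /\ exec B c (lays n s (encv r) L) (lays n (F s) (encv r) L).

Lemma implements_forV B n r c F :
  (forall x, x < n -> implements B n (x :: r) c (F x)) ->
  implements B n r (forV c) (fun s => foldl (fun s x => F x s) s (iota 0 n)).
Proof.
move=> h s L fs.
have nB : n <= B by case/and4P: fs.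
pose G x := foldl (fun s x => F x s) s (iota 0 x).
have GS x : G x.+1 = F x (G x) by rewrite /G -addn1 iotaD foldl_cat /= add0n.
have fG x : x <= n -> fits B n (G x).2 (G x).1.
  elim: x => [|x IH] // lx; rewrite GS; have [] // := h x lx (G x) L (IH (ltnW lx)).
split; first exact: fG.
apply: (@forV_ok B n c (fun x => Store (G x).1 (trues (G x).2) [::] [::] [::] [::]) _ _ nB) => x lx L'.
rewrite -encv_cons GS; have [] // := h x lx (G x) L' (fG x (ltnW lx)).
Qed.

Lemma implements_seq B n r c1 c2 F1 F2 :
  implements B n r c1 F1 -> implements B n r c2 F2 -> implements B n r (c1 ;; c2) (fun s => F2 (F1 s)).
Proof.
move=> h1 h2 s L fs; have [f1 e1] := h1 s L fs; have [f2 e2] := h2 _ L f1.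
by split=> //; eexists; first exact: e1.
Qed.

(** The parameter pays for the edge before the matrix is rebuilt. At parameter 0 nothing can be
    paid, and the edge is kept. *)
Definition delcmd (f d : fm) : cmd :=
  eval f ;; If 5 id (Pop 5 ;; If 3 id (Pop 3 ;; remap d) Skip) (Pop 5).

Definition delfun n (f d : fm) (r : seq nat) (s : seq bool * nat) : seq bool * nat :=
  if sat n (madj n s.1) s.2 r f then
    if s.2 is k.+1 then (mx n (fun i j => sat n (madj n s.1) k [:: j, i & r] d), k) else s
  else s.

Definition isocmd (f d : fm) : cmd :=
  eval f ;; If 5 id (Pop 5 ;; remap d) (Pop 5).

Definition isofun n (f d : fm) (r : seq nat) (s : seq bool * nat) : seq bool * nat :=
  if sat n (madj n s.1) s.2 r f
  then (mx n (fun i j => sat n (madj n s.1) s.2 [:: j, i & r] d), s.2) else s.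

Lemma fits_mx B n k M g : fits B n k M -> fits B n k (mx n g).
Proof. by case/and4P=> [_ h1 h2 h3]; apply/and4P; split=> //; rewrite size_mx. Qed.

Lemma implements_del B n r f d : all (gtn n) r -> wf (size r) f -> wf (size r).+2 d ->
  implements B n r (delcmd f d) (delfun n f d r).
Proof.
move=> hr w1 w2 [M k] L fs; split.
  rewrite /delfun; case: ifP => //= _; case: k fs => // k fs.
  by apply: (fits_mx (M := M)); case/and4P: fs => *; apply/and4P; split=> //; apply: ltnW.
eexists; first exact: eval_ok.
split=> //=; rewrite /delfun /=; case: sat => /=; last by lit.
eexists; first by lit.
split=> //=; case: k fs => [|k] fs //=.
eexists; first by lit.
apply: (@remap_ok B n k M d r [::] [::] [::] L) => //.
by case/and4P: fs => *; apply/and4P; split=> //; apply: ltnW.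
Qed.

Lemma implements_iso B n r f d : all (gtn n) r -> wf (size r) f -> wf (size r).+2 d ->
  implements B n r (isocmd f d) (isofun n f d r).
Proof.
move=> hr w1 w2 [M k] L fs; split.
  by rewrite /isofun; case: ifP => //= _; apply: (fits_mx (M := M)).
eexists; first exact: eval_ok.
split=> //=; rewrite /isofun /=; case: sat => /=; last by lit.
eexists; first by lit.
exact: (@remap_ok B n k M d r [::] [::] [::] L).
Qed.

(** * Reading the input and writing the output *)

Definition parse (i : nat) : cmd :=
  While 13 id (Pop 13 ;; moveBit 13 i) ;; Pop 13 ;; Pop 13.

(** Stack 0 grows at its front, so a field is written from its end, and the fields in the reverse of
    their order in [encode]. *)
Definition emit (i : nat) : cmd :=
  Push 0 false ;; Push 0 false ;; While i xpredT (moveBit i 0 ;; Push 0 true).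

Lemma field_cons b w : field (b :: w) = true :: b :: field w.
Proof. by []. Qed.

Lemma parse_ok B i s w r : i < 13 -> 13 < size s -> size w <= B ->
  nth [::] s 13 = field w ++ r ->
  exec B (parse i) s (set_nth [::] (set_nth [::] s 13 r) i (rev w ++ nth [::] s i)).
Proof.
move=> li ls le e.
pose F y := set_nth [::] (set_nth [::] s 13 (field (drop y w) ++ r)) i (rev (take y w) ++ nth [::] s i).
have F0 : F 0 = s by rewrite /F drop0 take0 -e !upd_id //; lia.
have szF y : size (F y) = size s by rewrite /F; env_size.
have nF y : nth [::] (F y) 13 = field (drop y w) ++ r by rewrite /F !updE eqxx gtn_eqF.
have h : exec B (While 13 id (Pop 13 ;; moveBit 13 i)) (F 0) (F (size w)).
  apply: exec_while => //.
  - by move=> y _; rewrite szF.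
  - move=> y ly; rewrite nF (drop_nth true ly) field_cons; split=> //.
    eexists; first by split; rewrite ?szF // nF (drop_nth true ly).
    rewrite nF (drop_nth true ly) field_cons /=; set s1 := set_nth _ _ _ _.
    have := @moveBit_ok B 13 i s1 (nth true w y) (field (drop y.+1 w) ++ r).
    have ->: F y.+1 = set_nth [::] (set_nth [::] s1 13 (field (drop y.+1 w) ++ r)) i
       (nth true w y :: nth [::] s1 i).
      by rewrite /s1 /F (take_nth true ly) rev_rcons; env_ext.
    by apply; rewrite /s1 ?updE ?size_set_nth ?szF //; lia.
  - by rewrite nF drop_size.
rewrite F0 in h; eexists; first exact: h.
have nw : nth [::] (F (size w)) 13 = [:: false, false & r] by rewrite nF drop_size.
eexists; first by split; rewrite ?szF // nw.
split; [by rewrite size_set_nth szF; lia | by rewrite updE nw |].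
by rewrite updE nw /F take_size; env_ext.
Qed.

Lemma emit_ok B i s w : 0 < i -> i < size s -> size w <= B -> nth [::] s i = rev w ->
  exec B (emit i) s (set_nth [::] (set_nth [::] s i [::]) 0 (field w ++ nth [::] s 0)).
Proof.
move=> i0 li le e.
pose v y := drop (size w - y) w.
pose F y := set_nth [::] (set_nth [::] s i (rev (take (size w - y) w))) 0 (field (v y) ++ nth [::] s 0).
have szF y : size (F y) = size s by rewrite /F; env_size.
have nF y : nth [::] (F y) i = rev (take (size w - y) w) by rewrite /F !updE eqxx gtn_eqF.
exists (set_nth [::] s 0 (false :: nth [::] s 0)); first by split=> //; lia.
exists (F 0).
  split; first by rewrite size_set_nth; lia.
  by rewrite /F /v subn0 drop_size take_size; env_ext.
have -> : set_nth [::] (set_nth [::] s i [::]) 0 (field w ++ nth [::] s 0) = F (size w).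
  by rewrite /F /v subnn drop0 take0.
apply: exec_while => //.
- by move=> y _; rewrite szF.
- move=> y ly; set q := size w - y.+1.
  have lq : q < size w by rewrite /q; lia.
  have eq : size w - y = q.+1 by rewrite /q; lia.
  have tk : rev (take (size w - y) w) = nth true w q :: rev (take q w).
    by rewrite eq (take_nth true lq) rev_rcons.
  rewrite nF tk; split=> //.
  eexists; first by apply: (@moveBit_ok B i 0 _ (nth true w q) (rev (take q w))); rewrite ?nF ?szF //; lia.
  split; first by rewrite ?size_set_nth ?szF; lia.
  have e0 : nth [::] (F y) 0 = field (v y) ++ nth [::] s 0 by rewrite /F updE.
  rewrite e0 /F /v eq -/q (drop_nth true lq) field_cons.
  by env_ext.
- by rewrite nF subnn take0.
Qed.

Lemma size_bin m : size (bin m) <= m.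
Proof.
case: m => // m; rewrite /bin size_map size_iota.
have := trunc_logP (p := 2) (n := m.+1) isT isT; have := ltn_expl (trunc_log 2 m.+1) (isT : 1 < 2); lia.
Qed.

Lemma bits_value L m : m < 2 ^ L ->
  foldr (fun (b : bool) u => u.*2 + b) 0 [seq odd (m %/ 2 ^ i) | i <- iota 0 L] = m.
Proof.
elim: L m => [|L IH] m lm; first by move: lm; rewrite expn0; case: m.
rewrite /= expn0 divn1 -[1]addn0 iotaDl -map_comp.
rewrite (eq_map (g := fun i => odd (m./2 %/ 2 ^ i))); last first.
  by move=> i /=; rewrite expnS divnMA divn2.
by rewrite IH; [rewrite addnC odd_double_half | move: lm; rewrite expnS; lia].
Qed.

Lemma bin_value m : foldl (fun u (b : bool) => u.*2 + b) 0 (rev (bin m)) = m.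
Proof.
case: m => // m; rewrite foldl_rev /bin bits_value //.
by apply: trunc_log_ltn.
Qed.

Definition hstep c u (b : bool) := minn (u.*2 + b) c.

(** Capping at every step amounts to capping once at the end, because a capped value stays at or
    above [c] after doubling. *)
Lemma hstep_value c m : foldl (hstep c) 0 (rev (bin m)) = minn m c.
Proof.
rewrite -{2}(bin_value m) -{1}(min0n c); move: (rev _) (0) => v; elim: v => //= b v IH a.
by rewrite -IH /hstep; congr foldl; lia.
Qed.

(* Binary (stack 7, most significant bit first) to unary (stack 3), capped by the
   length of stack 12: the parameter may be exponential in the size of the input. *)
Definition horner : cmd :=
  While 7 xpredT (moveT 3 9 ;; While 9 id (Pop 9 ;; Push 10 true ;; Push 10 true) ;;
    If 7 id (Pop 7 ;; Push 10 true) (Pop 7) ;; copyT 12 9 11 ;;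
    While 11 id (Pop 11 ;; If 10 id (Pop 10 ;; Push 3 true) Skip) ;; clearT 10).

Lemma horner_ok B c v a0 a1 a2 a4 a5 a6 a8 a13 :
  c.*2.+1 <= B -> size v <= B ->
  exec B horner [:: a0; a1; a2; [::]; a4; a5; a6; v; a8; [::]; [::]; [::]; trues c; a13]
    [:: a0; a1; a2; trues (foldl (hstep c) 0 v); a4; a5; a6; [::]; a8; [::]; [::]; [::]; trues c; a13].
Proof.
move=> cB vB.
pose U y := foldl (hstep c) 0 (take y v).
have Uc y : U y <= c.
  rewrite /U; move: (take y v); case/lastP=> // w b; rewrite foldl_rcons; exact: geq_minr.
pose F y := [:: a0; a1; a2; trues (U y); a4; a5; a6; drop y v; a8; [::]; [::]; [::]; trues c; a13].
have h : exec B horner (F 0) (F (size v)); last by rewrite /F /U drop0 take0 drop_size take_size in h.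
apply: exec_while => //; last by rewrite /= drop_size.
move=> y ly; split; first by rewrite /= (drop_nth true ly).
eexists; first by apply: (@moveT_ok B 3 9 _ (U y) [::]); rewrite ?cats0 //; have := Uc y; lia.
rewrite /= cats0; set u := U y.
have uc : u <= c := Uc y.
pose D z := [:: a0; a1; a2; [::]; a4; a5; a6; drop y v; a8; trues (u - z); trues z.*2; [::]; trues c; a13].
have h : exec B (While 9 id (Pop 9 ;; Push 10 true ;; Push 10 true)) (D 0) (D u).
  apply: (@exec_countdown B 9 _ D [::] u) => // [|z _|z lz]; first lia.
    by rewrite cats0.
  by rewrite /= cats0; eexists; lit.
rewrite /D subn0 subnn in h; eexists; first exact: h.
exists [:: a0; a1; a2; [::]; a4; a5; a6; drop y.+1 v; a8; [::]; trues (u.*2 + nth true v y); [::]; trues c; a13].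
  rewrite (drop_nth true ly); move: (nth true v y) => b; split=> //; case: b => /=.
    by rewrite addn1; eexists; lit.
  by rewrite addn0; lit.
set d := u.*2 + _.
eexists; first by apply: (@copyT_ok B 12 9 11 _ c) => //; lia.
rewrite /= cats0.
pose G z := [:: a0; a1; a2; trues (minn d z); a4; a5; a6; drop y.+1 v; a8; [::]; trues (d - z); trues (c - z); trues c; a13].
have {}h : exec B (While 11 id (Pop 11 ;; If 10 id (Pop 10 ;; Push 3 true) Skip)) (G 0) (G c).
  apply: (@exec_countdown B 11 _ G [::] c) => // [|z _|z lz]; first lia.
    by rewrite cats0.
  rewrite /= cats0 /G; split=> //=; case: (ltnP z d) => lzd.
    rewrite -(subnSK lzd) /=; eexists; first by lit.
    by rewrite (_ : minn d z.+1 = z.+1); [lit | lia].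
  by rewrite (_ : d - z = 0) 1?(_ : d - z.+1 = 0) 1?(_ : minn d z.+1 = d) //; lia.
rewrite /G minn0 !subn0 subnn in h; eexists; first exact: h.
have -> : F y.+1 = set_nth [::] (G c) 10 [::].
  by rewrite /F /G /U (take_nth true ly) foldl_rcons subnn.
rewrite /G subnn.
by apply: (@clearT_ok B 10 _ (d - c) [::]); rewrite ?cats0 //; lia.
Qed.

(** Moving the matrix to stack 1 leaves one mark per entry on stack 12; these [n * n] marks are the
    cap for both numbers. Every [moveAll] reverses its stack, hence the detour through stack 9. *)
Definition readin : cmd :=
  parse 7 ;; parse 8 ;; parse 10 ;; While 10 xpredT (moveBit 10 1 ;; Push 12 true) ;;
  horner ;; moveT 3 2 ;; moveAll 8 9 ;; moveAll 9 7 ;; horner ;; clearT 12.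

Lemma readin_ok B n k M :
  size M = n * n -> (n * n).*2.+1 <= B -> size (bin k) <= B ->
  exec B readin (rcons (nseq 13 [::]) (field (bin n) ++ field (bin k) ++ field M))
    (lays n (M, minn k (n * n)) (encv [::]) [::]).
Proof.
move=> sM cB kB.
have nB : size (bin n) <= B by apply: leq_trans (size_bin n) _; nia.
eexists; first exact: (@parse_ok B 7 _ (bin n)).
eexists; first exact: (@parse_ok B 8 _ (bin k) (field M)).
eexists; first by apply: (@parse_ok B 10 _ M [::]); rewrite ?cats0 // sM; lia.
rewrite /= !cats0.
pose F y := [:: [::]; drop (size M - y) M; [::]; [::]; [::]; [::]; [::]; rev (bin n); rev (bin k); [::];
  rev (take (size M - y) M); [::]; trues y; [::]].
have h : exec B (While 10 xpredT (moveBit 10 1 ;; Push 12 true)) (F 0) (F (size M)).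
  apply: exec_while => //; first by rewrite sM; lia.
  - move=> y ly; set q := size M - y.+1; have eq : size M - y = q.+1 by rewrite /q; lia.
    have lq : q < size M by rewrite /q; lia.
    rewrite /F eq -/q (take_nth true lq) rev_rcons (drop_nth true lq); split=> //.
    by eexists; [exact: (@moveBit_ok B 10 1) | lit].
  - by rewrite /F subnn take0.
rewrite /F subn0 drop_size take_size subnn take0 drop0 sM in h.
eexists; first exact: h.
eexists; first by apply: horner_ok; rewrite // size_rev.
(* Since [n <= n * n], the cap leaves the number of vertices unchanged. *)
rewrite hstep_value (_ : minn n _ = n); last by case: (n) => // m; nia.
eexists; first by apply: (@moveT_ok B 3 2 _ n [::]); rewrite ?cats0 //; nia.
rewrite /= cats0.
eexists; first by apply: (@moveAll_ok B 8 9 _ (rev (bin k))); rewrite ?size_rev.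
rewrite /= cats0 revK.
eexists; first by apply: (@moveAll_ok B 9 7 _ (bin k)).
rewrite /= cats0.
eexists; first by apply: horner_ok; rewrite // size_rev.
rewrite hstep_value.
by apply: (@clearT_ok B 12 _ (n * n) [::]); rewrite ?cats0 //=; lia.
Qed.

(* Unary (stack 3) to binary (stack 8, most significant bit first). *)
Definition tobin : cmd :=
  While 3 id (While 3 id (Pop 3 ;; If 3 id (Pop 3 ;; Push 10 true) (Push 5 true)) ;;
    If 5 id (Pop 5 ;; Push 8 true) (Push 8 false) ;; moveT 10 3).

Lemma size_binE m : size (bin m) = if m is 0 then 0 else (trunc_log 2 m).+1.
Proof. by case: m => // m; rewrite size_map size_iota. Qed.

Lemma tobin_ok B m a0 a1 a2 a4 a6 a7 a9 a11 a12 a13 : m <= B ->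
  exec B tobin [:: a0; a1; a2; trues m; a4; [::]; a6; a7; [::]; a9; [::]; a11; a12; a13]
   [:: a0; a1; a2; [::]; a4; [::]; a6; a7; rev (bin m); a9; [::]; a11; a12; a13].
Proof.
move=> mB; pose U y := m %/ 2 ^ y.
have US y : U y.+1 = (U y)./2 by rewrite /U expnSr divnMA divn2.
have Um y : U y <= m by apply: leq_div.
pose F y := [:: a0; a1; a2; trues (U y); a4; [::]; a6; a7; rev [seq odd (U i) | i <- iota 0 y];
  a9; [::]; a11; a12; a13].
have U0 y : (0 < U y) = (y < size (bin m)).
  rewrite size_binE /U divn_gt0 ?expn_gt0 //; case: m {mB F U US Um} => [|m].
    by rewrite leqn0 expn_eq0.
  apply/idP/idP => [h|h].
    have := trunc_log_ltn m.+1 (isT : 1 < 2) => h2.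
    by have := leq_ltn_trans h h2; rewrite ltn_exp2l.
  by apply: leq_trans (trunc_logP (isT : 1 < 2) (isT : 0 < m.+1)); rewrite leq_exp2l.
have fin : F (size (bin m)) = [:: a0; a1; a2; [::]; a4; [::]; a6; a7; rev (bin m); a9; [::]; a11; a12; a13].
  rewrite /F; have := U0 (size (bin m)); rewrite ltnn; case: (U _) => // _.
  by rewrite (_ : map _ _ = bin m) // /U; case: (m) => // p; rewrite size_binE.
have h : exec B tobin (F 0) (F (size (bin m))); last by rewrite fin /F /U expn0 divn1 in h.
apply: exec_while => //; last by rewrite fin.
  by apply: leq_trans (size_bin m) mB.
move=> y; rewrite -U0 => ly; split; first by rewrite /F; case: (U y) ly.
set u := U y in ly; have uB : u <= B by apply: leq_trans (Um y) mB.
set t8 := rev [seq odd (U i) | i <- iota 0 y].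
(* Each inner iteration takes two marks from [u] and adds one to stack 10. If [u] is odd, the last
   one takes a single mark and records it on stack 5: this is the next binary digit. *)
pose D z := [:: a0; a1; a2; trues (u - z.*2); a4; trues (z.*2 - u); a6; a7; t8;
  a9; trues (minn z u./2); a11; a12; a13].
have h : exec B (While 3 id (Pop 3 ;; If 3 id (Pop 3 ;; Push 10 true) (Push 5 true))) (D 0) (D (uphalf u)).
  apply: exec_while => //; first by lia.
  - move=> z lz; rewrite /D /=; have e : u - z.*2 = (u - z.*2).-1.+1 by lia.
    rewrite {1}e; split=> //; eexists; first by rewrite e; lit.
    split=> //=; have e5 : z.*2 - u = 0 by lia.
    rewrite e5; case E: (u - z.*2).-1 => [|p] /=.
      rewrite (_ : u - z.+1.*2 = 0) 1?(_ : z.+1.*2 - u = 1) 1?(_ : minn z u./2 = minn z.+1 u./2); try lia.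
      by lit.
    eexists; first by lit.
    rewrite (_ : u - z.+1.*2 = p) 1?(_ : z.+1.*2 - u = 0) 1?(_ : minn z.+1 u./2 = (minn z u./2).+1); try lia.
    by lit.
  - by rewrite /= (_ : u - _ = 0) //; lia.
rewrite /D subn0 min0n (_ : 0.*2 - u = 0) // in h; eexists; first exact: h.
rewrite (_ : u - (uphalf u).*2 = 0) 1?(_ : (uphalf u).*2 - u = odd u) 1?(_ : minn (uphalf u) u./2 = u./2); try lia.
exists [:: a0; a1; a2; [::]; a4; [::]; a6; a7; odd u :: t8; a9; trues u./2; a11; a12; a13].
  by split=> //=; case: (odd u) => /=; [eexists; lit | lit].
have -> : F y.+1 = [:: a0; a1; a2; trues u./2; a4; [::]; a6; a7; odd u :: t8; a9; [::]; a11; a12; a13].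
  by rewrite /F US -addn1 iotaD map_cat rev_cat.
have := @moveT_ok B 10 3 [:: a0; a1; a2; [::]; a4; [::]; a6; a7; odd u :: t8; a9; trues u./2; a11; a12; a13] u./2 [::].
by rewrite /= !cats0; apply=> //; lia.
Qed.

Fixpoint pushes (w : seq bool) : cmd :=
  if w is b :: w' then pushes w' ;; Push 0 b else Skip.

Lemma pushes_ok B w r s : exec B (pushes w) (r :: s) ((w ++ r) :: s).
Proof. by elim: w => //= b w IH; eexists; [exact: IH | lit]. Qed.

Fixpoint dec (d : nat) : cmd :=
  if d is d'.+1 then If 8 id (Pop 8) Skip ;; dec d' else Skip.

Lemma dec_ok B d x a0 a1 a2 a3 a4 a5 a6 a7 a9 :
  exec B (dec d) [:: a0, a1, a2, a3, a4, a5, a6, a7, trues x & a9]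
    [:: a0, a1, a2, a3, a4, a5, a6, a7, trues (x - d) & a9].
Proof.
elim: d x => [|d IH] x; first by rewrite subn0.
exists [:: a0, a1, a2, a3, a4, a5, a6, a7, trues x.-1 & a9]; first by case: x => [|x]; split.
by rewrite (_ : x - d.+1 = x.-1 - d) ?IH //; lia.
Qed.

Definition dec3 (d : nat) : cmd :=
  copyT 3 9 10 ;; While 10 id (Pop 10 ;; copyT 3 9 11 ;; While 11 id (Pop 11 ;;
    copyT 3 9 12 ;; While 12 id (Pop 12 ;; dec d))).

Lemma dec3_ok B d k x a0 a1 a2 a4 a5 a6 a7 a13 : k <= B ->
  exec B (dec3 d)
    [:: a0; a1; a2; trues k; a4; a5; a6; a7; trues x; [::]; [::]; [::]; [::]; a13]
    [:: a0; a1; a2; trues k; a4; a5; a6; a7; trues (x - d * k ^ 3); [::]; [::]; [::]; [::]; a13].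
Proof.
move=> kB.
pose S y p q r := [:: a0; a1; a2; trues k; a4; a5; a6; a7; trues y; [::]; trues p; trues q; trues r; a13].
have h3 y p q : exec B (copyT 3 9 12 ;; While 12 id (Pop 12 ;; dec d)) (S y p q 0) (S (y - d * k) p q 0).
  eexists; first by apply: (@copyT_ok B 3 9 12 _ k).
  rewrite /= cats0; pose F z := S (y - d * z) p q (k - z).
  have h : exec B (While 12 id (Pop 12 ;; dec d)) (F 0) (F k).
    apply: (@exec_countdown B 12 _ F [::] k) => // [z _|z lz]; first by rewrite cats0.
    by rewrite /F /= cats0 mulnSr subnDA; apply: dec_ok.
  by rewrite /F muln0 !subn0 subnn in h.
have h2 y p : exec B (copyT 3 9 11 ;; While 11 id (Pop 11 ;; copyT 3 9 12 ;; While 12 id (Pop 12 ;; dec d)))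
    (S y p 0 0) (S (y - d * k * k) p 0 0).
  eexists; first by apply: (@copyT_ok B 3 9 11 _ k).
  rewrite /= cats0; pose F z := S (y - d * k * z) p (k - z) 0.
  have h : exec B (While 11 id (Pop 11 ;; copyT 3 9 12 ;; While 12 id (Pop 12 ;; dec d))) (F 0) (F k).
    apply: (@exec_countdown B 11 _ F [::] k) => // [z _|z lz]; first by rewrite cats0.
    by rewrite /F /= cats0 mulnSr subnDA; apply: h3.
  by rewrite /F muln0 !subn0 subnn in h.
eexists; first by apply: (@copyT_ok B 3 9 10 _ k).
rewrite /= cats0; pose F z := S (x - d * k * k * z) (k - z) 0 0.
have h : exec B (While 10 id (Pop 10 ;; copyT 3 9 11 ;; While 11 id (Pop 11 ;;
    copyT 3 9 12 ;; While 12 id (Pop 12 ;; dec d)))) (F 0) (F k).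
  apply: (@exec_countdown B 10 _ F [::] k) => // [z _|z lz]; first by rewrite cats0.
  by rewrite /F /= cats0 mulnSr subnDA; apply: h2.
rewrite /F muln0 !subn0 subnn in h.
by rewrite (_ : d * k ^ 3 = d * k * k * k) // !expnS expn0; lia.
Qed.

(** Truncated subtraction of [d * k ^ 3] and then [d] from the number of vertices satisfying [f]
    leaves stack 8 nonempty exactly when the bound is exceeded. *)
Definition writeout (d : nat) (f : fm) (p : fm) (reject : seq bool) : cmd :=
  forV (eval f ;; If 5 id (Pop 5 ;; Push 13 true) (Pop 5)) ;;
  copyT 13 9 8 ;; dec3 d ;; dec d ;;
  If 8 id (pushes reject)
    (collect p (FAdj 1 0) ;; emit 12 ;; tobin ;; emit 8 ;; moveT 13 3 ;; tobin ;; emit 8).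

Lemma writeout_ok B n k M d f p reject :
  fits B n k M -> wf 1 f -> wf 2 p ->
  let n' := count (fun x => sat n (madj n M) k [:: x] f) (iota 0 n) in
  exists2 s, exec B (writeout d f p reject) (lays n (M, k) (encv [::]) [::]) s &
    head [::] s = if d * k ^ 3 + d < n' then reject else
      field (bin n') ++ field (bin k) ++ field (collected n (madj n M) k [::] p (FAdj 1 0) n).
Proof.
move=> fB wff wfp n'; have /and4P [/eqP sM nnB nB kB] := fB.
pose F x := Store M (trues k) [::] [::] [::] (trues (count (fun x => sat n (madj n M) k [:: x] f) (iota 0 x))).
have n'B : n' <= B.
  by apply: leq_trans nB; rewrite -[X in _ <= X](size_iota 0 n) count_size.
have h : exec B (forV (eval f ;; If 5 id (Pop 5 ;; Push 13 true) (Pop 5)))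
   (lay n (F 0) (encv [::]) [::]) (lay n (F n) (encv [::]) [::]).
  apply: (@forV_ok B n _ F _ _ nB) => x lx L'; rewrite -encv_cons.
  eexists; first by apply: eval_ok => //=; rewrite lx.
  split=> //=; rewrite /F count_iotaS; case: sat => /=.
    by rewrite addn1; eexists; lit.
  by rewrite addn0; lit.
rewrite /F /= -/n' in h.
suff [s e hs] : exists2 s, exec B (If 8 id (pushes reject)
    (collect p (FAdj 1 0) ;; emit 12 ;; tobin ;; emit 8 ;; moveT 13 3 ;; tobin ;; emit 8))
    [:: [::]; M; trues n; trues k; encv [::]; [::]; [::]; [::]; trues (n' - d * k ^ 3 - d);
        [::]; [::]; [::]; [::]; trues n'] s &
    head [::] s = if d * k ^ 3 + d < n' then reject else
      field (bin n') ++ field (bin k) ++ field (collected n (madj n M) k [::] p (FAdj 1 0) n).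
  exists s => //; eexists; first exact: h.
  eexists; first by apply: (@copyT_ok B 13 9 8 _ n').
  rewrite /= cats0.
  eexists; first exact: dec3_ok.
  by eexists; first exact: dec_ok.
case: ltnP => cmp.
  have e : n' - d * k ^ 3 - d = (n' - d * k ^ 3 - d).-1.+1 by lia.
  eexists; first by rewrite e; split=> //; apply: pushes_ok.
  by rewrite cats0.
rewrite (_ : n' - d * k ^ 3 - d = 0); last lia.
set w := collected _ _ _ _ _ _ _.
have sw : size w <= n * n.
  rewrite /w /collected size_flatten /shape -map_comp.
  set g := _ \o _; suff H m : sumn [seq g i | i <- iota 0 m] <= m * n by [].
  elim: m => [|m IH] //; rewrite -addn1 iotaD map_cat sumn_cat /= addn0 mulnDl mul1n.
  apply: leq_add => //; rewrite /g /= size_map size_filter.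
  by rewrite -[X in _ <= X](size_iota 0 n) count_size.
have bB m : m <= B -> size (bin m) <= B by apply: leq_trans (size_bin m).
eexists.
  split=> //.
  eexists; first by apply: (@collect_ok B n k M p (FAdj 1 0) [::] [::] [::] [::] (trues n') [::] fB).
  rewrite cats0 -/w /=.
  eexists; first by apply: (@emit_ok B 12 _ w) => //; lia.
  rewrite /= cats0.
  eexists; first exact: tobin_ok.
  eexists; first by apply: (@emit_ok B 8 _ (bin k)) => //; exact: bB.
  rewrite /=.
  eexists; first by apply: (@moveT_ok B 13 3 _ n' [::]); rewrite ?cats0.
  rewrite /= cats0.
  eexists; first exact: tobin_ok.
  by apply: (@emit_ok B 8 _ (bin n')) => //; exact: bB.
by [].
Qed.

(** * The complete program: rounds of reductions between input and output *)

Definition kernelize (fE dE fV dV f p : fm) (d : nat) (reject : seq bool) : cmd :=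
  readin ;;
  forV (forV (forV (forV (delcmd fE dE)) ;; forV (isocmd fV dV))) ;;
  writeout d f p reject.

Definition round (n : nat) (fE dE fV dV : fm) (s : seq bool * nat) : seq bool * nat :=
  foldl (fun s v => isofun n fV dV [:: v] s)
    (foldl (fun s x => foldl (fun s y => delfun n fE dE [:: y; x] s) s (iota 0 n)) s (iota 0 n))
    (iota 0 n).

Definition reduce (n : nat) (fE dE fV dV : fm) (s : seq bool * nat) : seq bool * nat :=
  iter (n * n) (round n fE dE fV dV) s.

Lemma implements_eq B n r c F G : implements B n r c F -> (forall s, F s = G s) -> implements B n r c G.
Proof. by move=> h e s L fs; rewrite -e; apply: h. Qed.

Lemma foldl_eq (T S : Type) (F G : S -> T -> S) s xs :
  (forall s x, F s x = G s x) -> foldl F s xs = foldl G s xs.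
Proof. by move=> e; elim: xs s => //= x xs IH s; rewrite e IH. Qed.

Lemma foldl_const (T S : Type) (F : S -> S) s (xs : seq T) :
  foldl (fun s _ => F s) s xs = iter (size xs) F s.
Proof. by elim: xs s => //= x xs IH s; rewrite IH -iterSr. Qed.

Lemma delfun_cat n f d r1 r2 s : wf (size r1) f -> wf (size r1).+2 d ->
  delfun n f d (r1 ++ r2) s = delfun n f d r1 s.
Proof.
move=> w1 w2; rewrite /delfun sat_cat //; case: ifP => // _; case: s.2 => // k; congr (_, _).
congr flatten; apply: eq_map => i; apply: eq_map => j.
by rewrite -(sat_cat _ _ _ r2 (r1 := [:: j, i & r1])).
Qed.

Lemma isofun_cat n f d r1 r2 s : wf (size r1) f -> wf (size r1).+2 d ->
  isofun n f d (r1 ++ r2) s = isofun n f d r1 s.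
Proof.
move=> w1 w2; rewrite /isofun sat_cat //; case: ifP => // _; congr (_, _).
congr flatten; apply: eq_map => i; apply: eq_map => j.
by rewrite -(sat_cat _ _ _ r2 (r1 := [:: j, i & r1])).
Qed.

(** The two outermost loops only repeat a round [n * n] times; their variables lie below those of
    the rules, which ignore them. *)
Lemma implements_reduce B n fE dE fV dV : wf 2 fE -> wf 4 dE -> wf 1 fV -> wf 3 dV ->
  implements B n [::] (forV (forV (forV (forV (delcmd fE dE)) ;; forV (isocmd fV dV))))
    (reduce n fE dE fV dV).
Proof.
move=> w1 w2 w3 w4.
have wfle m m' f : m <= m' -> wf m f -> wf m' f.
  elim: f m m' => [i j|i j|f IH|f IHf g IHg|b f IH] m m' /= le.
  - by move=> /andP [h1 h2]; rewrite !(leq_trans _ le).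
  - by move=> /andP [h1 h2]; rewrite !(leq_trans _ le).
  - exact: IH.
  - by move=> /andP [h1 h2]; rewrite (IHf _ _ le) ?(IHg _ _ le).
  - exact: IH.
have hr a b : a < n -> b < n -> implements B n [:: b; a]
    (forV (forV (delcmd fE dE)) ;; forV (isocmd fV dV)) (round n fE dE fV dV).
  move=> la lb; apply: (implements_seq (F1 := fun s =>
    foldl (fun s x => foldl (fun s y => delfun n fE dE [:: y; x] s) s (iota 0 n)) s (iota 0 n))
    (F2 := fun s => foldl (fun s v => isofun n fV dV [:: v] s) s (iota 0 n))).
    apply: implements_forV => x lx; apply: implements_forV => y ly.
    apply: (implements_eq (F := delfun n fE dE ([:: y; x] ++ [:: b; a]))).
      by apply: implements_del; rewrite /= ?la ?lb ?lx ?ly //; [apply: wfle w1 | apply: wfle w2].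
    by move=> s; apply: delfun_cat.
  apply: implements_forV => v lv.
  apply: (implements_eq (F := isofun n fV dV ([:: v] ++ [:: b; a]))).
    by apply: implements_iso; rewrite /= ?la ?lb ?lv //; [apply: wfle w3 | apply: wfle w4].
  by move=> s; apply: isofun_cat.
apply: (implements_eq (F := fun s => foldl (fun s a => foldl (fun s b => round n fE dE fV dV s) s (iota 0 n)) s (iota 0 n))).
  by apply: implements_forV => a la; apply: implements_forV => b lb; apply: hr.
move=> s; rewrite (foldl_eq (G := fun s _ => iter n (round n fE dE fV dV) s)); last first.
  by move=> s' a; rewrite foldl_const size_iota.
rewrite foldl_const size_iota /reduce.
have gen m : iter m (iter n (round n fE dE fV dV)) s = iter (m * n) (round n fE dE fV dV) s.
  by elim: m => //= m ->; rewrite mulSn iterD.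
exact: gen.
Qed.

Lemma kernelize_ok B n k M fE dE fV dV f p d reject :
  wf 2 fE -> wf 4 dE -> wf 1 fV -> wf 3 dV -> wf 1 f -> wf 2 p ->
  size M = n * n -> (n * n).*2.+1 <= B -> size (bin k) <= B ->
  let s := reduce n fE dE fV dV (M, minn k (n * n)) in
  let n' := count (fun x => sat n (madj n s.1) s.2 [:: x] f) (iota 0 n) in
  exists2 s', exec B (kernelize fE dE fV dV f p d reject)
    (rcons (nseq 13 [::]) (field (bin n) ++ field (bin k) ++ field M)) s' &
    head [::] s' = if d * s.2 ^ 3 + d < n' then reject else
      field (bin n') ++ field (bin s.2) ++ field (collected n (madj n s.1) s.2 [::] p (FAdj 1 0) n).
Proof.
move=> w1 w2 w3 w4 wff wfp sM cB kB s n'.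
have fs : fits B n (M, minn k (n * n)).2 (M, minn k (n * n)).1.
  by apply/and4P; split=> /=; [apply/eqP | lia | nia | lia].
have [fs' e] := implements_reduce w1 w2 w3 w4 [::] fs.
have [s' e' hs'] := writeout_ok d reject fs' wff wfp.
exists s' => //; eexists; first exact: readin_ok.
by eexists; first exact: e.
Qed.

(** * Graph notions and soundness of the reduction rules *)

(** The map [a] to [a :&: Z] sends [A] onto all singletons of [Z]. This is the counting behind every
    claim that many vertices need a deleted edge of their own. *)
Lemma card_private (T : finType) (Z : {set T}) (A : {set {set T}}) :
  (forall z, z \in Z -> exists2 a, a \in A & a :&: Z = [set z]) -> #|Z| <= #|A|.
Proof.
move=> h; rewrite -(card_imset _ (@set1_inj T)).
apply: leq_trans (leq_imset_card (fun a => a :&: Z) A).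
by apply/subset_leq_card/subsetP => _ /imsetP [z /h [a aA <-] ->]; apply: imset_f.
Qed.

Lemma card_bigcup_le (I T : finType) (P : {set I}) (F : I -> {set T}) m :
  (forall i, i \in P -> #|F i| <= m) -> #|\bigcup_(i in P) F i| <= #|P| * m.
Proof.
move=> h; rewrite -sum_nat_const.
elim/big_ind2: _ => [|s1 B1 s2 B2 h1 h2|i /h //]; first by rewrite cards0.
by apply: leq_trans (leq_add h1 h2); rewrite leq_card_setU.
Qed.

Lemma set2_meet (T : finType) (Z : {set T}) x z :
  x \notin Z -> z \in Z -> [set x; z] :&: Z = [set z].
Proof.
move=> xZ zZ; apply/setP => u; rewrite !inE; case: eqP => [->|_] /=.
  by rewrite (negPf xZ); case: eqP xZ => // ->; rewrite zZ.
by case: eqP => // ->.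
Qed.

Definition dl (n : nat) (e : rel 'I_n) (A : {set {set 'I_n}}) : rel 'I_n :=
  fun x y => e x y && ([set x; y] \notin A).

Definition solvable n (e : rel 'I_n) (k : nat) : Prop :=
  exists2 A : {set {set 'I_n}}, #|A| <= k & paw_free (dl e A).

(** Sets in [A] that are not edges delete nothing, so they may be filtered out. *)
Lemma solvableP (G : graph) k : paw_free_edge_deletion G k <-> solvable (adj G) k.
Proof.
split=> [[A [_ [hA pf]]]|[A hA pf]]; first by exists A.
pose A' := [set a in A | [exists x, exists y, adj G x y && (a == [set x; y])]].
exists A'; split; [|split].
- by move=> a; rewrite inE => /andP [_ /existsP [x /existsP [y /andP [exy /eqP ->]]]]; exists x, y.
- by apply: leq_trans hA; apply/subset_leq_card/subsetP => a; rewrite inE => /andP [].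
- have E x y : delete_edges A' x y = dl (adj G) A x y.
    rewrite /delete_edges /dl inE; case exy: (adj G x y) => //=; congr (~~ _).
    by case: (_ \in A) => //=; apply/existsP; exists x; apply/existsP; exists y; rewrite exy eqxx.
  by move=> x1 x2 x3 x4; have := pf x1 x2 x3 x4; rewrite /induced_paw !E.
Qed.

Lemma paw_ext n (e e' : rel 'I_n) x1 x2 x3 x4 :
  (forall x y, x \in [:: x1; x2; x3; x4] -> y \in [:: x1; x2; x3; x4] -> e x y = e' x y) ->
  induced_paw e x1 x2 x3 x4 = induced_paw e' x1 x2 x3 x4.
Proof. by move=> h; rewrite /induced_paw !h // !inE eqxx ?orbT. Qed.

Lemma dl_sym n (e : rel 'I_n) A : symmetric e -> symmetric (dl e A).
Proof. by move=> se x y; rewrite /dl se setUC. Qed.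

(** For irreflexive [e], equal neighbourhoods exclude an edge [uv]: these are false twins. *)
Definition twin n (e : rel 'I_n) (u v : 'I_n) : bool := [forall w, e u w == e v w].

Lemma twinP n (e : rel 'I_n) u v : reflect (e u =1 e v) (twin e u v).
Proof. by apply: (iffP forallP) => h w; have := h w; [move/eqP | move=> ->]. Qed.

Definition inT n (e : rel 'I_n) (v : 'I_n) : bool :=
  [exists p, exists q, [&& e v p, e v q & e p q]].

Lemma inTP n (e : rel 'I_n) v : reflect (exists p q, [/\ e v p, e v q & e p q]) (inT e v).
Proof.
apply: (iffP existsP) => [[p /existsP [q /and3P [? ? ?]]]|[p [q [? ? ?]]]]; exists p.
  by exists q.
by apply/existsP; exists q; apply/and3P.
Qed.

(** Each [z] completes a triangle [xyz] with a tail [w] at [z]. In [tails] the triangle is fixed and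
    the tail hangs at [x]. *)
Definition apex n (e : rel 'I_n) (x y : 'I_n) : {set 'I_n} :=
  [set z | [&& e z x, e z y & [exists w, [&& e w z, ~~ e w x & ~~ e w y]]]].

Definition tails n (e : rel 'I_n) (x y z : 'I_n) : {set 'I_n} :=
  [set w | [&& e w x, ~~ e w y, ~~ e w z, w != y & w != z]].

(* In both cases, keeping [xy] would cost more than [k] deletions, since each
   counted vertex needs a deleted edge of its own. *)
Definition forced n (e : rel 'I_n) (k : nat) (x y : 'I_n) : bool :=
  e x y && ((k < #|apex e x y|) || (k < #|[set z | [&& e z x, e z y & k < #|tails e x y z|]]|)).

(** A local description of a complete multipartite component: vertices at distance 2 from [v] are
    false twins of [v], and nonadjacency is transitive among the neighbours of [v]. The component
    then consists of these neighbours and the twins. *)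
Definition multipartite n (e : rel 'I_n) (v : 'I_n) : bool :=
  [forall a, forall b, e v a ==> (e a b ==> (e v b || twin e b v))] &&
  [forall a, forall b, forall c, [&& e v a, e v b, e v c & e a c] ==> (e a b || e b c)].

Definition alike n (e : rel 'I_n) (v a b c u : 'I_n) : bool :=
  [&& u != a, u != b, u != c, e u a == e v a, e u b == e v b & e u c == e v c].

(* Among more than [k] vertices alike [v] towards [a], [b], [c], one has no deleted
   edge to them, so a paw on [v], [a], [b], [c] would survive on this vertex and
   [a], [b], [c]. *)
Definition replaceable n (e : rel 'I_n) (k : nat) (v : 'I_n) : bool :=
  [forall a, forall b, forall c,
    [&& a != v, b != v, c != v & inT e v || [&& e a b, e b c, e a c & e v a]] ==>
    (k < #|[set u | (u != v) && alike e v a b c u]|)].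

(* The same for the class of false twins of [v], two of which never lie in a
   common paw as long as no edge at the class is deleted. *)
Definition class_replaceable n (e : rel 'I_n) (k : nat) (v : 'I_n) : bool :=
  [forall a, forall b, forall c,
    [&& ~~ twin e a v, ~~ twin e b v & ~~ twin e c v] ==>
    (k < #|[set u | ~~ twin e u v && alike e v a b c u]|)].

Definition removable n (e : rel 'I_n) (k : nat) (v : 'I_n) : bool :=
  [|| multipartite e v, replaceable e k v | class_replaceable e k v].

Definition isolate n (e : rel 'I_n) (v : 'I_n) : rel 'I_n :=
  fun x y => [&& e x y, x != v & y != v].

Definition unlink n (e : rel 'I_n) (x y : 'I_n) : rel 'I_n :=
  fun i j => [&& e i j, ~~ ((i == x) && (j == y)) & ~~ ((i == y) && (j == x))].

Lemma paw_of n (e : rel 'I_n) x1 x2 x3 x4 : symmetric e -> irreflexive e ->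
  e x1 x2 -> e x2 x3 -> e x1 x3 -> e x3 x4 -> ~~ e x1 x4 -> ~~ e x2 x4 ->
  induced_paw e x1 x2 x3 x4.
Proof.
move=> se ie h12 h23 h13 h34 h14 h24.
rewrite /induced_paw h12 h23 h13 h34 h14 h24 !andbT /= !inE.
have ne x y : e x y -> x != y by apply: contraL => /eqP ->; rewrite ie.
rewrite !negb_or (ne _ _ h12) (ne _ _ h13) (ne _ _ h23) (ne _ _ h34) /= !andbT.
by apply/andP; split; apply/negP => /eqP E; [move: h24; rewrite -E se h12 | move: h14; rewrite -E h12].
Qed.

Lemma pawP n (e : rel 'I_n) x1 x2 x3 x4 : induced_paw e x1 x2 x3 x4 ->
  [/\ uniq [:: x1; x2; x3; x4], e x1 x2, e x2 x3 & e x1 x3] /\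
  [/\ e x3 x4, ~~ e x1 x4 & ~~ e x2 x4].
Proof. by rewrite /induced_paw => /and5P [? ? ? ? /and3P []]. Qed.

Section Soundness.
Variables (n : nat) (e : rel 'I_n).
Hypotheses (se : symmetric e) (ie : irreflexive e).

Lemma neq_adj x y : e x y -> x != y.
Proof. by apply: contraL => /eqP ->; rewrite ie. Qed.

(** Deletions never repair a nonadjacency, so an induced paw disappears only if one of its four
    edges does. *)
Lemma paw_hit (A : {set {set 'I_n}}) x1 x2 x3 x4 : paw_free (dl e A) ->
  e x1 x2 -> e x2 x3 -> e x1 x3 -> e x3 x4 -> ~~ e x1 x4 -> ~~ e x2 x4 ->
  [\/ [set x1; x2] \in A, [set x2; x3] \in A, [set x1; x3] \in A | [set x3; x4] \in A].
Proof.
move=> pf h12 h23 h13 h34 h14 h24.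
have sd : symmetric (dl e A) by apply: dl_sym.
have id : irreflexive (dl e A) by move=> x; rewrite /dl ie.
case a12: ([set x1; x2] \in A); first by constructor 1.
case a23: ([set x2; x3] \in A); first by constructor 2.
case a13: ([set x1; x3] \in A); first by constructor 3.
case a34: ([set x3; x4] \in A); first by constructor 4.
have := pf x1 x2 x3 x4; rewrite paw_of // /dl ?h12 ?h23 ?h13 ?h34 ?a12 ?a23 ?a13 ?a34 //.
  by rewrite (negPf h14).
by rewrite (negPf h24).
Qed.

(** If [xy] is kept, each apex [z] loses [xz], [yz] or its tail [zw]; since [w] misses [x] it is no
    apex, and the lost edge is private to [z]. In the second case some [z] keeps its edges to [x]
    and [y], and then every tail at [x] has to be deleted. *)
Lemma forced_hit k (A : {set {set 'I_n}}) x y : #|A| <= k -> paw_free (dl e A) -> forced e k x y -> [set x; y] \in A.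
Proof.
move=> hA pf /andP [exy] h; apply/negPn/negP => xyA.
case/orP: h => h.
  have : #|apex e x y| <= #|A|; last by lia.
  apply: card_private => z zZ; have := zZ; rewrite inE => /and3P [zx zy /existsP [w /and3P [wz wx wy]]].
  have xZ : x \notin apex e x y by rewrite inE ie.
  have yZ : y \notin apex e x y by rewrite inE ie andbF.
  have wZ : w \notin apex e x y by rewrite inE (negPf wx).
  case: (@paw_hit A x y z w pf) => //; rewrite 1?se // => hh.
  - by rewrite hh in xyA.
  - by exists [set y; z] => //; apply: set2_meet.
  - by exists [set x; z] => //; apply: set2_meet.
  - by exists [set w; z]; [rewrite setUC | apply: set2_meet].
set Z := [set z | _] in h.
have xZ : x \notin Z by rewrite inE ie.
have yZ : y \notin Z by rewrite inE ie andbF.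
have [z zZ [xzA yzA]] : exists2 z, z \in Z & [set x; z] \notin A /\ [set y; z] \notin A.
  case E: [exists z, [&& z \in Z, [set x; z] \notin A & [set y; z] \notin A]].
    by move/existsP: E => [z /and3P [zZ a b]]; exists z.
  have : #|Z| <= #|A|; last by lia.
  apply: card_private => z zZ; move/negbT: E; rewrite negb_exists => /forallP /(_ z).
  rewrite zZ /= negb_and !negbK => /orP [h'|h'].
    by exists [set x; z] => //; apply: set2_meet.
  by exists [set y; z] => //; apply: set2_meet.
have := zZ; rewrite inE => /and3P [zx zy hk].
have : #|tails e x y z| <= #|A|; last by lia.
apply: card_private => w wW; have := wW; rewrite inE => /and5P [wx wy wz _ _].
have xW : x \notin tails e x y z by rewrite inE ie.
case: (@paw_hit A y z x w pf) => //; rewrite 1?se // => hh.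
- by rewrite hh in yzA.
- by rewrite setUC hh in xzA.
- by rewrite setUC hh in xyA.
- by exists [set x; w] => //; apply: set2_meet.
Qed.

Lemma set2_eq (T : finType) (u v x y : T) :
  ([set u; v] == [set x; y]) = ((u == x) && (v == y)) || ((u == y) && (v == x)).
Proof.
apply/idP/idP => [/eqP E|].
  have := set21 u v; have := set22 u v; rewrite E !inE.
  have := set21 x y; have := set22 x y; rewrite -E !inE.
  rewrite ![x == _]eq_sym ![y == _]eq_sym.
  by case: (u == x); case: (u == y); case: (v == x); case: (v == y).
by case/orP => /andP [/eqP -> /eqP ->] //; rewrite setUC.
Qed.

Lemma dl_unlink (A : {set {set 'I_n}}) x y i j : dl (unlink e x y) A i j = dl e ([set x; y] |: A) i j.
Proof.
rewrite /dl /unlink !inE set2_eq !negb_or -!andbA.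
by case: (e i j); case: (i == x); case: (j == y); case: (i == y); case: (j == x).
Qed.

Lemma solvable_unlink k x y : forced e k.+1 x y ->
  solvable e k.+1 <-> solvable (unlink e x y) k.
Proof.
move=> hf; split=> [[A hA pf]|[A hA pf]].
  have xyA := forced_hit hA pf hf.
  exists (A :\ [set x; y]); first by move: hA; rewrite (cardsD1 [set x; y]) xyA add1n ltnS.
  move=> x1 x2 x3 x4; rewrite -(paw_ext (e := dl e A)) //.
  by move=> i j _ _; rewrite dl_unlink setD1K.
exists ([set x; y] |: A); first by rewrite cardsU1; apply: leq_trans (_ : 1 + k <= _) => //; apply: leq_add => //; case: (_ \notin _).
move=> x1 x2 x3 x4; rewrite -(paw_ext (e := dl (unlink e x y) A)) //.
by move=> i j _ _; rewrite dl_unlink.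
Qed.

(** A paw has no isolated vertex, so a paw surviving in the isolated graph avoids [v] and survives
    in [e] as well. *)
Lemma solvable_isolate k v : solvable e k -> solvable (isolate e v) k.
Proof.
move=> [A hA pf]; exists A => // x1 x2 x3 x4; apply/negP => pw.
have := pf x1 x2 x3 x4; rewrite (paw_ext (e' := dl (isolate e v) A)) ?pw //.
have [[_ h12 h23 h13] [h34 _ _]] := pawP pw.
have nv x y : dl (isolate e v) A x y -> (x != v) * (y != v).
  by rewrite /dl /isolate => /andP [/and3P [_ -> ->]].
have hv x : x \in [:: x1; x2; x3; x4] -> x != v.
  by rewrite !inE => /or4P [] /eqP ->; [rewrite (nv _ _ h12) | rewrite (nv _ _ h12) | rewrite (nv _ _ h13) | rewrite (nv _ _ h34)].
by move=> x y /hv hx /hv hy; rewrite /dl /isolate hx hy !andbT.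
Qed.

(** As [a], [b], [c] lie outside [U], a deleted edge from [u] to one of them is private to [u]. *)
Lemma alike_free (A : {set {set 'I_n}}) v a b c (U : {set 'I_n}) :
  (forall u, u \in U -> alike e v a b c u) -> #|A| < #|U| ->
  exists2 u, u \in U & [/\ [set u; a] \notin A, [set u; b] \notin A & [set u; c] \notin A].
Proof.
move=> hU lt.
case E: [exists u, [&& u \in U, [set u; a] \notin A, [set u; b] \notin A & [set u; c] \notin A]].
  by move/existsP: E => [z /and4P [zZ ? ? ?]]; exists z.
have : #|U| <= #|A|; last by lia.
have aU : a \notin U by apply/negP => /hU /andP []; rewrite eqxx.
have bU : b \notin U by apply/negP => /hU /and3P [_]; rewrite eqxx.
have cU : c \notin U by apply/negP => /hU /and4P [_ _]; rewrite eqxx.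
apply: card_private => z zU; move/negbT: E; rewrite negb_exists => /forallP /(_ z).
rewrite zU /= !negb_and !negbK => /or3P [h|h|h].
- by exists [set a; z]; [rewrite setUC | apply: set2_meet].
- by exists [set b; z]; [rewrite setUC | apply: set2_meet].
- by exists [set c; z]; [rewrite setUC | apply: set2_meet].
Qed.

Lemma paw_map (D : rel 'I_n) (f : 'I_n -> 'I_n) x1 x2 x3 x4 :
  {in [:: x1; x2; x3; x4] &, injective f} ->
  {in [:: x1; x2; x3; x4] &, forall x y, D (f x) (f y) = D x y} ->
  induced_paw D (f x1) (f x2) (f x3) (f x4) = induced_paw D x1 x2 x3 x4.
Proof.
move=> fI fD; rewrite /induced_paw -(map_inj_in_uniq fI) /= !fD // !inE eqxx ?orbT //.
Qed.

(** Inside a paw the neighbourhoods are [{x2,x3}], [{x1,x3}], [{x1,x2,x4}] and [{x3}], pairwise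
    distinct. *)
Lemma paw_twins (D : rel 'I_n) x1 x2 x3 x4 x y : symmetric D -> irreflexive D ->
  induced_paw D x1 x2 x3 x4 -> x \in [:: x1; x2; x3; x4] -> y \in [:: x1; x2; x3; x4] ->
  D x =1 D y -> x = y.
Proof.
move=> sD iD /pawP [[_ h12 h23 h13] [h34 h14 h24]].
have h21 : D x2 x1 by rewrite sD.
have h41 : ~~ D x4 x1 by rewrite sD.
have h42 : ~~ D x4 x2 by rewrite sD.
have h31 : D x3 x1 by rewrite sD.
have h32 : D x3 x2 by rewrite sD.
have h43 : D x4 x3 by rewrite sD.
by rewrite !inE => /or4P [] /eqP -> /or4P [] /eqP -> // E;
  move: (E x1) (E x2) (E x3) (E x4);
  rewrite ?iD ?h12 ?h23 ?h13 ?h34 ?h21 ?h31 ?h32 ?h43 ?(negPf h14) ?(negPf h24) ?(negPf h41) ?(negPf h42).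
Qed.

(** A vertex with the adjacencies of [d] to the other three takes the place of [d]. Both replacement
    rules use this; [P] says what the substitute must avoid. *)
Lemma paw_replace (D : rel 'I_n) (P : pred 'I_n) x1 x2 x3 x4 d : symmetric D -> irreflexive D ->
  induced_paw D x1 x2 x3 x4 -> d \in [:: x1; x2; x3; x4] ->
  (forall a b c, {subset [:: a; b; c] <= [:: x1; x2; x3; x4]} -> d \notin [:: a; b; c] ->
     inT D d || [&& D a b, D b c, D a c & D d a] ->
     exists u, [/\ P u, u \notin [:: a; b; c] & {in [:: a; b; c], D u =1 D d}]) ->
  exists y1 y2 y3 y4, induced_paw D y1 y2 y3 y4 /\
    {in [:: y1; y2; y3; y4], forall y, P y || (y \in [:: x1; x2; x3; x4]) && (y != d)}.
Proof.
move=> sD iD pw hd key; have [[un h12 h23 h13] [h34 h14 h24]] := pawP pw.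
set xs := [:: x1; x2; x3; x4] in hd key *.
(* The alternatives in [hT] are the two roles of [d]: on the triangle, or pendant. *)
have [a [b [c [sub dn hT cov]]]] : exists a b c, [/\ {subset [:: a; b; c] <= xs}, d \notin [:: a; b; c],
    inT D d || [&& D a b, D b c, D a c & D d a] & {subset xs <= [:: d; a; b; c]}].
  have sb a b c : a \in xs -> b \in xs -> c \in xs -> {subset [:: a; b; c] <= xs}.
    by move: xs {hd key} => xs ha hb hc z; rewrite !inE => /or3P [] /eqP ->.
  have m1 : x1 \in xs by rewrite !inE eqxx.
  have m2 : x2 \in xs by rewrite !inE eqxx ?orbT.
  have m3 : x3 \in xs by rewrite !inE eqxx ?orbT.
  have m4 : x4 \in xs by rewrite !inE eqxx ?orbT.
  move: un; rewrite /= !inE !negb_or -!andbA => /and3P [n12 n13 /and5P [n14 n23 n24 n34 _]].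
  have n21 : x2 != x1 by rewrite eq_sym.
  have n31 : x3 != x1 by rewrite eq_sym.
  have n32 : x3 != x2 by rewrite eq_sym.
  have n41 : x4 != x1 by rewrite eq_sym.
  have n42 : x4 != x2 by rewrite eq_sym.
  have n43 : x4 != x3 by rewrite eq_sym.
  move: hd; rewrite !inE => /or4P [] /eqP ->.
  - exists x2, x3, x4; split; [exact: sb | by rewrite !inE !negb_or n12 n13 n14 | | by []].
    by apply/orP; left; apply/inTP; exists x2, x3.
  - exists x1, x3, x4; split; [exact: sb | by rewrite !inE !negb_or n21 n23 n24 | |].
      by apply/orP; left; apply/inTP; exists x1, x3; rewrite sD.
    by move=> z; rewrite !inE; do 4 case: (z == _).
  - exists x1, x2, x4; split; [exact: sb | by rewrite !inE !negb_or n31 n32 n34 | |].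
      by apply/orP; left; apply/inTP; exists x1, x2; rewrite sD h13 sD h23.
    by move=> z; rewrite !inE; do 4 case: (z == _).
  - exists x3, x1, x2; split; [exact: sb | by rewrite !inE !negb_or n43 n41 n42 | |].
      by apply/orP; right; rewrite sD h13 h12 sD h23 sD h34.
    by move=> z; rewrite !inE; do 4 case: (z == _).
have [u [Pu un' uD]] := key a b c sub dn hT.
pose f x := if x == d then u else x.
have inabc x : x \in xs -> x != d -> x \in [:: a; b; c].
  by move=> /cov; rewrite in_cons => /orP [/eqP ->|]; rewrite ?eqxx.
exists (f x1), (f x2), (f x3), (f x4); split.
  rewrite paw_map // => x y hx hy; rewrite /f.
    case: (altP (x =P d)) => [->|nx]; case: (altP (y =P d)) => [->|ny] //.
      by move=> E; move: un'; rewrite E (inabc y).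
    by move=> E; move: un'; rewrite -E (inabc x).
  case: (altP (x =P d)) => [->|nx]; case: (altP (y =P d)) => [->|ny] //.
  - by rewrite !iD.
  - by apply: uD; apply: inabc.
  - by rewrite sD [RHS]sD; apply: uD; apply: inabc.
move=> y hy; have [x hx ->] : exists2 x, x \in xs & y = f x.
  by apply/mapP.
by rewrite /f; case: (altP (x =P d)) => [_|nx]; [rewrite Pu | rewrite hx nx orbT].
Qed.

Lemma dl_irr (A : {set {set 'I_n}}) : irreflexive (dl e A).
Proof. by move=> x; rewrite /dl ie. Qed.

Lemma inT_dl (A : {set {set 'I_n}}) x : inT (dl e A) x -> inT e x.
Proof.
move/inTP => [p [q [h1 h2 h3]]]; apply/inTP; exists p, q.
by move: h1 h2 h3 => /andP [-> _] /andP [-> _] /andP [-> _].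
Qed.

(** Dropping all sets that contain [v] gives [v] its original edges back. A paw through [v] would
    then move to a look-alike with no deleted edge to the other three vertices, and so avoid [v]. *)
Lemma solvable_replaceable k v : replaceable e k v -> solvable (isolate e v) k -> solvable e k.
Proof.
move=> hr [A hA pf]; pose A' := [set a in A | v \notin a].
have hA' : #|A'| <= k by apply: leq_trans hA; apply/subset_leq_card/subsetP => a; rewrite inE => /andP [].
have pf' x1 x2 x3 x4 : v \notin [:: x1; x2; x3; x4] -> ~~ induced_paw (dl e A') x1 x2 x3 x4.
  move=> hv; rewrite (paw_ext (e' := dl (isolate e v) A)) // => x y hx hy.
  have nx : x != v by apply: contraNneq hv => <-.
  have ny : y != v by apply: contraNneq hv => <-.
  by rewrite /dl /isolate nx ny !andbT !inE ![v == _]eq_sym (negPf nx) (negPf ny) andbT.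
exists A' => // x1 x2 x3 x4; apply/negP => pw.
case hv: (v \in [:: x1; x2; x3; x4]); last by have := pf' x1 x2 x3 x4; rewrite hv pw => /(_ isT).
have vA y : dl e A' v y = e v y by rewrite /dl inE set21 andbF andbT.
have [|y1 [y2 [y3 [y4 [pwy hy]]]]] :=
  paw_replace (P := fun u => u != v) (dl_sym A' se) (@dl_irr A') pw hv.
  move=> a b c _ hn hT.
  have /forallP /(_ a) /forallP /(_ b) /forallP /(_ c) /implyP := hr.
  move: hn; rewrite !inE !negb_or ![v == _]eq_sym => /and3P [na nb nc].
  have hT' : inT e v || [&& e a b, e b c, e a c & e v a].
    case/orP: hT => [/inT_dl -> //|/and4P [/andP [h1 _] /andP [h2 _] /andP [h3 _]]].
    by rewrite vA => h4; rewrite h1 h2 h3 h4 orbT.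
  rewrite na nb nc hT' => /(_ isT) lt.
  have [|u] := @alike_free A' v a b c _ _ (leq_ltn_trans hA' lt).
    by move=> u; rewrite inE => /andP [].
  rewrite inE => /andP [uv /and5P [ua ub uc /eqP ea /andP [/eqP eb /eqP ec]]] [fa fb fc].
  exists u; split=> //; first by rewrite !inE !negb_or ua ub uc.
  by move=> z; rewrite !inE => /or3P [] /eqP ->; rewrite vA /dl ?fa ?fb ?fc andbT.
by apply: (negP (pf' y1 y2 y3 y4 _) pwy); apply/negP => /hy; rewrite eqxx andbF.
Qed.

(** Once the sets meeting the class of [v] are dropped, its members are twins after deletion too, so
    a paw has at most one of them, and a look-alike outside the class can replace it. *)
Lemma solvable_class k v : class_replaceable e k v -> solvable (isolate e v) k -> solvable e k.
Proof.
move=> hr [A hA pf]; pose A' := [set a in A | [forall x in a, ~~ twin e x v]].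
have hA' : #|A'| <= k by apply: leq_trans hA; apply/subset_leq_card/subsetP => a; rewrite inE => /andP [].
have tA x y : twin e x v -> dl e A' x y = e v y.
  move=> tx; have /twinP <- := tx; rewrite /dl inE.
  suff -> : [forall z in [set x; y], ~~ twin e z v] = false by rewrite andbF andbT.
  by apply/negP => /forall_inP /(_ x); rewrite set21 tx => /(_ isT).
have tv : twin e v v by apply/twinP.
have pf' x1 x2 x3 x4 : {in [:: x1; x2; x3; x4], forall x, ~~ twin e x v} ->
    ~~ induced_paw (dl e A') x1 x2 x3 x4.
  move=> hv; rewrite (paw_ext (e' := dl (isolate e v) A)) // => x y /hv hx /hv hy.
  have nx : x != v by apply: contraNneq hx => ->.
  have ny : y != v by apply: contraNneq hy => ->.
  rewrite /dl /isolate nx ny !andbT inE.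
  suff -> : [forall z in [set x; y], ~~ twin e z v] by rewrite andbT.
  by apply/forall_inP => z; rewrite !inE => /orP [] /eqP ->.
exists A' => // x1 x2 x3 x4; apply/negP => pw.
case hv: [exists d, (d \in [:: x1; x2; x3; x4]) && twin e d v]; last first.
  apply: (negP (pf' x1 x2 x3 x4 _) pw) => x hx; apply/negP => tx.
  by move/negbT: hv; rewrite negb_exists => /forallP /(_ x); rewrite hx tx.
move/existsP: hv => [d /andP [hd td]].
have uniqd x : x \in [:: x1; x2; x3; x4] -> twin e x v -> x = d.
  move=> hx tx; apply: (paw_twins (dl_sym A' se) (@dl_irr A') pw hx hd) => y.
  by rewrite !tA.
have [|y1 [y2 [y3 [y4 [pwy hy]]]]] :=
  paw_replace (P := fun u => ~~ twin e u v) (dl_sym A' se) (@dl_irr A') pw hd.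
  move=> a b c sub hn _.
  have /forallP /(_ a) /forallP /(_ b) /forallP /(_ c) /implyP := hr.
  have nt x : x \in [:: a; b; c] -> ~~ twin e x v.
    by move=> hx; apply/negP => /(uniqd _ (sub _ hx)) E; move: hn; rewrite -E hx.
  rewrite !nt ?inE ?eqxx ?orbT // => /(_ isT) lt.
  have [|u] := @alike_free A' v a b c _ _ (leq_ltn_trans hA' lt).
    by move=> u; rewrite inE => /andP [].
  rewrite inE => /andP [uv /and5P [ua ub uc /eqP ea /andP [/eqP eb /eqP ec]]] [fa fb fc].
  exists u; split=> //; first by rewrite !inE !negb_or ua ub uc.
  by move=> z; rewrite !inE => /or3P [] /eqP ->; rewrite (tA d) // /dl ?fa ?fb ?fc andbT.
apply: (negP (pf' y1 y2 y3 y4 _) pwy) => y /hy /orP [//|/andP [hy' nd]].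
by apply/negP => /(uniqd _ hy') E; rewrite E eqxx in nd.
Qed.

(** Sets meeting [K], the component of [v], are dropped. Inside [K] the graph is complete
    multipartite and has no paw; any other paw avoids [K] altogether. *)
Lemma solvable_multipartite k v : multipartite e v -> solvable (isolate e v) k -> solvable e k.
Proof.
move=> /andP [/forallP h1 /forallP h2] [A hA pf].
pose K := [pred x | e v x || twin e x v].
have near a b : e v a -> e a b -> K b.
  by move=> va ab; have /forallP /(_ b) := h1 a; rewrite va ab.
have dist a b c : e v a -> e v b -> e v c -> e a c -> e a b || e b c.
  by move=> va vb vc ac; have /forallP /(_ b) /forallP /(_ c) := h2 a; rewrite va vb vc ac.
have Kadj x y : K x -> e x y -> K y.
  case/orP => [vx|/twinP tx]; first exact: near.
  by rewrite tx => vy; apply/orP; left.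
have Kdist a b c : K a -> K b -> K c -> e a c -> e a b || e b c.
  move=> /orP [va|/twinP ta] /orP [vb|/twinP tb] /orP [vc|/twinP tc] ac.
  - exact: dist ac.
  - by rewrite [e b c]se tc vb orbT.
  - by rewrite tb vc orbT.
  - by rewrite [e a b]se tb va.
  - by rewrite ta vb.
  - by rewrite ta vb.
  - by rewrite tb -ta ac orbT.
  - by move: ac; rewrite ta se tc ie.
pose A' := [set a in A | [forall x in a, ~~ K x]].
have hA' : #|A'| <= k by apply: leq_trans hA; apply/subset_leq_card/subsetP => a; rewrite inE => /andP [].
have Kv : K v by apply/orP; right; apply/twinP.
exists A' => // x1 x2 x3 x4; apply/negP => pw.
have [[un h12 h23 h13] [h34 h14 h24]] := pawP pw.
have [e12 e23 e13 e34] : [/\ e x1 x2, e x2 x3, e x1 x3 & e x3 x4].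
  by move: h12 h23 h13 h34 => /andP [-> _] /andP [-> _] /andP [-> _] /andP [-> _].
case K3: (K x3).
  have K1 : K x1 by apply: Kadj K3 _; rewrite se.
  have K2 : K x2 by apply: Kadj K3 _; rewrite se.
  have K4 : K x4 by apply: Kadj K3 _.
  have dK x y : K x -> dl e A' x y = e x y.
    move=> Kx; rewrite /dl inE.
    suff -> : [forall z in [set x; y], ~~ K z] = false by rewrite andbF andbT.
    by apply/negP => /forall_inP /(_ x); rewrite set21 Kx => /(_ isT).
  rewrite dK // in h14; rewrite dK // in h24.
  by have := Kdist _ _ _ K1 K4 K2 e12; rewrite (negPf h14) se (negPf h24).
have nK x : x \in [:: x1; x2; x3; x4] -> K x = false.
  rewrite !inE => /or4P [] /eqP ->; last 1 first.
  - by apply: contraFF K3 => K4; apply: Kadj K4 _; rewrite se.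
  - by apply: contraFF K3 => K1; apply: Kadj K1 _.
  - by apply: contraFF K3 => K2; apply: Kadj K2 _.
  - by [].
have := pf x1 x2 x3 x4; rewrite -(paw_ext (e := dl e A')) ?pw // => x y /nK hx /nK hy.
have nx : x != v by apply: contraFneq hx => ->.
have ny : y != v by apply: contraFneq hy => ->.
rewrite /dl /isolate nx ny !andbT inE.
suff -> : [forall z in [set x; y], ~~ K z] by rewrite andbT.
by apply/forall_inP => z /[!inE] /orP [] /eqP ->; [move: hx | move: hy] => /= ->.
Qed.

Lemma solvable_removable k v : removable e k v -> solvable e k <-> solvable (isolate e v) k.
Proof.
move=> h; split; first exact: solvable_isolate.
by case/or3P: h => h; [apply: solvable_multipartite | apply: solvable_replaceable | apply: solvable_class].
Qed.

End Soundness.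

(** * Size of reduced instances *)

Section PawFree.
Variables (n : nat) (h : rel 'I_n).
Hypotheses (sh : symmetric h) (ih : irreflexive h) (pf : paw_free h).

Lemma paw_freeE a b c d : h a b -> h b c -> h a c -> h c d -> h a d || h b d.
Proof.
move=> ab bc ac cd; apply/negPn/negP; rewrite negb_or => /andP [ad bd].
by apply: (negP (pf a b c d)); apply: paw_of.
Qed.

(** Otherwise [va] would be the tail of a paw on a triangle at [v]. *)
Lemma inT_edge v a : inT h v -> h v a -> exists2 p, h v p & h a p.
Proof.
move=> /inTP [p [q [vp vq pq]]] va.
have := paw_freeE pq (_ : h q v) (_ : h p v) va.
rewrite ![h _ v]sh vp vq => /(_ isT isT) /orP [pa|qa].
  by exists p => //; rewrite sh.
by exists q => //; rewrite sh.
Qed.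

Lemma inT_adj v a : inT h v -> h v a -> inT h a.
Proof.
move=> tv va; have [p vp ap] := inT_edge tv va.
by apply/inTP; exists v, p; rewrite sh.
Qed.

(* Olariu's theorem in local form: a component of a paw-free graph containing a
   triangle is complete multipartite. *)
Lemma inT_near v a b : inT h v -> h v a -> h a b -> ~~ h v b -> twin h b v.
Proof.
(* One inclusion suffices: the situation is symmetric in [v] and [b], as [b] lies in a triangle
   too. *)
have sub x y z : inT h x -> h x y -> h y z -> ~~ h x z -> {subset h x <= h z}.
  move=> tx xy yz nxz w; rewrite -!topredE /= => xw.
  have [p xp yp] := inT_edge tx xy.
  have hpz : h p z.
    by have := paw_freeE xp (_ : h p y) xy yz; rewrite sh yp (negPf nxz) => /(_ isT).
  have hxw : h y x by rewrite sh.
  have hpx : h p x by rewrite sh.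
  have := paw_freeE yp hpx hxw xw => /orP [yw|pw].
    have := paw_freeE xw (_ : h w y) xy yz; rewrite sh yw (negPf nxz) => /(_ isT).
    by rewrite sh.
  have := paw_freeE xw (_ : h w p) xp hpz; rewrite sh pw (negPf nxz) => /(_ isT).
  by rewrite sh.
move=> tv va ab nvb; apply/twinP => w; apply/idP/idP => hw.
  have tb := inT_adj (inT_adj tv va) ab.
  have ba : h b a by rewrite sh.
  have av : h a v by rewrite sh.
  have nbv : ~~ h b v by rewrite sh.
  exact: (sub b a v tb ba av nbv w hw).
exact: (sub v a b tv va ab nvb w hw).
Qed.

(** For [s] in a triangle this is the component of [s]: neighbours form the other parts, twins the
    part of [s]. *)
Definition kin (s v : 'I_n) : bool := h s v || twin h v s.

Lemma kin_adj s v w : inT h s -> kin s v -> h v w -> kin s w.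
Proof.
move=> ts /orP [sv|/twinP tv] vw; rewrite /kin; last by rewrite -tv vw.
by case sw: (h s w) => //=; apply: inT_near ts sv vw _; rewrite sw.
Qed.

Lemma kin_inT s v : inT h s -> kin s v -> inT h v.
Proof.
move=> ts /orP [sv|/twinP tv]; first exact: inT_adj sv.
by have /inTP [p [q [sp sq pq]]] := ts; apply/inTP; exists p, q; rewrite !tv.
Qed.

Lemma kin_sym s v : kin s v = kin v s.
Proof.
rewrite /kin sh; congr (_ || _).
by apply/twinP/twinP => E w; rewrite E.
Qed.

Lemma kin_trans s v w : inT h s -> kin s v -> kin v w -> kin s w.
Proof.
move=> ts sv; have tv := kin_inT ts sv.
rewrite {1}/kin => /orP [vw|/twinP tw]; first exact: kin_adj sv vw.
case/orP: sv => [sv|/twinP Ev]; last by rewrite /kin; apply/orP; right; apply/twinP => z; rewrite tw Ev.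
by rewrite /kin sh tw sh sv.
Qed.

End PawFree.

Section Bound.
Variables (n : nat) (e : rel 'I_n) (k : nat) (A : {set {set 'I_n}}).
Hypotheses (se : symmetric e) (ie : irreflexive e).
Hypotheses (hA : #|A| <= k) (pf : paw_free (dl e A)).
Hypothesis noE : forall x y, ~~ forced e k x y.

Notation H := (dl e A).

Definition touched : {set 'I_n} := [set x | [exists y, e x y && ([set x; y] \in A)]].
Local Notation S := touched.

Lemma touchedP x y : e x y -> [set x; y] \in A -> (x \in S) /\ (y \in S).
Proof.
move=> exy xyA; split; rewrite inE; apply/existsP; first by exists y; rewrite exy.
by exists x; rewrite se exy setUC.
Qed.

Lemma card_touched : #|S| <= 2 * k.
Proof.
(* [A] may contain arbitrary sets; only those with at most two elements delete edges. *)
pose A2 := [set a in A | #|a| <= 2].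
have sub : S \subset cover A2.
  apply/subsetP => x; rewrite inE => /existsP [y /andP [_ xyA]].
  by apply/bigcupP; exists [set x; y]; rewrite ?set21 // inE xyA cards2; case: (_ != _).
apply: leq_trans (subset_leq_card sub) _; apply: leq_trans (leq_card_cover A2) _.
apply: leq_trans (_ : \sum_(a in A2) 2 <= _).
  by apply: leq_sum => a; rewrite inE => /andP [].
rewrite sum_nat_const mulnC leq_mul2l /=; apply: leq_trans hA.
by apply/subset_leq_card/subsetP => a; rewrite inE => /andP [].
Qed.

Lemma untouchedE v w : v \notin S -> e v w = H v w.
Proof.
move=> vS; rewrite /dl; case evw: (e v w) => //=; apply/esym/negP => vwA.
by have [] := touchedP evw vwA; rewrite (negPf vS).
Qed.

Lemma sH : symmetric H. Proof. exact: dl_sym. Qed.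
Lemma iH : irreflexive H. Proof. exact: dl_irr. Qed.
Hint Resolve sH iH : core.

Lemma twin_H u v : u \notin S -> v \notin S -> twin e u v = twin H u v.
Proof.
move=> uS vS; apply/twinP/twinP => E w; have := E w; rewrite ?untouchedE // -?untouchedE //.
Qed.

Lemma twin_sym u v : twin e u v = twin e v u.
Proof. by apply/twinP/twinP => E w; rewrite E. Qed.

Lemma twin_trans u v w : twin e u v -> twin e v w -> twin e u w.
Proof. by move=> /twinP E1 /twinP E2; apply/twinP => z; rewrite E1 E2. Qed.

(** All twins of [v] except possibly [v], [a], [b], [c] look like [v] towards [a], [b], [c],
    whatever these are; hence the 4. *)
Lemma card_twins v : inT e v -> ~~ replaceable e k v -> #|[set u | twin e u v]| <= k + 4.
Proof.
move=> tv; apply: contraNT; rewrite -ltnNge => lt.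
apply/forallP => a; apply/forallP => b; apply/forallP => c; apply/implyP => _.
have sub : [set u | twin e u v] \subset
   [set v; a; b] :|: [set c] :|: [set u | (u != v) && alike e v a b c u].
  apply/subsetP => u; rewrite !inE /alike => /twinP tu; rewrite !tu !eqxx !andbT.
  by case: (u == v); case: (u == a); case: (u == b); case: (u == c).
have := leq_trans (subset_leq_card sub) (leq_card_setU _ _).
have c4 : #|[set v; a; b] :|: [set c]| <= 4.
  have c2 : #|[set v; a]| <= 2 by rewrite cards2; case: (_ != _).
  apply: leq_trans (leq_card_setU _ _) _; rewrite cards1 (leq_add (_ : _ <= 3)) //.
  by apply: leq_trans (leq_card_setU _ _) _; rewrite cards1 (leq_add c2).
move=> h; have := leq_trans lt h; set m := #|[set u | _]|; move: c4 => /leq_add /(_ (leqnn m)) h1 h2.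
by have := leq_trans h2 h1; rewrite /m; lia.
Qed.

Definition inM : {set 'I_n} := [set v | [&& v \notin S, inT H v & ~~ removable e k v]].

(** If the component of [v] in [H] had no touched vertex, it would be complete multipartite in [e]
    as well, and [v] removable. *)
Lemma inM_kin v : v \in inM -> exists2 s, s \in S & kin H v s.
Proof.
rewrite inE => /and3P [vS tv nr].
case E: [exists s, (s \in S) && kin H v s]; first by move/existsP: E => [s /andP [? ?]]; exists s.
have nS s : kin H v s -> s \notin S.
  by move=> ks; apply/negP => sS; move/negbT: E; rewrite negb_exists => /forallP /(_ s); rewrite sS ks.
case/or3P: nr; constructor 1.
apply/andP; split.
  apply/forallP => a; apply/forallP => b; apply/implyP; rewrite untouchedE // => va.
  have ka : kin H v a by rewrite /kin va.
  apply/implyP; rewrite untouchedE ?nS // => ab.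
  have kb := kin_adj sH iH pf tv ka ab.
  by rewrite untouchedE // (twin_H (nS _ kb) vS); exact: kb.
apply/forallP => a; apply/forallP => b; apply/forallP => c.
apply/implyP; rewrite ![e v _]untouchedE // => /and4P [va vb vc].
have ka : kin H v a by rewrite /kin va.
have kb : kin H v b by rewrite /kin vb.
rewrite !(untouchedE _ (nS _ ka)) (untouchedE _ (nS _ kb)) => ac.
case ab: (H a b) => //=.
have av : H a v by rewrite sH.
have /twinP -> // : twin H b a.
by apply: (inT_near sH iH pf (inT_adj sH iH pf tv va) av vb); rewrite ab.
Qed.

Lemma card_inM : #|inM| <= 2 * k * (5 * k + 16) + 2 * k * (k + 4).
Proof.
(* [dirty s] collects the part of [s]; [clean s] collects the parts of its component that avoid
   [S]. *)
pose dirty s := [set v in inM | twin H s v].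
pose clean s := [set v in inM | kin H v s && [forall t in S, ~~ twin H t v]].
have tw v x : v \in inM -> twin e v x -> #|[set u | twin e u x]| <= k + 4.
  rewrite inE => /and3P [vS /inT_dl tv nr] vx.
  have nr' : ~~ replaceable e k v by apply: contra nr; rewrite /removable => ->; rewrite orbT.
  apply: leq_trans (card_twins tv nr'); apply/subset_leq_card/subsetP => u; rewrite !inE => ux.
  by apply: twin_trans ux _; rewrite twin_sym.
have twI x : #|[set u in inM | twin e u x]| <= k + 4.
  have [->|[v]] := set_0Vmem [set u in inM | twin e u x]; first by rewrite cards0.
  rewrite inE => /andP [vM vx]; apply: leq_trans (tw v x vM vx).
  by apply/subset_leq_card/subsetP => u; rewrite !inE => /andP [_].
have cd s : #|dirty s| <= k + 4.
  have [->|[v]] := set_0Vmem (dirty s); first by rewrite cards0.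
  rewrite inE => /andP [vM /twinP sv]; apply: leq_trans (twI v).
  apply/subset_leq_card/subsetP => u; rewrite [u \in dirty s]inE => /andP [uM /twinP su]; rewrite inE uM /=.
  rewrite twin_H; first by apply/twinP => w; rewrite -su sv.
    by move: uM; rewrite inE => /and3P [].
  by move: vM; rewrite inE => /and3P [].
(* Let [a], [b], [c] violate [class_replaceable] for one clean [v]. A clean vertex is a twin of [v],
   [a], [b] or [c], at most [k + 4] each, or one of at most [k] look-alikes of [v]. *)
have cc s : #|clean s| <= 5 * k + 16.
  have [->|[v]] := set_0Vmem (clean s); first by rewrite cards0.
  rewrite inE => /and3P [vM kvs /forall_inP cv].
  have := vM; rewrite inE => /and3P [vS tv nr].
  have : ~~ class_replaceable e k v by apply: contra nr; rewrite /removable => ->; rewrite !orbT.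
  rewrite negb_forall => /existsP [a]; rewrite negb_forall => /existsP [b].
  rewrite negb_forall => /existsP [c]; rewrite negb_imply -leqNgt => /andP [/and3P [na nb nc] le].
  (* Clean [u] and [v] in different parts agree on [x] unless [x] lies in the part of one of them;
     such an [x] is untouched and hence a twin in [e]. *)
  have same u x : u \in clean s -> ~~ twin e u v -> ~~ twin e u x -> ~~ twin e x v -> u != x /\ e u x = e v x.
    rewrite inE => /and3P [uM kus /forall_inP cu] uv ux xv.
    have := uM; rewrite inE => /and3P [uS tu _].
    have hv : H v u.
      have := kin_trans sH iH pf tv kvs (_ : kin H s u); rewrite [kin H s u]kin_sym // => /(_ kus).
      by case/orP => //; rewrite -twin_H // (negPf uv).
    have cl y : y \notin S -> (forall t, t \in S -> ~~ twin H t y) -> ~~ twin e x y -> twin H x y -> False.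
      move=> yS cy nxy txy; case xS: (x \in S); first by have := cy x xS; rewrite txy.
      by move: nxy; rewrite twin_H ?xS // txy.
    split; first by apply: contraNneq ux => ->; apply/twinP.
    rewrite !untouchedE //; apply/idP/idP => hx.
      apply/negPn/negP => nvx.
      by apply: (cl v) => //; apply: (inT_near sH iH pf tv hv hx nvx).
    apply/negPn/negP => nux; have hu : H u v by rewrite sH.
    apply: (cl u) => //; first by rewrite twin_sym.
    exact: (inT_near sH iH pf tu hu hx nux).
  have sub : clean s \subset [set u in inM | twin e u v] :|: [set u in inM | twin e u a] :|:
     [set u in inM | twin e u b] :|: [set u in inM | twin e u c] :|:
     [set u | ~~ twin e u v && alike e v a b c u].
    apply/subsetP => u uC; have := uC; rewrite inE => /andP [uM _]; rewrite !inE.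
    have := @same u a uC; have := @same u b uC; have := @same u c uC.
    have uM' := uM; rewrite !inE in uM'; rewrite uM' /=.
    case: (twin e u v) => //=; case: (twin e u a) => //=; case: (twin e u b) => //=; case: (twin e u c) => //=.
    rewrite /alike => /(_ isT isT nc) [-> ->] /(_ isT isT nb) [-> ->] /(_ isT isT na) [-> ->].
    by rewrite !eqxx.
  have U (x y : {set 'I_n}) m p : #|x| <= m -> #|y| <= p -> #|x :|: y| <= m + p.
    by move=> h1 h2; apply: leq_trans (leq_card_setU _ _) (leq_add h1 h2).
  apply: leq_trans (subset_leq_card sub) _.
  apply: leq_trans (U _ _ _ _ (U _ _ _ _ (U _ _ _ _ (U _ _ _ _ (twI v) (twI a)) (twI b)) (twI c)) le) _; lia.
have sub : inM \subset (\bigcup_(s in S) clean s) :|: (\bigcup_(s in S) dirty s).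
  apply/subsetP => v vM; rewrite inE; have [s sS ks] := inM_kin vM.
  case E: [exists t in S, twin H t v].
    move/existsP: E => [t /andP [tS tt]]; apply/orP; right; apply/bigcupP; exists t => //.
    by rewrite inE vM.
  apply/orP; left; apply/bigcupP; exists s => //; rewrite inE vM ks /=.
  by move/negbT: E; rewrite negb_exists_in.
apply: leq_trans (subset_leq_card sub) (leq_trans (leq_card_setU _ _) (leq_add _ _)).
  apply: leq_trans (card_bigcup_le (m := 5 * k + 16) _) _; first by move=> s _; apply: cc.
  by rewrite leq_mul2r card_touched orbT.
apply: leq_trans (card_bigcup_le (m := k + 4) _) _; first by move=> s _; apply: cd.
by rewrite leq_mul2r card_touched orbT.
Qed.

(** A deleted edge is read as an ordered pair in both ways, whence the factor 2 in the bounds. *)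
Definition over_pairs (F : 'I_n -> 'I_n -> {set 'I_n}) : {set 'I_n} :=
  \bigcup_(a in A) [set z | [exists x, exists y, [&& e x y, a == [set x; y] & z \in F x y]]].

Lemma over_pairsP (F : 'I_n -> 'I_n -> {set 'I_n}) x y z : e x y -> [set x; y] \in A -> z \in F x y -> z \in over_pairs F.
Proof.
move=> exy xyA zF; apply/bigcupP; exists [set x; y] => //.
by rewrite inE; apply/existsP; exists x; apply/existsP; exists y; rewrite exy eqxx.
Qed.

Lemma card_over_pairs (F : 'I_n -> 'I_n -> {set 'I_n}) : (forall x y, e x y -> #|F x y| <= k) -> #|over_pairs F| <= k * (2 * k).
Proof.
move=> hF; apply: leq_trans (card_bigcup_le (m := 2 * k) _) _; last by rewrite leq_mul2r hA orbT.
move=> a _; set X := [set z | _]; have [->|[z]] := set_0Vmem X; first by rewrite cards0.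
rewrite inE => /existsP [x /existsP [y /and3P [exy /eqP aE _]]].
have sub : X \subset F x y :|: F y x.
  apply/subsetP => u; rewrite inE => /existsP [p /existsP [q /and3P [_ pq uF]]].
  by move: pq uF; rewrite aE eq_sym set2_eq inE => /orP [] /andP [/eqP -> /eqP ->] ->; rewrite ?orbT.
apply: leq_trans (subset_leq_card sub) _; apply: leq_trans (leq_card_setU _ _) _.
by rewrite mul2n -addnn leq_add ?hF // se.
Qed.

Definition apices : {set 'I_n} := over_pairs (apex e).

Lemma card_apices : #|apices| <= k * (2 * k).
Proof.
apply: card_over_pairs => x y exy; have := noE x y.
by rewrite /forced exy /= negb_or -!leqNgt => /andP [].
Qed.

Definition inF : {set 'I_n} :=
  [set v | [&& v \notin S, inT e v, ~~ inT H v & ~~ removable e k v]].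

Definition plain : {set 'I_n} := inF :\: apices.

Lemma plainP v : v \in plain -> [/\ v \notin S, inT e v, ~~ inT H v & ~~ removable e k v] /\ v \notin apices.
Proof. by rewrite in_setD [v \in inF]inE => /andP [-> /and4P [-> -> -> ->]]. Qed.

Lemma triangle_hit v a b : v \notin S -> ~~ inT H v -> e v a -> e v b -> e a b -> [set a; b] \in A.
Proof.
move=> vS nt va vb ab; apply: contraR nt => abA.
by apply/inTP; exists a, b; split; [rewrite -untouchedE | rewrite -untouchedE | rewrite /dl ab].
Qed.

(** Otherwise [u] is a tail at [v] for the triangle [vab], and [v] an apex of the deleted edge
    [ab]. *)
Lemma plain_near v a b u : v \in plain -> e v a -> e v b -> e a b -> e v u -> e u a || e u b.
Proof.
move=> /plainP [[vS _ nt _] nap] va vb ab vu; apply: contraNT nap; rewrite negb_or => /andP [ua ub].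
apply: (over_pairsP ab); first exact: triangle_hit vb ab.
by rewrite inE va vb; apply/existsP; exists u; rewrite se vu ua ub.
Qed.

(** [u] is adjacent to [a] or [b] and forms a triangle with it and [v]; the edge opposite to [v] is
    deleted. *)
Lemma plain_sub v u : v \in plain -> e v u -> u \in S.
Proof.
move=> vp vu; have [[vS /inTP [a [b [va vb ab]]] nt _] _] := plainP vp.
have := plain_near vp va vb ab vu.
case/orP => ux.
  by have [] := touchedP ux (triangle_hit vS nt vu va ux).
by have [] := touchedP ux (triangle_hit vS nt vu vb ux).
Qed.

Definition near_both x y : {set 'I_n} := [set z in plain | e z x && e z y].
Definition near_one x y : {set 'I_n} := [set w in plain | e w x && ~~ e w y].
Definition small_side x y : {set 'I_n} :=
  if #|near_both x y| <= k then near_both x y else near_one x y.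
Definition small : {set 'I_n} := over_pairs small_side.

(** If both sides exceed [k], every [z] in [near_both] has all of [near_one] among its tails, since
    plain vertices are pairwise nonadjacent; then [xy] would be forced. *)
Lemma card_small : #|small| <= k * (2 * k).
Proof.
apply: card_over_pairs => x y exy; have := noE x y.
rewrite /forced exy /= negb_or -!leqNgt /small_side => /andP [_].
case: (leqP #|near_both x y| k) => // lt; apply: contraLR; rewrite -!ltnNge => lt1.
apply: leq_trans lt _; apply/subset_leq_card/subsetP => z zZ.
have [zp /andP [zx zy]] : z \in plain /\ e z x && e z y by apply/andP; move: zZ; rewrite /near_both inE.
rewrite inE zx zy /=; apply: leq_trans lt1 _; apply/subset_leq_card/subsetP => w wW.
have [wp /andP [wx wy]] : w \in plain /\ e w x && ~~ e w y by apply/andP; move: wW; rewrite /near_one inE.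
have [[wS _ _ _] _] := plainP wp.
rewrite inE wx wy /=; apply/and3P; split.
- by apply/negP => wz; case/negP: wS; apply: (plain_sub zp); rewrite se.
- by apply: contraNneq wS => ->; apply: plain_sub zy.
- by apply: contraNneq wy => ->.
Qed.

Lemma plain_nbhd v w s : v \in plain -> w \in plain -> v \notin small -> w \notin small ->
  e v s -> e w s -> {subset e v <= e w}.
Proof.
move=> vp wp vs ws es fs t; rewrite -!topredE /= => et; apply/negPn/negP => nft.
have [[vS /inTP [a [b [va vb ab]]] nt _] _] := plainP vp.
(* Some path from [s] to [t] inside the neighbourhood of [v] has length at most 2; along it [w]
   stops being adjacent at some edge [s1 t1], and [small_side] there contains [v] or [w]. *)
suff [s1 [t1 [es1 et1 st fs1 nft1]]] : exists s1 t1, [/\ e v s1, e v t1, e s1 t1, e w s1 & ~~ e w t1].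
  have hA1 := triangle_hit vS nt es1 et1 st.
  have m1 : v \in near_both s1 t1 by rewrite inE vp es1.
  have m2 : w \in near_one s1 t1 by rewrite inE wp fs1.
  case lt: (#|near_both s1 t1| <= k).
    by case/negP: vs; apply: (over_pairsP st hA1); rewrite /small_side lt.
  by case/negP: ws; apply: (over_pairsP st hA1); rewrite /small_side lt.
have [p [vp' sp]] : exists p, e v p /\ e s p.
  by case/orP: (plain_near vp va vb ab es) => h; [exists a | exists b].
case st: (e s t); first by exists s, t.
have pt : e p t by have := plain_near vp es vp' sp et; rewrite se st /= se.
case fp: (e w p); first by exists p, t.
by exists s, p; rewrite fp.
Qed.

(** The exceptions in [apices] and [small] number at most [2 * k ^ 2] each. All others with a common
    touched neighbour are twins. *)
Lemma card_inF : #|inF| <= 4 * k * k + 2 * k * (k + 4).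
Proof.
pose G s := [set v in plain :\: small | e v s].
have cG s : #|G s| <= k + 4.
  have [->|[v]] := set_0Vmem (G s); first by rewrite cards0.
  rewrite [v \in G s]inE => /andP [/setDP [vp vs] es].
  have [[_ tv _ nr] _] := plainP vp.
  have nr' : ~~ replaceable e k v by apply: contra nr; rewrite /removable => ->; rewrite orbT.
  apply: leq_trans (card_twins tv nr'); apply/subset_leq_card/subsetP => w.
  rewrite [w \in G s]inE => /andP [/setDP [wp ws] fs]; rewrite inE; apply/twinP => u.
  by apply/idP/idP; [exact: (plain_nbhd wp vp ws vs fs es) | exact: (plain_nbhd vp wp vs ws es fs)].
have sub : inF \subset (apices :|: small) :|: \bigcup_(s in S) G s.
  apply/subsetP => v vF; rewrite !in_setU.
  case va: (v \in apices) => //=; case vs: (v \in small) => //=.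
  have vp : v \in plain by rewrite in_setD va.
  have [[_ /inTP [a [_ [ea _ _]]] _ _] _] := plainP vp.
  by apply/bigcupP; exists a; [exact: plain_sub ea | rewrite inE in_setD vs vp].
apply: leq_trans (subset_leq_card sub) _; apply: leq_trans (leq_card_setU _ _) (leq_add _ _).
  by apply: leq_trans (leq_card_setU _ _) _; have := card_apices; have := card_small; lia.
apply: leq_trans (card_bigcup_le (m := k + 4) _) _; first by move=> s _; apply: cG.
by rewrite leq_mul2r card_touched orbT.
Qed.

Definition inN : {set 'I_n} :=
  [set v | [&& v \notin S, ~~ inT e v & ~~ replaceable e k v]].

(** Being in no triangle, [v] fails to be replaceable only as the pendant vertex of a paw on some
    triangle [abc]. The deleted edge of this paw makes [a] touched or an apex of [bc]. The vertices
    at the same [a] miss [b] and [c], so they look alike. *)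
Lemma card_inN : #|inN| <= (2 * k + k * (2 * k)) * k.+1.
Proof.
pose G a := [set v in inN | e v a && [exists b, exists c,
  [&& b != v, c != v, e a b, e b c, e a c & #|[set u | (u != v) && alike e v a b c u]| <= k]]].
have cG a : #|G a| <= k.+1.
  have [->|[v]] := set_0Vmem (G a); first by rewrite cards0.
  rewrite [v \in G a]inE => /and3P [vN va /existsP [b /existsP [c /and5P [bv cv ab bc /andP [ac le]]]]].
  have noT u x y : u \in inN -> e u a -> e a x -> e x y -> e a y -> u != x /\ e u x = false.
    rewrite inE => /and3P [_ nt _] ua ax xy ay; split.
      by apply: contraNneq nt => ->; apply/inTP; exists a, y; rewrite se.
    by apply/negP => ux; case/negP: nt; apply/inTP; exists a, x.
  have sub : G a \subset v |: [set u | (u != v) && alike e v a b c u].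
    apply/subsetP => u; rewrite [u \in G a]inE => /and3P [uN ua _]; rewrite in_setU1 inE.
    case: (u == v) => //=; rewrite /alike.
    have cb : e c b by rewrite se.
    have [-> ->] := noT u b c uN ua ab bc ac; have [-> ->] := noT u c b uN ua ac cb ab.
    have [_ ->] := noT v b c vN va ab bc ac; have [_ ->] := noT v c b vN va ac cb ab.
    by rewrite ua va (neq_adj ie ua).
  apply: leq_trans (subset_leq_card sub) _; rewrite cardsU1.
  by rewrite -add1n; apply: leq_add => //; case: (_ \notin _).
have sub : inN \subset \bigcup_(a in S :|: apices) G a.
  apply/subsetP => v vN; have := vN; rewrite inE => /and3P [vS nt].
  rewrite negb_forall => /existsP [a]; rewrite negb_forall => /existsP [b].
  rewrite negb_forall => /existsP [c]; rewrite negb_imply -leqNgt (negPf nt) /=.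
  move=> /andP [/and5P [av bv cv ab /and3P [bc ac va]] le].
  have noT x y : e a x -> e x y -> e a y -> ~~ e v x.
    by move=> ax xy ay; apply/negP => vx; case/negP: nt; apply/inTP; exists a, x.
  have cb : e c b by rewrite se.
  have nvb := noT b c ab bc ac; have nvc := noT c b ac cb ab.
  apply/bigcupP; exists a; last first.
    rewrite inE vN va; apply/existsP; exists b; apply/existsP; exists c.
    by rewrite bv cv ab bc ac.
  have ba : e b a by rewrite se.
  have ca : e c a by rewrite se.
  have av' : e a v by rewrite se.
  have nbv : ~~ e b v by rewrite se.
  have ncv : ~~ e c v by rewrite se.
  rewrite inE; case: (paw_hit se ie pf bc ca ba av' nbv ncv) => hit.
  - apply/orP; right; apply: (over_pairsP bc hit).
    by rewrite inE ab ac; apply/existsP; exists v; rewrite va nvb nvc.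
  - by have [_ ->] := touchedP ca hit.
  - by have [_ ->] := touchedP ba hit.
  - by have [_ vS'] := touchedP av' hit; rewrite vS' in vS.
apply: leq_trans (subset_leq_card sub) _.
apply: leq_trans (card_bigcup_le (m := k.+1) _) _; first by move=> s _; apply: cG.
rewrite leq_mul2r; apply/orP; right; apply: leq_trans (leq_card_setU _ _) _.
exact: leq_add card_touched card_apices.
Qed.

Lemma card_reduced : (forall v, [exists u, e v u] -> ~~ removable e k v) ->
  #|[set v | [exists u, e v u]]| <= 76 * k ^ 3 + 76.
Proof.
move=> nr.
have sub : [set v | [exists u, e v u]] \subset S :|: (inM :|: (inF :|: inN)).
  apply/subsetP => v; rewrite [v \in _]inE => /nr nrv; rewrite !in_setU.
  case vS: (v \in S) => //=; rewrite [v \in inF]inE [v \in inN]inE [v \in inM]inE vS nrv /= !andbT.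
  case tH: (inT H v) => //=; case te: (inT e v) => //=.
  by apply: contra nrv; rewrite /removable => ->; rewrite orbT.
have U (x y : {set 'I_n}) m p : #|x| <= m -> #|y| <= p -> #|x :|: y| <= m + p.
  by move=> h1 h2; apply: leq_trans (leq_card_setU _ _) (leq_add h1 h2).
apply: leq_trans (subset_leq_card sub) _.
apply: leq_trans (U _ _ _ _ card_touched (U _ _ _ _ card_inM (U _ _ _ _ card_inF card_inN))) _.
(* The sum is [2 * k ^ 3 + 22 * k ^ 2 + 52 * k], and 2 + 22 + 52 = 76. *)
rewrite expnS expnS expn1; nia.
Qed.

End Bound.

(** * Discarding isolated vertices *)

Lemma solvable_embed m n (e : rel 'I_n) (f : 'I_m -> 'I_n) k :
  injective f -> (forall x, [exists u, e x u] -> exists i, f i = x) ->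
  symmetric e -> solvable e k <-> solvable (fun i j => e (f i) (f j)) k.
Proof.
move=> fI surj se; split=> [[A hA pf]|[A hA pf]].
  exists [set a : {set 'I_m} | f @: a \in A].
    rewrite -(card_imset _ (imset_inj fI)); apply: leq_trans hA.
    by apply/subset_leq_card/subsetP => _ /imsetP [a + ->]; rewrite inE.
  move=> x1 x2 x3 x4; apply/negP => pw; apply: (negP (pf (f x1) (f x2) (f x3) (f x4))).
  move: pw; rewrite /induced_paw -(map_inj_uniq fI) /=.
  suff E i j : dl (fun i j => e (f i) (f j)) [set a : {set 'I_m} | f @: a \in A] i j = dl e A (f i) (f j).
    by rewrite !E.
  by rewrite /dl inE imsetU !imset_set1.
exists [set f @: (a : {set 'I_m}) | a in A].
  by apply: leq_trans (leq_imset_card _ _) hA.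
move=> y1 y2 y3 y4; apply/negP => pw.
have [[_ /andP [h12 _] /andP [h23 _] _] [/andP [h34 _] _ _]] := pawP pw.
have ex x y : e x y -> exists i, f i = x by move=> exy; apply: surj; apply/existsP; exists y.
have [x1 E1] := ex _ _ h12; have [x2 E2] := ex _ _ h23; have [x3 E3] := ex _ _ h34.
have [x4 E4] : exists i, f i = y4 by apply: (ex _ y3); rewrite se.
apply: (negP (pf x1 x2 x3 x4)); move: pw; rewrite -E1 -E2 -E3 -E4 /induced_paw.
rewrite -[uniq [:: x1; x2; x3; x4]](map_inj_uniq fI) /=.
suff E i j : dl e [set f @: (a : {set 'I_m}) | a in A] (f i) (f j) = dl (fun i j => e (f i) (f j)) A i j.
  by rewrite !E.
rewrite /dl; congr (_ && ~~ _).
have -> : [set f i; f j] = f @: [set i; j] by rewrite imsetU !imset_set1.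
by rewrite mem_imset //; apply: imset_inj.
Qed.

(** * The reduction rules as formulas *)

Definition FImp f g := FNot (FAnd f (FNot g)).
Definition FOr f g := FNot (FAnd (FNot f) (FNot g)).
Definition FIff f g := FAnd (FImp f g) (FImp g f).
Definition FEx f := FCnt false f.
Definition FAll f := FNot (FEx (FNot f)).

Definition adjm (n : nat) (M : seq bool) : rel 'I_n := fun i j => madj n M i j.

Lemma count_ord n (P : pred nat) : count P (iota 0 n) = #|[set x : 'I_n | P x]|.
Proof. by rewrite -val_enum_ord count_map cardsE cardE size_filter -enumT. Qed.

Lemma sat_adj n g k r i j : sat n g k r (FAdj i j) = g (nth 0 r i) (nth 0 r j).
Proof. by []. Qed.

Lemma sat_eq n g k r i j : sat n g k r (FEq i j) = (nth 0 r i == nth 0 r j).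
Proof. by []. Qed.

Lemma sat_not n g k r f : sat n g k r (FNot f) = ~~ sat n g k r f.
Proof. by []. Qed.

Lemma sat_and n g k r f1 f2 : sat n g k r (FAnd f1 f2) = sat n g k r f1 && sat n g k r f2.
Proof. by []. Qed.

Lemma sat_or n g k r f1 f2 : sat n g k r (FOr f1 f2) = sat n g k r f1 || sat n g k r f2.
Proof. by rewrite /= negb_and !negbK. Qed.

Lemma sat_imp n g k r f1 f2 : sat n g k r (FImp f1 f2) = (sat n g k r f1 ==> sat n g k r f2).
Proof. by rewrite /= negb_and negbK implybE. Qed.

Lemma sat_iff n g k r f1 f2 : sat n g k r (FIff f1 f2) = (sat n g k r f1 == sat n g k r f2).
Proof. by rewrite /FIff sat_and !sat_imp; case: sat; case: sat. Qed.

Lemma sat_many n g k r f : sat n g k r (FCnt true f) = (k < #|[set x : 'I_n | sat n g k (val x :: r) f]|).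
Proof. by rewrite /= count_ord. Qed.

Lemma sat_ex n g k r f : sat n g k r (FEx f) = [exists x : 'I_n, sat n g k (val x :: r) f].
Proof.
rewrite /= count_ord; apply/card_gt0P/existsP => [] [x]; first by rewrite inE; exists x.
by exists x; rewrite inE.
Qed.

Lemma sat_all n g k r f : sat n g k r (FAll f) = [forall x : 'I_n, sat n g k (val x :: r) f].
Proof.
by rewrite sat_not sat_ex negb_exists; apply: eq_forallb => x; rewrite sat_not negbK.
Qed.

Definition satE := (sat_or, sat_imp, sat_iff, sat_many, sat_ex, sat_all, sat_not, sat_and, sat_adj, sat_eq).

Definition fTwin i j := FAll (FIff (FAdj i.+1 0) (FAdj j.+1 0)).

Definition fInT i := FEx (FEx (FAnd (FAdj i.+2 1) (FAnd (FAdj i.+2 0) (FAdj 1 0)))).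

(** [y] and [x] are the variables 0 and 1, shifted by one under each quantifier. *)
Definition fForced := FAnd (FAdj 1 0) (FOr
  (FCnt true (FAnd (FAdj 0 2) (FAnd (FAdj 0 1)
     (FEx (FAnd (FAdj 0 1) (FAnd (FNot (FAdj 0 3)) (FNot (FAdj 0 2))))))))
  (FCnt true (FAnd (FAdj 0 2) (FAnd (FAdj 0 1)
     (FCnt true (FAnd (FAdj 0 3) (FAnd (FNot (FAdj 0 2)) (FAnd (FNot (FAdj 0 1))
        (FAnd (FNot (FEq 0 2)) (FNot (FEq 0 1))))))))))).

Definition fUnlink := FAnd (FAdj 1 0)
  (FAnd (FNot (FAnd (FEq 1 3) (FEq 0 2))) (FNot (FAnd (FEq 1 2) (FEq 0 3)))).

Definition fLinked := FEx (FAdj 1 0).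

Definition fMulti := FAnd
  (FAll (FAll (FImp (FAdj 2 1) (FImp (FAdj 1 0) (FOr (FAdj 2 0) (fTwin 0 2))))))
  (FAll (FAll (FAll (FImp (FAnd (FAdj 3 2) (FAnd (FAdj 3 1) (FAnd (FAdj 3 0) (FAdj 2 0))))
     (FOr (FAdj 2 1) (FAdj 1 0)))))).

(* [u], [c], [b], [a], [v] are the variables 0 to 4. *)
Definition fAlike := FAnd (FNot (FEq 0 3)) (FAnd (FNot (FEq 0 2)) (FAnd (FNot (FEq 0 1))
  (FAnd (FIff (FAdj 0 3) (FAdj 4 3)) (FAnd (FIff (FAdj 0 2) (FAdj 4 2)) (FIff (FAdj 0 1) (FAdj 4 1)))))).

Definition fRepl := FAll (FAll (FAll (FImp
  (FAnd (FNot (FEq 2 3)) (FAnd (FNot (FEq 1 3)) (FAnd (FNot (FEq 0 3))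
     (FOr (fInT 3) (FAnd (FAdj 2 1) (FAnd (FAdj 1 0) (FAnd (FAdj 2 0) (FAdj 3 2))))))))
  (FCnt true (FAnd (FNot (FEq 0 4)) fAlike))))).

Definition fClass := FAll (FAll (FAll (FImp
  (FAnd (FNot (fTwin 2 3)) (FAnd (FNot (fTwin 1 3)) (FNot (fTwin 0 3))))
  (FCnt true (FAnd (FNot (fTwin 0 4)) fAlike))))).

(** Demanding an edge at [v] makes every application lose an edge, so the process terminates. *)
Definition fRemove := FAnd fLinked (FOr fMulti (FOr fRepl fClass)).

Definition fIsolate := FAnd (FAdj 1 0) (FAnd (FNot (FEq 1 2)) (FNot (FEq 0 2))).

Definition fKept := FAnd (FEx (FAdj 2 0)) (FEx (FAdj 1 0)).

Lemma sat_twin n M k r i j (x y : 'I_n) : nth 0 r i = x -> nth 0 r j = y ->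
  sat n (madj n M) k r (fTwin i j) = twin (@adjm n M) x y.
Proof. by move=> hx hy; rewrite sat_all; apply: eq_forallb => w; rewrite !satE /= hx hy. Qed.

Lemma sat_ntwin n M k r i j (x y : 'I_n) : nth 0 r i = x -> nth 0 r j = y ->
  sat n (madj n M) k r (FNot (fTwin i j)) = ~~ twin (@adjm n M) x y.
Proof. by move=> hx hy; rewrite sat_not (sat_twin _ _ hx hy). Qed.

Lemma sat_inT n M k r i (x : 'I_n) : nth 0 r i = x -> sat n (madj n M) k r (fInT i) = inT (@adjm n M) x.
Proof.
move=> hx; rewrite sat_ex; apply: eq_existsb => p; rewrite sat_ex; apply: eq_existsb => q.
by rewrite !satE /= hx.
Qed.

Lemma sat_forced n M k (x y : 'I_n) :
  sat n (madj n M) k [:: val y; val x] fForced = forced (@adjm n M) k x y.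
Proof.
rewrite sat_and sat_or !sat_many /forced; congr (_ && ((k < _) || (k < _))); apply: eq_card => z.
  by rewrite !inE !sat_and sat_ex; congr [&& _, _ & _].
by rewrite !inE !sat_and sat_many; congr [&& _, _ & k < _].
Qed.

Lemma sat_linked n M k (v : 'I_n) r :
  sat n (madj n M) k (val v :: r) fLinked = [exists u, @adjm n M v u].
Proof. by rewrite sat_ex; apply: eq_existsb => u; rewrite !satE. Qed.

Lemma sat_alike n M k (u c b a v : 'I_n) :
  sat n (madj n M) k [:: val u; val c; val b; val a; val v] fAlike = alike (@adjm n M) v a b c u.
Proof. by rewrite !satE. Qed.

Lemma sat_remove n M k (v : 'I_n) : sat n (madj n M) k [:: val v] fRemove =
  [exists u, @adjm n M v u] && removable (@adjm n M) k v.
Proof.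
rewrite sat_and sat_linked !sat_or; congr (_ && [|| _, _ | _]).
- rewrite sat_and !sat_all; congr (_ && _); apply: eq_forallb => a; rewrite sat_all; apply: eq_forallb => b.
    by rewrite 2!sat_imp sat_or (@sat_twin _ _ _ _ _ _ b v).
  by rewrite sat_all; apply: eq_forallb => c; rewrite !satE.
- rewrite sat_all; apply: eq_forallb => a; rewrite sat_all; apply: eq_forallb => b.
  rewrite sat_all; apply: eq_forallb => c; rewrite sat_imp !sat_and sat_or (@sat_inT _ _ _ _ _ v) //.
  rewrite !sat_and sat_many; congr (_ ==> (k < _)); apply: eq_card => u.
  by rewrite !inE sat_and sat_alike.
- rewrite sat_all; apply: eq_forallb => a; rewrite sat_all; apply: eq_forallb => b.
  rewrite sat_all; apply: eq_forallb => c; rewrite sat_imp 2!sat_and sat_many.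
  rewrite (@sat_ntwin _ _ _ _ _ _ a v) // (@sat_ntwin _ _ _ _ _ _ b v) // (@sat_ntwin _ _ _ _ _ _ c v) //.
  congr (_ ==> (k < _)); apply: eq_card => u.
  by rewrite !inE sat_and sat_alike (@sat_ntwin _ _ _ _ _ _ u v).
Qed.

(** * Termination at a reduced instance *)

Section Descent.
Variables (S : Type) (mu : S -> nat) (Inv : S -> Prop).

Definition descends (F : S -> S) : Prop :=
  forall s, Inv s -> Inv (F s) /\ (F s = s \/ mu (F s) < mu s).

Lemma descends_fixed F s : descends F -> Inv s -> mu s <= mu (F s) -> F s = s.
Proof. by move=> dF /dF [_ [//|lt]] le; have := leq_trans lt le; rewrite ltnn. Qed.

Lemma descends_le F s : descends F -> Inv s -> mu (F s) <= mu s.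
Proof. by move=> dF /dF [_ [->|/ltnW]]. Qed.

Lemma descends_comp F G : descends F -> descends G -> descends (G \o F).
Proof.
move=> dF dG s Is; have [IF hF] := dF s Is; have [IG hG] := dG _ IF; split=> //=.
case: hF hG => [-> //|lt] [->|lt']; right=> //; exact: ltn_trans lt' lt.
Qed.

(** Neither map raises the measure, so returning to [s] leaves no room for a strict drop. *)
Lemma descends_comp_fixed F G s : descends F -> descends G -> Inv s -> G (F s) = s -> F s = s /\ G s = s.
Proof.
move=> dF dG Is E; have [IF _] := dF s Is.
have Fs : F s = s by apply: descends_fixed => //; rewrite -{1}E; apply: descends_le.
by rewrite Fs in E.
Qed.

Lemma descends_fold (T : eqType) (F : S -> T -> S) (xs : seq T) :
  (forall x, x \in xs -> descends (F^~ x)) -> descends (fun s => foldl F s xs).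
Proof.
elim: xs => [|x xs IH] h; first by move=> s Is; split=> //; left.
have dF : descends (F^~ x) by apply: h; rewrite inE eqxx.
have dG : descends (fun s => foldl F s xs) by apply: IH => y hy; apply: h; rewrite inE hy orbT.
exact: (descends_comp dF dG).
Qed.

Lemma descends_fold_fixed (T : eqType) (F : S -> T -> S) (xs : seq T) s :
  (forall x, x \in xs -> descends (F^~ x)) -> Inv s -> foldl F s xs = s ->
  forall x, x \in xs -> F s x = s.
Proof.
elim: xs => //= x xs IH h Is E y.
have hx : descends (F^~ x) by apply: h; rewrite inE eqxx.
have hxs z : z \in xs -> descends (F^~ z) by move=> hz; apply: h; rewrite inE hz orbT.
have [Ex Es] := descends_comp_fixed hx (descends_fold hxs) Is E.
by rewrite inE => /orP [/eqP -> //|]; apply: IH.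
Qed.

Lemma descends_iter F s N : descends F -> Inv s -> mu s <= N ->
  Inv (iter N F s) /\ F (iter N F s) = iter N F s.
Proof.
move=> dF; elim: N s => [|N IH] s Is le.
  by split=> //; apply: descends_fixed => //; apply: leq_trans le _.
rewrite !iterSr; have [IFs [E|lt]] := dF s Is; last by apply: IH => //; lia.
have fx j : iter j F s = s by elim: j => //= j ->.
by rewrite E fx.
Qed.

End Descent.

Lemma adjm_mx n (g : nat -> nat -> bool) (i j : 'I_n) : adjm (mx n g) i j = g i j.
Proof. exact: madj_mx. Qed.

Lemma solvable_ext n (e e' : rel 'I_n) k : e =2 e' -> solvable e k -> solvable e' k.
Proof.
move=> E [A hA pf]; exists A => // x1 x2 x3 x4; rewrite -(paw_ext (e := dl e A)) //.
by move=> x y _ _; rewrite /dl E.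
Qed.

Lemma solvable_extE n (e e' : rel 'I_n) k : e =2 e' -> solvable e k <-> solvable e' k.
Proof. by move=> E; split; apply: solvable_ext => // x y; rewrite E. Qed.

Definition state := (seq bool * nat)%type.

Definition edges n (s : state) : nat := #|[set p : 'I_n * 'I_n | adjm s.1 p.1 p.2]|.

Definition reduction_inv n (P : Prop) (k0 : nat) (s : state) : Prop :=
  [/\ size s.1 = n * n, symmetric (@adjm n s.1), irreflexive (@adjm n s.1), s.2 <= k0 &
      P <-> solvable (@adjm n s.1) s.2].

Lemma edges_lt n (M : seq bool) (g : nat -> nat -> bool) k k' (x y : 'I_n) :
  (forall i j : 'I_n, g i j -> adjm M i j) -> adjm M x y -> ~~ g x y ->
  edges n (mx n g, k') < edges n (M, k).
Proof.
move=> sub xy nxy; apply/proper_card/properP; split.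
  by apply/subsetP => -[i j]; rewrite !inE /= adjm_mx; apply: sub.
by exists (x, y); rewrite !inE //= adjm_mx.
Qed.

Lemma sat_unlink n M k (x y i j : 'I_n) :
  sat n (madj n M) k [:: val j; val i; val y; val x] fUnlink = unlink (@adjm n M) x y i j.
Proof. by []. Qed.

Lemma sat_isolate n M k (v i j : 'I_n) :
  sat n (madj n M) k [:: val j; val i; val v] fIsolate = isolate (@adjm n M) v i j.
Proof. by []. Qed.

Lemma unlink_step n P k0 (x y : 'I_n) :
  descends (edges n) (@reduction_inv n P k0) (delfun n fForced fUnlink [:: val y; val x]).
Proof.
move=> [M k] [/= sM sy ir lek eqv]; rewrite /delfun sat_forced /=.
case: ifP => // hf; last by split=> //; left.
case: k hf lek eqv => [|k] hf lek eqv; first by split=> //; left.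
set M' := mx _ _.
have E : @adjm n M' =2 unlink (@adjm n M) x y by move=> i j; rewrite adjm_mx; exact: sat_unlink.
have exy : adjm M x y by case/andP: hf.
split; last first.
  right; apply: (@edges_lt n M _ _ _ x y) => //.
    by move=> i j /andP [].
  by rewrite [X in ~~ X](sat_unlink M k x y x y) /unlink exy !eqxx.
split=> /=; first exact: size_mx.
- move=> i j; rewrite !E /unlink sy.
  by case: (adjm M j i); case: (i == x); case: (j == y); case: (i == y); case: (j == x).
- by move=> i; rewrite E /unlink ir.
- exact: ltnW.
- by rewrite eqv (solvable_unlink sy ir hf); apply: solvable_extE => i j; rewrite E.
Qed.

Lemma isolate_step n P k0 (v : 'I_n) :
  descends (edges n) (@reduction_inv n P k0) (isofun n fRemove fIsolate [:: val v]).
Proof.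
move=> [M k] [/= sM sy ir lek eqv]; rewrite /isofun sat_remove /=.
case: ifP => // [/andP [/existsP [u evu] hr]|_]; last by split=> //; left.
set M' := mx _ _.
have E : @adjm n M' =2 isolate (@adjm n M) v by move=> i j; rewrite adjm_mx; exact: sat_isolate.
split; last first.
  right; apply: (@edges_lt n M _ _ _ v u) => //.
    by move=> i j /andP [].
  by rewrite [X in ~~ X](sat_isolate M k v v u) /isolate evu eqxx.
split=> //=; first exact: size_mx.
- by move=> i j; rewrite !E /isolate sy; congr (_ && _); rewrite andbC.
- by move=> i; rewrite E /isolate ir.
- by rewrite eqv (solvable_removable sy ir hr); apply: solvable_extE => i j; rewrite E.
Qed.

Lemma round_step n P k0 : descends (edges n) (@reduction_inv n P k0) (round n fForced fUnlink fRemove fIsolate).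
Proof.
apply: (@descends_comp _ _ _
  (fun s => foldl (fun s x => foldl (fun s y => delfun n fForced fUnlink [:: y; x] s) s (iota 0 n)) s (iota 0 n))
  (fun s => foldl (fun s v => isofun n fRemove fIsolate [:: v] s) s (iota 0 n))).
  apply: descends_fold => x; rewrite mem_iota /= add0n => lx; apply: descends_fold => y; rewrite mem_iota /= add0n => ly.
  exact: (@unlink_step n P k0 (Ordinal lx) (Ordinal ly)).
apply: descends_fold => v; rewrite mem_iota /= add0n => lv; exact: (@isolate_step n P k0 (Ordinal lv)).
Qed.

(** A rule that still applied would lower the parameter or the number of edges. *)
Lemma round_fixed n P k0 s : @reduction_inv n P k0 s -> round n fForced fUnlink fRemove fIsolate s = s ->
  (forall x y : 'I_n, 0 < s.2 -> ~~ forced (@adjm n s.1) s.2 x y) /\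
  (forall v : 'I_n, [exists u, @adjm n s.1 v u] -> ~~ removable (@adjm n s.1) s.2 v).
Proof.
move=> Is E.
have d1 (x : nat) : x \in iota 0 n -> descends (edges n) (@reduction_inv n P k0)
    (fun s => foldl (fun s y => delfun n fForced fUnlink [:: y; x] s) s (iota 0 n)).
  rewrite mem_iota /= add0n => lx; apply: descends_fold => y; rewrite mem_iota /= add0n => ly.
  exact: (@unlink_step n P k0 (Ordinal lx) (Ordinal ly)).
have d2 (v : nat) : v \in iota 0 n -> descends (edges n) (@reduction_inv n P k0) (isofun n fRemove fIsolate [:: v]).
  by rewrite mem_iota /= add0n => lv; exact: (@isolate_step n P k0 (Ordinal lv)).
have [E1 E2] := descends_comp_fixed (descends_fold d1) (descends_fold d2) Is E.
have mi (x : 'I_n) : val x \in iota 0 n by rewrite mem_iota /=.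
split.
- move=> x y s0; have Ex := descends_fold_fixed d1 Is E1 (mi x).
  have dy z : z \in iota 0 n -> descends (edges n) (@reduction_inv n P k0) (delfun n fForced fUnlink [:: z; val x]).
    by rewrite mem_iota /= add0n => lz; exact: (@unlink_step n P k0 x (Ordinal lz)).
  have := descends_fold_fixed dy Is Ex (mi y).
  rewrite /delfun sat_forced; case: ifP => // hf; case: s s0 {Is E E1 E2 Ex} hf => M [|k] //= _ _ [_ /eqP].
  by rewrite ltn_eqF.
- move=> v lv; have := descends_fold_fixed d2 Is E2 (mi v).
  rewrite /isofun sat_remove lv /=; case: ifP => // hr E3.
  have := @edges_lt n s.1 (fun i j => sat n (madj n s.1) s.2 [:: j; i; val v] fIsolate) s.2 s.2 v.
  move/existsP: lv => [u evu] /(_ u); rewrite E3 -surjective_pairing ltnn => h; exfalso.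
  suff : false by []; apply: h => //.
    by move=> i j /andP [].
  by rewrite [X in ~~ X](sat_isolate s.1 s.2 v v u) /isolate evu eqxx.
Qed.

Lemma reduce_ok n P k0 s : @reduction_inv n P k0 s ->
  let s' := reduce n fForced fUnlink fRemove fIsolate s in
  @reduction_inv n P k0 s' /\
  (P -> count (fun x => sat n (madj n s'.1) s'.2 [:: x] fLinked) (iota 0 n) <= 76 * s'.2 ^ 3 + 76).
Proof.
move=> Is s'.
have [|Is' fx] := descends_iter (N := n * n) (@round_step n P k0) Is.
  by apply: leq_trans (max_card _) _; rewrite card_prod card_ord.
split=> // hP; have [noE noV] := round_fixed Is' fx.
have [_ sy ir _ eqv] := Is'; have [A hA pf] := eqv.1 hP.
have noE' x y : ~~ forced (@adjm n s'.1) s'.2 x y.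
  (* At parameter 0 the edge rule is idle, but a solution is then empty and cannot contain a forced
     edge. *)
  case k0': (s'.2) => [|k]; last by rewrite -k0'; apply: noE; rewrite -/(reduce _ _ _ _ _ _) -/s' k0'.
  apply/negP => hf; have := forced_hit sy ir _ pf hf.
  rewrite -k0' => /(_ hA); have : #|A| = 0 by apply/eqP; rewrite -leqn0 -k0'.
  by move/cards0_eq => ->; rewrite inE.
have := card_reduced sy ir hA pf noE' noV; congr (_ <= _).
by rewrite count_ord; apply: eq_card => v; rewrite !inE sat_linked.
Qed.

(** * Encoded graphs, the induced output graph and the final assembly *)

Definition nat_adj (G : graph) (x y : nat) : bool :=
  if (insub x : option 'I_(vn G)) is Some i then
    if (insub y : option 'I_(vn G)) is Some j then adj G i j else false
  else false.

Lemma adj_bitsE G : adj_bits G = mx (vn G) (nat_adj G).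
Proof.
rewrite /mx -val_enum_ord allpairs_mapl allpairs_mapr.
congr flatten; apply: eq_map => i; apply: eq_map => j.
by rewrite /nat_adj !valK.
Qed.

Lemma adjm_bits G : @adjm (vn G) (adj_bits G) =2 adj G.
Proof. by move=> i j; rewrite adj_bitsE adjm_mx /nat_adj !valK. Qed.

Lemma solvable_all n (e : rel 'I_n) k : n * n <= k -> solvable e k.
Proof.
move=> le; exists [set [set p.1; p.2] | p : 'I_n * 'I_n].
  by apply: leq_trans (leq_imset_card _ _) _; rewrite card_prod card_ord.
move=> x1 x2 x3 x4; apply/negP => /pawP [[_ /andP [_ /negP h] _ _] _]; apply: h.
by apply/imsetP; exists (x1, x2).
Qed.

Lemma solvable_cap n (e : rel 'I_n) k : solvable e k <-> solvable e (minn k (n * n)).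
Proof.
case: (leqP k (n * n)) => // lt.
by split=> _; apply: solvable_all => //; exact: ltnW.
Qed.

Definition paw_adj (i j : 'I_4) : bool :=
  [&& val i != val j, ~~ ((val i == 3) && (val j < 2)) & ~~ ((val j == 3) && (val i < 2))].

Lemma paw_adj_sym x y : paw_adj x y = paw_adj y x.
Proof. by rewrite /paw_adj eq_sym; congr (_ && _); rewrite andbC. Qed.

Lemma paw_adj_irr x : paw_adj x x = false.
Proof. by rewrite /paw_adj eqxx. Qed.

Definition paw : graph := Graph paw_adj_sym paw_adj_irr.

Lemma paw_unsolvable : ~ solvable (adj paw) 0.
Proof.
move=> [A hA pf]; have A0 : A = set0 by apply/eqP; rewrite -cards_eq0 -leqn0.
pose v i : i < 4 -> 'I_4 := @Ordinal 4 i.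
apply: (negP (pf (v 0 isT) (v 1 isT) (v 2 isT) (v 3 isT))).
by rewrite /induced_paw /dl A0 !inE.
Qed.

Section Induced.
Variables (n : nat) (g : nat -> nat -> bool) (p : pred nat).
Hypotheses (sg : forall x y, x < n -> y < n -> g x y = g y x) (ig : forall x, x < n -> g x x = false).

Definition kept : seq nat := [seq x <- iota 0 n | p x].

Lemma kept_lt (i : 'I_(size kept)) : nth 0 kept i < n.
Proof. by have := mem_nth 0 (ltn_ord i); rewrite mem_filter mem_iota => /andP []. Qed.

Definition induced_adj (i j : 'I_(size kept)) : bool := g (nth 0 kept i) (nth 0 kept j).

Lemma induced_sym i j : induced_adj i j = induced_adj j i.
Proof. by apply: sg; apply: kept_lt. Qed.

Lemma induced_irr i : induced_adj i i = false.
Proof. by apply: ig; apply: kept_lt. Qed.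

Definition induced : graph := Graph induced_sym induced_irr.

(** Scanning the full matrix and skipping discarded rows and columns yields the bits of the smaller
    graph in its own row order. *)
Lemma adj_bits_induced : adj_bits induced =
  flatten [seq [seq g i j | j <- iota 0 n & p i && p j] | i <- iota 0 n].
Proof.
have nthk : [seq nth 0 kept (val i) | i <- enum 'I_(size kept)] = kept.
  by rewrite (map_comp (nth 0 kept) val) val_enum_ord map_nth_iota0 // take_size.
have <- : [seq g x y | x <- kept, y <- kept] = adj_bits induced.
  have <- : [seq g x y | x <- [seq nth 0 kept (val i) | i <- enum 'I_(size kept)],
      y <- [seq nth 0 kept (val i) | i <- enum 'I_(size kept)]] = adj_bits induced.
    by rewrite allpairs_mapl allpairs_mapr.
  by rewrite nthk.
have gen s : [seq g x y | x <- [seq x <- s | p x], y <- kept] =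
    flatten [seq [seq g i j | j <- iota 0 n & p i && p j] | i <- s].
  elim: s => //= x s IH; case px: (p x) => /=; rewrite IH //.
  by rewrite (eq_filter (a2 := pred0)) ?filter_pred0.
exact: gen.
Qed.

Lemma solvable_induced (e : rel 'I_n) k : (forall i j : 'I_n, e i j = g i j) ->
  (forall i : 'I_n, [exists u, e i u] -> p i) ->
  solvable e k <-> solvable (adj induced) k.
Proof.
move=> E hp; have se : symmetric e by move=> x y; rewrite !E sg.
pose f i : 'I_n := Ordinal (kept_lt i).
rewrite (solvable_embed k (f := f)) //.
- by apply: solvable_extE => i j; rewrite E.
- move=> i j /(congr1 val) /= /eqP; rewrite nth_uniq // ?filter_uniq ?iota_uniq //.
  by move=> /eqP /val_inj.
- move=> x /hp px; have xk : val x \in kept by rewrite mem_filter px mem_iota /=.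
  have lx : index (val x) kept < size kept by rewrite index_mem.
  by exists (Ordinal lx); apply: val_inj; rewrite /= nth_index.
Qed.

End Induced.

Definition kernel_cmd : cmd :=
  kernelize fForced fUnlink fRemove fIsolate fLinked fKept 76 (encode paw 0).

Lemma size_encode G k : size (encode G k) = (size (bin (vn G)) + size (bin k) + vn G * vn G).*2 + 6.
Proof.
have sf w : size (field w) = (size w).*2 + 2.
  by rewrite /field size_cat; elim: w => //= b w IH; lia.
by rewrite /encode size_cat sf size_cat !sf adj_bitsE size_mx; lia.
Qed.

Theorem theorem3 :
  exists (M : TM) (c d : nat),
    forall (G : graph) (k : nat),
      exists (t : nat) (G' : graph) (k' : nat),
        t <= c * (size (encode G k)) ^ c + c /\
        halts_within M (encode G k) t (encode G' k') /\
        k' <= k /\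
        vn G' <= d * k ^ 3 + d /\
        (paw_free_edge_deletion G k <-> paw_free_edge_deletion G' k').
Proof.
(* There are 14 stacks, and the input length [N] serves as the loop bound; the summands are those of
   [Mprog_halts]. *)
pose T N := 2 * 14 + time N (14 + N + grow N kernel_cmd) kernel_cmd + 3.
have [c hc] : exists c, forall N, 0 < N -> T N <= c * N ^ c + c.
  apply: polyb_expand; apply: polyb_add (polyb_const 3); apply: polyb_add (polyb_const 28) _.
  apply: polyb_time polyb_id _; apply: polyb_add; last exact: polyb_grow polyb_id.
  exact: polyb_add (polyb_const 14) polyb_id.
exists (Mprog 14 kernel_cmd), c, 76 => G k.
set N := size (encode G k); have N0 : 0 < N by rewrite /N size_encode; lia.
set n := vn G; set M := adj_bits G.
have sM : size M = n * n by rewrite /M adj_bitsE size_mx.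
pose P := paw_free_edge_deletion G k.
pose s0 : state := (M, minn k (n * n)).
have I0 : reduction_inv n P k s0.
  split=> //=; last 1 first.
  - rewrite /P solvableP solvable_cap; apply: solvable_extE => i j; rewrite adjm_bits //.
  - by move=> i j; rewrite !adjm_bits adj_sym.
  - by move=> i; rewrite adjm_bits adj_irr.
  - exact: geq_minl.
have [I1 bound] := reduce_ok I0; set s := reduce _ _ _ _ _ _ in I1 bound.
have [sM1 sy ir lek eqv] := I1.
(* [field] doubles every bit, so the input is long enough to bound all loops. *)
have NB : (n * n).*2.+1 <= N by rewrite /N size_encode -/n; lia.
have kB : size (bin k) <= N by rewrite /N size_encode; lia.
have [s' ex hs'] := kernelize_ok (fE := fForced) (dE := fUnlink) (fV := fRemove) (dV := fIsolate)
  (f := fLinked) (p := fKept) 76 (encode paw 0) isT isT isT isT isT isT sM NB kB.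
have wn : encode G k != [::] by rewrite -size_eq0 -lt0n.
have := @Mprog_halts N 14 kernel_cmd (encode G k) s' isT wn ex; rewrite {}hs' -/(T N) -/s.
set n' := count _ _; rewrite -/n' in bound.
case: ltnP => cmp halt.
  exists (T N), paw, 0; split; [exact: hc | split; [exact: halt | split=> //; split; first by rewrite /=; lia]].
  split=> [/bound|/solvableP /paw_unsolvable //].
  by rewrite leqNgt cmp.
pose p x := sat n (madj n s.1) s.2 [:: x] fLinked.
have sg x y : x < n -> y < n -> madj n s.1 x y = madj n s.1 y x.
  by move=> lx ly; exact: (sy (Ordinal lx) (Ordinal ly)).
have ig x : x < n -> madj n s.1 x x = false by move=> lx; exact: (ir (Ordinal lx)).
exists (T N), (induced p sg ig), s.2; split; first exact: hc.
have vn' : vn (induced p sg ig) = n' by rewrite /= /kept size_filter.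
split; last split=> //; last split.
- rewrite /encode vn' adj_bits_induced; exact: halt.
(* The size was tested against the final parameter, which is at most [k]. *)
- by rewrite vn'; apply: leq_trans cmp _; rewrite leq_add2r leq_mul2l leq_exp2r.
- rewrite -/P eqv solvableP; apply: solvable_induced => // i lu.
  by rewrite /p sat_linked.
Qed.
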